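(* Let $P_0=\begin{pmatrix} Q & S\\ S^T & R\end{pmatrix}\in\mathbb{S}^{k+l}$ with $R\preceq0$ (blocks $Q\in\mathbb{S}^k$, $R\in\mathbb{S}^l$) and let $$\mathbf{V}=\left\{V\in\mathbb{C}^{l\times k} \;\middle|\; \begin{pmatrix}I_k\\ V\end{pmatrix}^{*}P_0\begin{pmatrix}I_k\\ V\end{pmatrix}\succeq 0\right\}.$$ Let $\begin{pmatrix}A_\psi&B_\psi\\ C_\psi&D_\psi\end{pmatrix}\in\mathbb{R}^{(n_\psi+m_\psi)\times(n_\psi+1)}$ with $A_\psi\in\mathbb{R}^{n_\psi\times n_\psi}$ stable (Hurwitz) be given and abbreviate $J_\Psi:=\mathrm{diag}(I_k\otimes J_\psi,\,I_l\otimes J_\psi)$ for $J\in\{A,B,C,D\}$. Then the uncertain interconnection $$\begin{pmatrix}\dot x(t)\\ z(t)\end{pmatrix}=\begin{pmatrix}A&B\\ C&D\end{pmatrix}\begin{pmatrix}x(t)\\ w(t)\end{pmatrix},\quad w(t)=\Delta(z)(t),\quad t\ge0,\quad \Delta\in\mathbf{\Delta}(\mathbf{V}),$$ is robustly stable if there exist $X\in\mathbb{S}^{(k+l)n_\psi+n}$, $Y\in\mathbb{S}^{n_\psi}$ and $M\in\mathbb{S}^{m_\psi}$ satisfying $$\begin{pmatrix} I&0\\ A_\psi&B_\psi\end{pmatrix}^T\begin{pmatrix}0&Y\\ Y&0\end{pmatrix}\begin{pmatrix} I&0\\ A_\psi&B_\psi\end{pmatrix}+\begin{pmatrix}C_\psi&D_\psi\end{pmatrix}^TM\begin{pmatrix}C_\psi&D_\psi\end{pmatrix}\succ0,$$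 $$H^T\begin{pmatrix}0&X&0\\ X&0&0\\ 0&0&P_0\otimes M\end{pmatrix}H\prec0\quad\text{with}\quad H=\begin{pmatrix}I&0&0\\ 0&I&0\\ A_\Psi&B_\Psi\begin{pmatrix}C\\ 0\end{pmatrix}&B_\Psi\begin{pmatrix}D\\ I_l\end{pmatrix}\\ 0&A&B\\ C_\Psi&D_\Psi\begin{pmatrix}C\\ 0\end{pmatrix}&D_\Psi\begin{pmatrix}D\\ I_l\end{pmatrix}\end{pmatrix},$$ and $$X-\begin{pmatrix}P_0\otimes Y&0\\ 0&0\end{pmatrix}\succ0.$$
   Context: $\mathbb{S}^n$ is the set of real symmetric $n\times n$ matrices; $\otimes$ is the Kronecker product; ${}^*$ is the conjugate transpose; $L_{2e}^n$ is the space of locally square integrable functions $[0,\infty)\to\mathbb{R}^n$; $\mathrm{RH}_\infty^{m\times n}$ is the space of real rational $m\times n$ matrices without poles in the extended closed right half-plane. $A\in\mathbb{R}^{n\times n}$, $B\in\mathbb{R}^{n\times l}$, $C\in\mathbb{R}^{k\times n}$, $D\in\mathbb{R}^{k\times l}$ are given real matrices. Uncertainties: $\Delta$ is a stable LTI system with input-output map $\Delta:L_{2e}^k\to L_{2e}^l$, $$\Delta(z)(t)=\int_0^tC_\Delta e^{A_\Delta(t-s)}B_\Delta z(s)\,ds+D_\Delta z(t),$$ for some real matrices $A_\Delta,B_\Delta,C_\Delta,D_\Delta$. The same symbol denotes its transfer matrix $\Delta(s)=C_\Delta(sI-A_\Delta)^{-1}B_\Delta+D_\Delta$; stability means $\Delta\in\mathrm{RH}_\infty^{l\times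 k}$. For $\mathbf{V}\subset\mathbb{C}^{l\times k}$, $\mathbf{\Delta}(\mathbf{V})$ is the set of all such $\Delta$ with $\Delta(i\omega)\in\mathbf{V}$ for all $\omega\in\mathbb{R}\cup\{\infty\}$. Robust stability: the interconnection is robustly stable if it is well-posed, i.e., $\det(I-DV)\ne0$ for all $V\in\mathbf{V}$, and if there exists a constant $M_0>0$ such that the state-trajectories satisfy $\lim_{t\to\infty}x(t)=0$ and $\|x(t)\|\le M_0\|x(0)\|$ for all $t\ge0$, for all initial conditions $x(0)\in\mathbb{R}^n$ and any $\Delta\in\mathbf{\Delta}(\mathbf{V})$. *)

(* Defs.v *)
From HB Require Import structures.
From mathcomp Require Import all_boot all_order all_algebra.
From mathcomp Require Import all_classical all_reals all_analysis.
From mathcomp Require Import complex.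
From mathcomp Require mxtens.

Set Implicit Arguments.
Unset Strict Implicit.
Unset Printing Implicit Defensive.

Import Order.TTheory GRing.Theory Num.Theory.
Import numFieldNormedType.Exports.

Local Open Scope classical_set_scope.
Local Open Scope ring_scope.
Local Open Scope sesquilinear_scope.

Notation "A *t B" := (mxtens.tensmx A B)
  (at level 40, left associativity, format "A  *t  B") : ring_scope.

Definition cmx {R : realType} {m n : nat} (A : 'M[R]_(m, n)) : 'M[R[i]]_(m, n) :=
  map_mx (real_complex R) A.

Definition posdefmx {R : realType} {n : nat} (A : 'M[R]_n) : Prop :=
  A \is symmetricmx /\ forall v : 'cV[R]_n, v != 0 -> 0 < (v^T *m A *m v) 0 0.

Definition negdefmx {R : realType} {n : nat} (A : 'M[R]_n) : Prop :=
  A \is symmetricmx /\ forall v : 'cV[R]_n, v != 0 -> (v^T *m A *m v) 0 0 < 0.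

Definition negsemidefmx {R : realType} {n : nat} (A : 'M[R]_n) : Prop :=
  A \is symmetricmx /\ forall v : 'cV[R]_n, (v^T *m A *m v) 0 0 <= 0.

(* In R[i], 0 <= x means that x is real and nonnegative. *)
Definition cpossemidefmx {R : realType} {n : nat} (A : 'M[R[i]]_n) : Prop :=
  A \is hermsymmx /\
  forall v : 'cV[R[i]]_n, 0 <= (v ^t* *m A *m v) 0 0.

Definition hurwitz {R : realType} {n : nat} (A : 'M[R]_n) : Prop :=
  forall s : R[i], eigenvalue (cmx A) s -> complex.Re s < 0.

Definition expmx {R : realType} {n : nat} (A : 'M[R]_n) : 'M[R]_n :=
  limn (series (fun j : nat => (j`!%:R)^-1 *: A ^+ j : 'M[R]_n)).

(* Euclidean norm; the norm `|v| of the library is the max norm. *)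
Definition enorm {R : realType} {n : nat} (v : 'cV[R]_n) : R :=
  Num.sqrt (\sum_i v i 0 ^+ 2).

(* Numerator and denominator in lowest terms: the representative of the class
   of f chosen by the library need not be reduced. *)
Definition rnum {R : realType} (f : {fraction {poly R}}) : {poly R} :=
  let r := fraction.frac (generic_quotient.repr f) in r.1 %/ gcdp r.1 r.2.
Definition rden {R : realType} (f : {fraction {poly R}}) : {poly R} :=
  let r := fraction.frac (generic_quotient.repr f) in r.2 %/ gcdp r.1 r.2.

Definition is_pole {R : realType} (f : {fraction {poly R}}) (s : R[i]) : Prop :=
  root (map_poly (real_complex R) (rden f)) s.
Definition is_pole_infty {R : realType} (f : {fraction {poly R}}) : Prop :=
  (size (rden f) < size (rnum f))%N.

Definition ratval {R : realType} (f : {fraction {poly R}}) (s : R[i]) : R[i] :=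
  (map_poly (real_complex R) (rnum f)).[s] /
  (map_poly (real_complex R) (rden f)).[s].
(* For f proper, f(oo) is the quotient of the coefficients of degree deg(rden f). *)
Definition ratval_infty {R : realType} (f : {fraction {poly R}}) : R[i] :=
  ((rnum f)`_(size (rden f)).-1 / lead_coef (rden f))%:C%C.

Definition RHinfty {R : realType} {m n : nat}
    (G : 'M[{fraction {poly R}}]_(m, n)) : Prop :=
  forall i j, (forall s : R[i], 0 <= complex.Re s -> ~ is_pole (G i j) s) /\
              ~ is_pole_infty (G i j).

Record lti (R : realType) (k l : nat) := Lti {
  lti_dim : nat;
  lti_A : 'M[R]_lti_dim;
  lti_B : 'M[R]_(lti_dim, k);
  lti_C : 'M[R]_(l, lti_dim);
  lti_D : 'M[R]_(l, k) }.

(* char_poly_mx A is the polynomial matrix sI - A. *)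
Definition transfer {R : realType} {k l : nat} (Delta : lti R k l) :
    'M[{fraction {poly R}}]_(l, k) :=
  let cst (m n : nat) (E : 'M[R]_(m, n)) : 'M[{fraction {poly R}}]_(m, n) :=
    map_mx (fun a : R => fraction.FracField.tofrac a%:P) E in
  cst _ _ (lti_C Delta)
    *m invmx (map_mx (@fraction.FracField.tofrac {poly R}) (char_poly_mx (lti_A Delta)))
    *m cst _ _ (lti_B Delta) + cst _ _ (lti_D Delta).

Definition iomap {R : realType} {k l : nat} (Delta : lti R k l)
    (z : R -> 'cV[R]_k) (t : R) : 'cV[R]_l :=
  (\col_i \int[lebesgue_measure]_(s in `[0, t])
     (lti_C Delta *m expmx ((t - s) *: lti_A Delta) *m lti_B Delta *m z s) i 0)
  + lti_D Delta *m z t.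

Definition uncertainty {R : realType} {k l : nat} (V : set 'M[R[i]]_(l, k)) :
    set (lti R k l) :=
  [set Delta | [/\ RHinfty (transfer Delta),
     forall omega : R, V (map_mx (ratval ^~ (0 +i* omega)%C) (transfer Delta))
   & V (map_mx ratval_infty (transfer Delta))]].

Definition L2e {R : realType} {n : nat} (u : R -> 'cV[R]_n) : Prop :=
  (forall i, measurable_fun (`[0, +oo[ : set R) (fun t : R => u t i 0)) /\
  forall T : R, (\int[lebesgue_measure]_(t in `[0%R, T])
                   (enorm (u t) ^+ 2)%:E < +oo)%E.

Definition abs_continuous {R : realType} {n : nat} (a b : R)
    (f : R -> 'cV[R]_n) : Prop :=
  forall e : R, 0 < e -> exists2 d : R, 0 < d &
    forall (m : nat) (s t : 'I_m -> R),
      (forall i, [/\ a <= s i, s i <= t i & t i <= b]) ->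
      (forall i j, i != j -> t i <= s j \/ t j <= s i) ->
      \sum_i (t i - s i) < d -> \sum_i enorm (f (t i) - f (s i)) < e.

(* Signals in L2e are defined up to null sets, so the equations hold at almost
   every t >= 0 and x is a solution in the sense of Caratheodory. *)
Definition state_trajectory {R : realType} {n k l : nat}
    (A : 'M[R]_n) (B : 'M[R]_(n, l)) (C : 'M[R]_(k, n)) (D : 'M[R]_(k, l))
    (Delta : lti R k l) (x : R -> 'cV[R]_n) : Prop :=
  (forall T : R, abs_continuous 0 T x) /\
  exists (w : R -> 'cV[R]_l) (z : R -> 'cV[R]_k), [/\ L2e w, L2e z &
    {ae lebesgue_measure, forall t : R, 0 <= t ->
      [/\ is_derive t 1 x (A *m x t + B *m w t),
          z t = C *m x t + D *m w t
        & w t = iomap Delta z t]}].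

Definition robustly_stable {R : realType} {n k l : nat}
    (A : 'M[R]_n) (B : 'M[R]_(n, l)) (C : 'M[R]_(k, n)) (D : 'M[R]_(k, l))
    (V : set 'M[R[i]]_(l, k)) : Prop :=
  (forall V0, V V0 -> \det (1%:M - cmx D *m V0) != 0) /\
  exists2 M0 : R, 0 < M0 &
    forall Delta, uncertainty V Delta ->
    forall x, state_trajectory A B C D Delta x ->
      x t @[t --> +oo] --> (0 : 'cV[R]_n) /\
      forall t, 0 <= t -> enorm (x t) <= M0 * enorm (x 0).

Definition value_set {R : realType} {k l : nat} (P0 : 'M[R]_(k + l)) :
    set 'M[R[i]]_(l, k) :=
  [set V | cpossemidefmx ((col_mx 1%:M V) ^t* *m cmx P0 *m col_mx 1%:M V)].

(* diag(I_k (x) J, I_l (x) J); the cast is the identity on entries. *)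
Definition Psimx {R : realType} (k l : nat) {p q : nat} (J : 'M[R]_(p, q)) :
    'M[R]_((k + l) * p, (k + l) * q) :=
  castmx (esym (mulnDl k l p), esym (mulnDl k l q))
    (block_mx ((1%:M : 'M[R]_k) *t J) 0 0 ((1%:M : 'M[R]_l) *t J)).

Definition Psimx1 {R : realType} (k l : nat) {p : nat} (J : 'cV[R]_p) :
    'M[R]_((k + l) * p, k + l) :=
  castmx (erefl, muln1 (k + l)) (Psimx k l J).

(* Main.v *)
Require Import Defs.
From HB Require Import structures.
From mathcomp Require Import all_boot all_order all_algebra.
From mathcomp Require Import all_classical all_reals all_analysis.
From mathcomp Require Import complex measurable_realfun.
From mathcomp Require mxtens.
From mathcomp Require Import ring lra zify.

(** The proof constructs, for every admissible uncertainty, a quadratic Lyapunov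
    function of the loop; frequency-domain integrals do not occur.

    The uncertainty [Delta] has a realisation [(A', B', C', D')] that is stable and has the
    given transfer matrix ([stable_realisation]).  Since [Delta (i om)] lies in the value
    set at every frequency, including infinity, the Kalman-Yakubovich-Popov lemma ([kyp])
    provides for every [gamma > 0] a symmetric [P] with
    [2 y^T P (A' y + B' u) + (u; C' y + D' u)^T P0 (u; C' y + D' u) >= - gamma |u|^2],
    and [P <= 0] because the lower right block of [P0] is nonpositive
    ([uncertainty_storage]).

    The multiplier filter [(A_psi, B_psi)] has a scalar input, so the filtered signals of
    all channels form a matrix [Xi] with one row per channel, and the filter acts on it
    from the right, whereas the dynamics of [Delta] act from the left.  The two commute:
    filtering input, state and output of [Delta] gives trajectories of [Delta] again
    ([filtered_states]).  If [T] collects the filtered state and the state of [Delta] as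
    columns, and [Phi = (Xi, (z; w))], then the inequality above, weighted by the
    positive definite matrix [L] of the first matrix inequality, becomes
    [tr (P (T L T^T)') + tr (P0 Phi L Phi^T) >= - gamma tr (U L U^T)], where [U] is the
    upper block of [Phi] ([kyp_trace]).  This uses that the trace of a product of two
    positive semidefinite matrices is nonnegative, which is where the positivity of the
    multiplier enters.

    The second matrix inequality, evaluated along a trajectory, contains exactly the same
    term [tr (P0 Phi L Phi^T)] ([lmi_main_form]).  Adding up, the function
    [V = h^T X h - tr (P0 Xi Y Xi^T) - tr (P T L T^T)], with [h] made of [Xi] and [x],
    satisfies [V' <= - a (|x|^2 + |w|^2)] once [gamma] is small ([dissipation_rate]).  The
    third matrix inequality and [P <= 0] give [V >= c |x|^2], and [V] at time 0 only
    depends on [x 0].  All constants are independent of [Delta], so the bound on [x] is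
    uniform; [x] tends to 0 because [|x|^2] varies slowly compared with [V]
    ([lyapunov_decay]).  Well-posedness is the static part of the same estimate
    ([well_posed]).

    The signals are only locally square integrable, so the differential equations hold
    almost everywhere, and monotonicity of [V] rests on the fact that an absolutely
    continuous function with nonpositive derivative almost everywhere is nonincreasing
    ([ac_decrease]).  The lemmas of Lyapunov and of Kalman, Yakubovich and Popov are
    obtained by separating a matrix from a convex cone ([sym_separation]) and excluding
    the dual certificate by linear algebra over the complex numbers. *)

Set Implicit Arguments.
Unset Strict Implicit.
Unset Printing Implicit Defensive.

Import Order.TTheory GRing.Theory Num.Theory.
Import numFieldNormedType.Exports.

Local Open Scope classical_set_scope.
Local Open Scope ring_scope.

(** * Absolutely continuous functions *)

Section AbsolutelyContinuous.
Variable R : realType.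
Implicit Types (f g : R -> R) (a b : R).
Local Notation mu := (@lebesgue_measure R).

(** The scalar form of [abs_continuous]: it is inherited by the coordinates of a
    trajectory, and unlike the vector form it is stable under products. *)
Definition ac a b f : Prop := forall e : R, 0 < e -> exists2 d : R, 0 < d &
  forall (m : nat) (s t : 'I_m -> R),
    (forall i, [/\ a <= s i, s i <= t i & t i <= b]) ->
    (forall i j, i != j -> t i <= s j \/ t j <= s i) ->
    \sum_i (t i - s i) < d -> \sum_i `|f (t i) - f (s i)| < e.

Lemma ac_sub a b a' b' f : a <= a' -> b' <= b -> ac a b f -> ac a' b' f.
Proof.
move=> aa' bb' acf e e0; have [d d0 H] := acf e e0; exists d => // m s t st.
by apply: H => i; have [? ? ?] := st i; split=> //;
  [exact: le_trans aa' _ | exact: le_trans bb'].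
Qed.

Lemma ac_le a b (K : R) (f g : R -> R) : 0 <= K ->
  (forall x y, a <= x -> x <= y -> y <= b -> `|g y - g x| <= K * `|f y - f x|) ->
  ac a b f -> ac a b g.
Proof.
move=> K0 fg acf e e0.
have K1 : 0 < K + 1 by rewrite ltr_wpDl.
have [d d0 H] := acf (e / (K + 1)) (divr_gt0 e0 K1).
exists d => // m s t st dis lt_d; have {H dis lt_d} := H m s t st dis lt_d.
rewrite ltr_pdivlMr// => H; apply: le_lt_trans H.
rewrite mulr_suml; apply: ler_sum => i _; have [? ? ?] := st i.
rewrite (le_trans (fg _ _ _ _ _))// mulrC ler_wpM2l// lerDl//.
Qed.

Lemma ac_cst a b (c : R) : ac a b (fun=> c).
Proof.
move=> e e0; exists 1 => // m s t _ _ _.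
by rewrite big1// => i _; rewrite subrr normr0.
Qed.

Lemma acD a b f g : ac a b f -> ac a b g -> ac a b (fun x => f x + g x).
Proof.
move=> acf acg e e0.
have e20 : 0 < e / 2 by rewrite divr_gt0.
have [d d0 H] := acf _ e20; have [d' d'0 H'] := acg _ e20.
exists (Num.min d d'); first by rewrite lt_min d0.
move=> m s t st dis; rewrite lt_min => /andP[ld ld'].
rewrite [e]splitr; apply: le_lt_trans (ltrD (H m s t st dis ld) (H' m s t st dis ld')).
rewrite -big_split/=; apply: ler_sum => i _.
by rewrite opprD addrACA ler_normD.
Qed.

(** Walk from [a] in steps of length [d / 2], each of which changes [f] by at most 1. *)
Lemma ac_bounded a b f : a <= b -> ac a b f ->
  exists2 K, 0 <= K & forall x, a <= x -> x <= b -> `|f x| <= K.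
Proof.
move=> ab acf; have [d d0 H] := acf 1 ltr01.
have step x y : a <= x -> x <= y -> y <= b -> y - x < d -> `|f y - f x| <= 1.
  move=> ax xy yb xyd.
  have := H 1%N (fun=> x) (fun=> y); rewrite !big_ord1 => H1.
  apply/ltW/H1 => //; first by move=> i j; rewrite !ord1 eqxx.
have d20 : 0 < d / 2 by rewrite divr_gt0.
have iter n : forall x, a <= x -> x <= b -> x - a <= n%:R * (d / 2) ->
    `|f x - f a| <= n%:R.
  elim: n => [|n IH] x ax xb.
    rewrite mul0r subr_le0 => xa.
    by have -> : x = a by [apply/eqP; rewrite eq_le xa]; rewrite subrr normr0.
  rewrite -natr1 mulrDl mul1r => xn.
  pose x' := Num.max a (x - d / 2).
  have ax' : a <= x' by rewrite le_max lexx.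
  have xx' : x' <= x by rewrite ge_max ax/= gerBl ltW.
  have := IH x' ax' (le_trans xx' xb).
  have -> : x' - a <= n%:R * (d / 2).
    rewrite lerBlDr ge_max lerDr mulr_ge0//=; last by rewrite ltW.
    lra.
  move=> /(_ isT) H1.
  have H2 : `|f x - f x'| <= 1.
    apply: step => //; rewrite ltrBlDr -ltrBlDl.
    by rewrite lt_max; apply/orP; right; lra.
  by rewrite -(subrK (f x') (f x)) -addrA addrC (le_trans (ler_normD _ _))// lerD.
have [n nP] : exists n : nat, b - a <= n%:R * (d / 2).
  exists (Num.bound ((b - a) / (d / 2))); rewrite -ler_pdivrMr//.
  by apply/ltW/archi_boundP; rewrite divr_ge0 ?subr_ge0// ltW.
exists (`|f a| + n%:R); first by rewrite addr_ge0.
move=> x ax xb; rewrite -[f x](subrK (f a)) addrC (le_trans (ler_normD _ _))//.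
by rewrite lerD// iter// (le_trans _ nP)// lerB.
Qed.

Lemma acM a b f g : a <= b -> ac a b f -> ac a b g -> ac a b (fun x => f x * g x).
Proof.
move=> ab acf acg.
have [K K0 fK] := ac_bounded ab acf; have [L L0 gL] := ac_bounded ab acg.
move=> e e0.
have e20 : 0 < e / (K + L + 1) by rewrite divr_gt0// ltr_wpDl// addr_ge0.
have [d d0 H] := acf _ e20; have [d' d'0 H'] := acg _ e20.
exists (Num.min d d'); first by rewrite lt_min d0.
move=> m s t st dis; rewrite lt_min => /andP[ld ld'].
have {}H := H m s t st dis ld; have {}H' := H' m s t st dis ld'.
set F := \sum_i _ in H; set G := \sum_i _ in H'.
apply: (@le_lt_trans _ _ (K * G + L * F)).
  rewrite /F /G !mulr_sumr -big_split/=; apply: ler_sum => i _.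
  have [asi sti tib] := st i.
  have -> : f (t i) * g (t i) - f (s i) * g (s i) =
     f (t i) * (g (t i) - g (s i)) + g (s i) * (f (t i) - f (s i)) by ring.
  rewrite (le_trans (ler_normD _ _))// !normrM lerD// ler_wpM2r//.
    by rewrite fK// (le_trans asi).
  by rewrite gL// (le_trans sti).
have KL : 0 < K + L + 1 by rewrite ltr_wpDl// addr_ge0.
have eKL : e = (K + L + 1) * (e / (K + L + 1)) by rewrite mulrC divfK// gt_eqF.
rewrite [ltRHS]eKL; nra.
Qed.

Lemma ac_lipschitz a b (K : R) f : 0 <= K ->
  (forall x y, a <= x -> x <= y -> y <= b -> `|f y - f x| <= K * (y - x)) ->
  ac a b f.
Proof.
move=> K0 fK.
apply: (@ac_le a b K id); first by [].
- by move=> x y ax xy yb; rewrite [`|y - x|]ger0_norm ?subr_ge0//; exact: fK.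
- move=> e e0; exists e => // m s t st _; apply: le_lt_trans.
  by apply: ler_sum => i _; have [_ ? _] := st i; rewrite ger0_norm// subr_ge0.
Qed.

(** Around a point with nonpositive derivative, increments of [f] over intervals that
    contain the point are controlled; intervals on one side of it are of no use in the
    covering argument of [ac_decrease]. *)
Lemma is_derive_slope f (c f' e : R) : is_derive c 1 f f' -> 0 < e -> f' <= 0 ->
  exists2 r, 0 < r & forall x y, x <= c -> c <= y -> c - x < r -> y - c < r ->
    f y - f x <= e * (y - x).
Proof.
move=> [df dv] e_gt0 f'0.
have : (fun h : R => h^-1 *: ((f \o shift c) (h *: (1:R)) - f c)) @ 0^' --> f'.
  by rewrite -dv; exact: df.
move/cvgrPdist_lt => /(_ _ e_gt0) [r /= r0 rP].
have slope h : h != 0 -> `|h| < r -> h^-1 * (f (c + h) - f c) <= e.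
  move=> h0 hr; have := rP h; rewrite /ball/= sub0r normrN => /(_ hr h0).
  rewrite /= [h *: 1]mulr1 [h^-1 *: _]/(h^-1 * _) [h + c]addrC distrC => H.
  have := le_lt_trans (ler_norm _) H; rewrite ltrBlDr => /ltW/le_trans; apply.
  by rewrite gerDl.
have right y : c <= y -> y - c < r -> f y - f c <= e * (y - c).
  rewrite le_eqVlt => /orP[/eqP<-|cy] yr; first by rewrite !subrr mulr0.
  have yc0 : 0 < y - c by rewrite subr_gt0.
  have := slope (y - c); rewrite gt_eqF// gtr0_norm// [c + _]addrC subrK => /(_ isT yr).
  by rewrite mulrC ler_pdivrMr.
have left x : x <= c -> c - x < r -> f c - f x <= e * (c - x).
  rewrite le_eqVlt => /orP[/eqP<-|cy] yr; first by rewrite !subrr mulr0.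
  have yc0 : 0 < c - x by rewrite subr_gt0.
  have := slope (x - c).
  rewrite subr_eq0 lt_eqF// distrC gtr0_norm// [c + _]addrC subrK => /(_ isT yr).
  by rewrite -opprB invrN mulNr -mulrN opprB mulrC ler_pdivrMr.
exists r => // x y xc cy xr yr.
have := left x xc xr; have := right y cy yr; lra.
Qed.

(** A covering argument in the style of Cousin, without Vitali's lemma.  Let [d] be
    what absolute continuity gives for [e], and enclose the exceptional null set in an
    open [U] of measure less than [d].  Call [x] reachable ([P x] below) if
    [f x - f a] is at most [e * (x - a)] plus the variation of [f] over finitely many
    disjoint intervals of total length at most the measure of [U] intersected with
    [[a, x]].  Reachability propagates across every point: through an interval inside
    [U] at an exceptional point, by the slope bound elsewhere.  So the supremum of the
    reachable points is [b], and the variation in question is less than [e]. *)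
Lemma ac_decrease a b f : a <= b -> ac a b f ->
  {ae mu, forall t, a <= t <= b -> exists2 f', is_derive t 1 f f' & f' <= 0} ->
  f b <= f a.
Proof.
move=> ab acf [N [mN N0 subN]].
apply/ler_addgt0Pr => e0 e0_gt0.
have ba1 : 0 < b - a + 1 by rewrite ltr_wpDl// subr_ge0.
pose e := e0 / (b - a + 1); have e_gt0 : 0 < e by rewrite divr_gt0.
have [d d0 Hd] := acf _ e_gt0.
have [] := @lebesgue_regularity_outer R N d mN _ d0.
  by apply: le_lt_trans (ltry 0); rewrite le_eqVlt; apply/orP; left; apply/eqP; exact: N0.
move=> U [oU NU muU].
have mU : measurable U by exact: measurable_realfun.open_measurable.
have {muU} muUd : (mu U < d%:E)%E.
  apply: le_lt_trans muU.
  rewrite -[X in (mu X <= _)%E](@setDUK _ N)// measureU//; last 2 first.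
    - exact: measurableD.
    - by rewrite setDIK.
  by rewrite [X in (X + _)%E](_ : _ = 0%E) ?add0e.
pose P x := exists m (s t : 'I_m -> R), [/\
  (forall i, [/\ a <= s i, s i <= t i & t i <= x]),
  (forall i j, i != j -> t i <= s j \/ t j <= s i),
  ((\sum_i (t i - s i))%:E <= mu (U `&` `[a, x]))%E &
  f x - f a <= e * (x - a) + \sum_i `|f (t i) - f (s i)|].
have Pa : P a.
  exists 0%N, (fun=> 0), (fun=> 0); split; try by case.
  - by rewrite big_ord0.
  - by rewrite big_ord0 !subrr mulr0 addr0.
(* across an interval inside U the increment of f joins the variation sum *)
have stepU x y : a <= x -> x <= y -> `[x, y] `<=` U -> P x -> P y.
  move=> ax xy xyU [m [s [t [st dis sm fx]]]].
  pose s' (i : 'I_m.+1) := if unlift ord_max i is Some j then s j else x.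
  pose t' (i : 'I_m.+1) := if unlift ord_max i is Some j then t j else y.
  have wE (i : 'I_m) : widen_ord (leqnSn m) i = lift ord_max i.
    by apply/val_inj; rewrite /= /bump leqNgt ltn_ord.
  exists m.+1, s', t'; split.
  - move=> i; rewrite /s' /t'; case: unliftP => [j _|_] //.
    by have [? ? tx] := st j; split=> //; exact: le_trans tx xy.
  - move=> i j; rewrite /s' /t'.
    case: unliftP => [i' ->|->]; case: unliftP => [j' ->|->] //.
    + by rewrite (inj_eq lift_inj); exact: dis.
    + by move=> _; left; have [] := st i'.
    + by move=> _; right; have [] := st j'.
    + by rewrite eqxx.
  - rewrite big_ord_recr/= /s' /t' unlift_none.
    under eq_bigr do rewrite wE liftK.
    rewrite EFinD.
    apply: (@le_trans _ _ (mu ((U `&` `[a, x]) `|` `]x, y])))%E.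
      rewrite measureU//; last 2 first.
      + exact: measurableI.
      + apply/seteqP; split=> // z [[_]] /=.
        by rewrite !in_itv/= => /andP[_ zx] /andP[]; rewrite ltNge zx.
      + have muxy : mu `]x, y]%classic = (y - x)%:E.
          by rewrite lebesgue_measure_itv/= lte_fin; case: ltgtP xy => // ->;
            rewrite subrr.
        by apply: leeD => //; rewrite -muxy; exact: lexx.
    apply: le_measure; rewrite ?inE.
    + by apply: measurableU => //; exact: measurableI.
    + exact: measurableI.
    + move=> z [[Uz]|] /=; rewrite !in_itv/=.
        by move=> /andP[az zx]; split=> //; rewrite az (le_trans zx).
      move=> /andP[xz zy]; split; last by rewrite (le_trans ax (ltW xz)) zy.
      by apply: xyU; rewrite /= in_itv/= (ltW xz).
  - rewrite big_ord_recr/= /s' /t' unlift_none.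
    under eq_bigr do rewrite wE liftK.
    have -> : f y - f a = (f y - f x) + (f x - f a) by ring.
    have fyx := ler_norm (f y - f x).
    have exy : e * (x - a) <= e * (y - a) by rewrite ler_wpM2l ?(ltW e_gt0)// lerB.
    lra.
have stepG x y : a <= x -> x <= y -> f y - f x <= e * (y - x) -> P x -> P y.
  move=> ax xy fxy [m [s [t [st dis sm fx]]]]; exists m, s, t; split => //.
  - by move=> i; have [? ? tx] := st i; split=> //; exact: le_trans tx xy.
  - apply: le_trans sm _; apply: le_measure; rewrite ?inE; try exact: measurableI.
    by apply: setIS => z /=; rewrite !in_itv/= => /andP[-> /le_trans->].
  - have -> : f y - f a = (f y - f x) + (f x - f a) by ring.
    lra.
have local c : a <= c -> c <= b -> exists2 r, 0 < r &
   forall x y, a <= x -> x <= c -> c <= y -> y <= b -> c - x < r -> y - c < r ->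
     P x -> P y.
  move=> ac cb; have [Nc|Nc] := pselect (N c).
    have /nbhs_ballP[r/= r0 rU] : nbhs c U by apply: open_nbhs_nbhs; split=> //; exact: NU.
    exists r => // x y ax xc cy yb xr yr; apply: stepU => //.
      exact: le_trans cy.
    move=> z /=; rewrite in_itv/= => /andP[xz zy]; apply: rU.
    by rewrite /ball/= ltr_norml; apply/andP; split; lra.
  have [f' df' f'0] : exists2 f', is_derive c 1 f f' & f' <= 0.
    apply: contrapT => nf; apply/Nc/subN => /= H; apply: nf; apply: H.
    by rewrite ac cb.
  have [r r0 slope] := is_derive_slope df' e_gt0 f'0.
  exists r => // x y ax xc cy yb xr yr; apply: stepG => //; last exact: slope.
  exact: le_trans cy.
have Pb : P b.
  pose S := [set x | a <= x <= b /\ P x].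
  have Sa : S a by split; [rewrite lexx ab|].
  have supS : has_sup S by split; [exists a|exists b => x [/andP[]]].
  pose c := sup S.
  have ac : a <= c by apply: ub_le_sup => //; case: supS.
  have cb : c <= b by apply: ge_sup; [exists a|move=> x [/andP[]]].
  have [r r0 rP] := local c ac cb.
  have [x [/andP[ax xb] Px] cx] := sup_adherent r0 supS.
  have xc : x <= c by apply: ub_le_sup; [case: supS|split=> //; rewrite ax].
  pose y := Num.min b (c + r / 2).
  have r20 : 0 < r / 2 by rewrite divr_gt0.
  have cy : c <= y by rewrite le_min cb lerDl ltW.
  have yb : y <= b by rewrite ge_min lexx.
  have yr : y - c < r by rewrite ltrBlDr gt_min; apply/orP; right; lra.
  have Py : P y by apply: (rP x) => //; rewrite ltrBlDr -ltrBlDl.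
  have yc : y <= c.
    by apply: ub_le_sup; [case: supS|split=> //; rewrite yb (le_trans ac)].
  have : y <= c by []; rewrite /y ge_min => /orP[bc|]; last by lra.
  by move: Py; rewrite /y min_l// (le_trans bc)// lerDl ltW.
have [m [s [t [st dis sm fx]]]] := Pb.
have lt_d : \sum_i (t i - s i) < d.
  rewrite -lte_fin; apply: le_lt_trans sm _; apply: le_lt_trans muUd.
  by apply: le_measure; rewrite ?inE//; exact: measurableI.
have := Hd m s t st dis lt_d; rewrite -lerBlDl => He.
apply: le_trans fx _; apply: (@le_trans _ _ (e * (b - a) + e)); first by rewrite lerD2l ltW.
by rewrite -[X in _ + X]mulr1 -mulrDr /e divfK// gt_eqF.
Qed.

End AbsolutelyContinuous.

(** * Primitives almost everywhere *)

Section Primitive.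
Variable R : realType.
Implicit Types (f g u : R -> R).
Local Notation mu := (@lebesgue_measure R).

Lemma ae_mono (P S : R -> Prop) : {ae mu, forall t, P t} ->
  (forall t, P t -> S t) -> {ae mu, forall t, S t}.
Proof.
move=> aP PS; apply: filterS aP => //.
exact: (ae_filter_ringOfSetsType mu).
Qed.

Lemma ae_mono2 (P Q S : R -> Prop) : {ae mu, forall t, P t} ->
  {ae mu, forall t, Q t} -> (forall t, P t -> Q t -> S t) ->
  {ae mu, forall t, S t}.
Proof.
move=> aP aQ PQS; apply: filterS2 aP aQ => //.
exact: (ae_filter_ringOfSetsType mu).
Qed.

(** Solutions in the sense of Caratheodory: all differential equations below are
    statements of the form [primitive f f'], where [f'] may be changed on a null set.
    Negative times are left free, because integrals from 0 to [t] and trajectories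
    carry no information there. *)
Definition primitive f f' : Prop :=
  (forall T, 0 <= T -> ac 0 T f) /\
  {ae mu, forall t : R, 0 <= t -> is_derive t 1 f (f' t)}.

Lemma primitive_ae f f' g' : primitive f f' ->
  {ae mu, forall t : R, 0 <= t -> f' t = g' t} -> primitive f g'.
Proof.
move=> [acf df] fg; split=> //; apply: ae_mono2 df fg _.
by move=> t dft fgt t0; rewrite -fgt//; exact: dft.
Qed.

Lemma primitive_cst (c : R) : primitive (fun=> c) (fun=> 0).
Proof.
split; first by move=> T _; exact: ac_cst.
by apply: aeW => t _; exact: is_derive_cst.
Qed.

Lemma primitiveD f f' g g' : primitive f f' -> primitive g g' ->
  primitive (fun t => f t + g t) (fun t => f' t + g' t).
Proof.
move=> [acf df] [acg dg]; split.
  by move=> T T0; apply: acD; [exact: acf|exact: acg].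
apply: ae_mono2 df dg _ => t dft dgt t0.
exact: is_deriveD (dft t0) (dgt t0).
Qed.

Lemma primitiveM f f' g g' : primitive f f' -> primitive g g' ->
  primitive (fun t => f t * g t) (fun t => f' t * g t + f t * g' t).
Proof.
move=> [acf df] [acg dg]; split.
  by move=> T T0; apply: acM => //; [exact: acf|exact: acg].
apply: ae_mono2 df dg _ => t dft dgt t0.
have := is_deriveM (dft t0) (dgt t0).
by rewrite addrC [g t *: _]mulrC.
Qed.

Lemma primitive_sum (I : Type) (r : seq I) (F F' : I -> R -> R) :
  (forall i, primitive (F i) (F' i)) ->
  primitive (fun t => \sum_(i <- r) F i t) (fun t => \sum_(i <- r) F' i t).
Proof.
move=> pF; elim: r => [|i r IH].
  under eq_fun do rewrite big_nil.
  under [X in primitive _ X]eq_fun do rewrite big_nil.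
  exact: primitive_cst.
under eq_fun do rewrite big_cons.
under [X in primitive _ X]eq_fun do rewrite big_cons.
exact: primitiveD (pF i) IH.
Qed.

Lemma primitiveZ (c : R) f f' : primitive f f' ->
  primitive (fun t => c * f t) (fun t => c * f' t).
Proof.
move=> pf; have := primitiveM (primitive_cst c) pf.
by under [X in primitive _ X -> _]eq_fun do rewrite mul0r add0r.
Qed.

Lemma primitive_nonincreasing_after f f' a : 0 <= a -> primitive f f' ->
  {ae mu, forall t : R, a <= t -> f' t <= 0} ->
  forall s t, a <= s -> s <= t -> f t <= f s.
Proof.
move=> a0 [acf df] f'0 s t as_ st; have s0 := le_trans a0 as_.
apply: ac_decrease => //; first by apply: ac_sub (acf t (le_trans s0 st)).
apply: ae_mono2 df f'0 _ => r dfr f'r /andP[sr _].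
by exists (f' r); [exact: dfr (le_trans s0 sr)|exact: f'r (le_trans as_ sr)].
Qed.

Lemma primitive_nonincreasing f f' : primitive f f' ->
  {ae mu, forall t : R, 0 <= t -> f' t <= 0} ->
  forall s t, 0 <= s -> s <= t -> f t <= f s.
Proof. exact: primitive_nonincreasing_after. Qed.

Definition locint u := measurable_fun (`[0, +oo[ : set R) u /\
  forall T : R, mu.-integrable `[0, T] (EFin \o u).

Lemma locintD u v : locint u -> locint v -> locint (fun t => u t + v t).
Proof.
move=> [mu_ iu] [mv iv]; split; first exact: measurable_funD.
by move=> T; exact: integrableD (iu T) (iv T).
Qed.

Lemma locint0 : locint (fun=> 0).
Proof. by split=> [|T]; [exact: measurable_cst|exact: integrable0]. Qed.

Lemma locint_sum (I : Type) (r : seq I) (F : I -> R -> R) :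
  (forall i, locint (F i)) -> locint (fun t => \sum_(i <- r) F i t).
Proof.
move=> iF; elim: r => [|i r IH].
  by under eq_fun do rewrite big_nil; exact: locint0.
by under eq_fun do rewrite big_cons; exact: locintD (iF i) IH.
Qed.

Lemma continuous_bounded_segment (c : R -> R) (T : R) : continuous c ->
  [bounded c x | x in (`[0, T] : set R)].
Proof.
move=> cc; have : compact (c @` `[0, T]%classic).
  apply: continuous_compact; last exact: segment_compact.
  exact: continuous_subspaceT.
move=> /compact_bounded [M [Mr MP]]; exists M; split=> // x Mx y yT /=.
by apply: MP => //; exists y.
Qed.

Lemma locintM (c : R -> R) u : continuous c -> locint u ->
  locint (fun t => c t * u t).
Proof.
move=> cc [mu_ iu]; split.
  apply: measurable_funM => //.
  by apply: measurable_funTS; exact: continuous_measurable_fun.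
move=> T; apply: (integrableMr _ _ _ (iu T)) => //.
- by apply: measurable_funTS; exact: continuous_measurable_fun.
- exact: continuous_bounded_segment.
Qed.

(** Absolute continuity of the integral of the restriction of [|u|] to [[0, T]],
    applied to the union of the given intervals. *)
Lemma ac_integral u T : 0 <= T -> locint u ->
  ac 0 T (fun t => \int[mu]_(s in `[0, t]) u s)%R.
Proof.
move=> T0 [mu_ iu] e e0.
pose v := u \_ (`[0, T] : set R).
have iv : mu.-integrable setT (EFin \o v).
  by have := iu T; rewrite integrable_mkcond//= (restrict_EFin u).
have [d [d0 dP]] := integral_normr_continuous iv e0.
exists d => // m s t st dis sd.
pose A (i : 'I_m) : set R := `]s i, t i]%classic.
have mA i : measurable (A i) by exact: measurable_itv.
have tA : trivIset setT A.
  move=> i j _ _ [x []]; rewrite /A/= !in_itv/= => /andP[sx xt] /andP[sx' xt'].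
  apply/eqP; apply: contraT => ij.
  have [H|H] := dis i j ij.
  - by move: (lt_le_trans sx' xt); rewrite ltNge H.
  - by move: (lt_le_trans sx xt'); rewrite ltNge H.
have muA i : mu (A i) = (t i - s i)%:E.
  have [_ si _] := st i.
  by rewrite lebesgue_measure_itv/= lte_fin; case: ltgtP si => // ->;
    rewrite subrr.
have muD : (mu (\big[setU/set0]_(i < m) A i) < d%:E)%E.
  rewrite measure_bigsetU_ord// (eq_bigr _ (fun i _ => muA i)) sumEFin lte_fin.
  exact: sd.
have mD : measurable (\big[setU/set0]_(i < m) A i) by exact: bigsetU_measurable.
apply: le_lt_trans (dP _ mD muD).
have ivA (D : set R) : measurable D -> mu.-integrable D (EFin \o (fun x => `|v x|)).
  move=> mD'; apply: (@integrableS _ _ _ mu setT) => //.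
  exact: (integrable_norm iv).
have -> : (\int[mu]_(x in \big[setU/set0]_(i < m) A i) `|v x| =
    \sum_(i < m) \int[mu]_(x in A i) `|v x|)%R.
  apply: EFin_inj; rewrite -sumEFin /Rintegral fineK; last first.
    exact: integrable_fin_num (ivA _ mD).
  rewrite ge0_integral_bigsetU//=.
  - apply: eq_bigr => i _; rewrite fineK//.
    by apply: integrable_fin_num (ivA _ (mA i)); exact: mA.
  - exact: index_enum_uniq.
  - exact: sub_trivIset tA.
  - by have /integrableP[] := ivA _ mD.
apply: ler_sum => i _; have [s0 sti tT] := st i.
have -> : \int[mu]_(x in `[0, t i]) u x - \int[mu]_(x in `[0, s i]) u x =
    \int[mu]_(x in `]s i, t i]) u x.
  by apply: Rintegral_itvB; [exact: iu|rewrite bnd_simp|rewrite bnd_simp].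
apply: le_trans (le_normr_Rintegral _ _) _ => //.
  apply: integrableS (iu T) => //.
  by move=> x /=; rewrite !in_itv/= => /andP[sx xt];
    rewrite (le_trans s0 (ltW sx)) (le_trans xt).
rewrite le_eqVlt; apply/orP; left; apply/eqP; apply: eq_Rintegral => x.
rewrite inE /A/= in_itv/= => /andP[sx xt].
by rewrite /v patchE mem_set//= in_itv/= (le_trans s0 (ltW sx)) (le_trans xt).
Qed.

(** Lebesgue's differentiation theorem, for the extension of [u] by 0 to negative
    times; the endpoint 0 is a null set. *)
Lemma primitive_integral u : locint u ->
  primitive (fun t => \int[mu]_(s in `[0, t]) u s)%R u.
Proof.
move=> lu; split; first by move=> T T0; exact: ac_integral.
have [mu_ iu] := lu.
pose v := u \_ (`[0, +oo[ : set R).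
have uv t : 0 <= t -> v t = u t.
  by move=> t0; rewrite /v patchE mem_set//= in_itv/= t0.
have iv y : mu.-integrable `[0, y] (EFin \o v).
  apply: eq_integrable (iu y) => // x; rewrite inE/= in_itv/= => /andP[x0 _].
  by rewrite uv.
have lv : locally_integrable [set: R] v.
  split; [|exact: openT|].
  - apply/(measurable_restrict _ _ _) => //; first by rewrite setTI.
  - move=> K _ cK; have [M [Mr MP]] := compact_bounded cK.
    have mK := compact_measurable cK.
    have M1 : M < M + 1 by rewrite ltrDl.
    have [_ _ /(_ K (@subsetT _ _) cK)] :=
      integrable_locally_restrict (measurable_itv `[0, M + 1]) (iu (M + 1)).
    apply: le_lt_trans; rewrite le_eqVlt; apply/orP; left; apply/eqP.
    apply: eq_integral => x; rewrite inE => Kx.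
    rewrite /v !patchE; congr (`|_|%:E).
    have /= xM := MP _ M1 x Kx.
    have xM' : x <= M + 1 := le_trans (ler_norm x) xM.
    have [x0|x0] := leP 0 x.
      by rewrite !mem_set//= in_itv/= x0.
    by rewrite !memNset//= in_itv/= leNgt x0.
have /= HF := @FTC1 R v (BLeft 0) iv lv.
have nz : {ae mu, forall t : R, t != 0}.
  exists [set 0]; split; [exact: measurable_set1|exact: lebesgue_measure_set1|].
  by move=> t /= /negP; rewrite negbK => /eqP.
apply: (ae_mono2 HF nz) => t H tn0 t0.
have {H} [|dF dFt] := H; first by rewrite lte_fin lt_def tn0.
rewrite -(uv t t0).
have -> : (fun t => \int[mu]_(s in `[0, t]) u s)%R =
          (fun t => \int[mu]_(s in `[0, t]) v s)%R.
  apply/funext => r; apply: eq_Rintegral => x.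
  by rewrite inE/= in_itv/= => /andP[x0 _]; rewrite uv.
apply: DeriveDef; first exact: dF.
by rewrite -derive1E; exact: dFt.
Qed.

End Primitive.

(** * Matrix-valued primitives and the matrix exponential *)

Section MatrixPrimitive.
Variable R : realType.
Local Notation mu := (@lebesgue_measure R).

Definition mxprimitive m n (F F' : R -> 'M[R]_(m, n)) : Prop :=
  forall i j, primitive (fun t => F t i j) (fun t => F' t i j).

Definition mxlocint m n (U : R -> 'M[R]_(m, n)) : Prop :=
  forall i j, locint (fun t => U t i j).

Lemma eq_mxprimitive m n (F F' G G' : R -> 'M[R]_(m, n)) :
  F =1 G -> F' =1 G' -> mxprimitive F F' -> mxprimitive G G'.
Proof. by move=> /funext -> /funext ->. Qed.

Lemma mxprimitive_ae m n (F F' G' : R -> 'M[R]_(m, n)) : mxprimitive F F' ->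
  {ae mu, forall t : R, 0 <= t -> F' t = G' t} -> mxprimitive F G'.
Proof.
move=> pF FG i j; apply: primitive_ae (pF i j) _.
by apply: (ae_mono FG) => t H t0; rewrite H.
Qed.

Lemma mxprimitive_cst m n (K : 'M[R]_(m, n)) :
  mxprimitive (fun=> K) (fun=> 0).
Proof.
move=> i j; under [X in primitive _ X]eq_fun do rewrite mxE.
exact: primitive_cst.
Qed.

Lemma mxprimitiveD m n (F F' G G' : R -> 'M[R]_(m, n)) :
  mxprimitive F F' -> mxprimitive G G' ->
  mxprimitive (fun t => F t + G t) (fun t => F' t + G' t).
Proof.
move=> pF pG i j; under eq_fun do rewrite mxE.
under [X in primitive _ X]eq_fun do rewrite mxE.
exact: primitiveD.
Qed.

Lemma mxprimitiveM m n p (F F' : R -> 'M[R]_(m, n)) (G G' : R -> 'M[R]_(n, p)) :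
  mxprimitive F F' -> mxprimitive G G' ->
  mxprimitive (fun t => F t *m G t) (fun t => F' t *m G t + F t *m G' t).
Proof.
move=> pF pG i j; under eq_fun do rewrite mxE.
under [X in primitive _ X]eq_fun do rewrite !mxE -big_split/=.
by apply: primitive_sum => k; exact: primitiveM.
Qed.

Lemma mxprimitive_mull m n p (K : 'M[R]_(m, n)) (G G' : R -> 'M[R]_(n, p)) :
  mxprimitive G G' -> mxprimitive (fun t => K *m G t) (fun t => K *m G' t).
Proof.
move=> pG; apply: eq_mxprimitive (mxprimitiveM (mxprimitive_cst K) pG) => // t.
by rewrite mul0mx add0r.
Qed.

Lemma mxprimitive_mulr m n p (K : 'M[R]_(n, p)) (G G' : R -> 'M[R]_(m, n)) :
  mxprimitive G G' -> mxprimitive (fun t => G t *m K) (fun t => G' t *m K).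
Proof.
move=> pG; apply: eq_mxprimitive (mxprimitiveM pG (mxprimitive_cst K)) => // t.
by rewrite mulmx0 addr0.
Qed.

Lemma mxprimitiveB m n (F F' G G' : R -> 'M[R]_(m, n)) :
  mxprimitive F F' -> mxprimitive G G' ->
  mxprimitive (fun t => F t - G t) (fun t => F' t - G' t).
Proof.
move=> pF pG; have := mxprimitiveD pF (mxprimitive_mull (- 1%:M) pG).
by apply: eq_mxprimitive => t; rewrite mulNmx mul1mx.
Qed.

Lemma mxprimitive_tr m n (F F' : R -> 'M[R]_(m, n)) : mxprimitive F F' ->
  mxprimitive (fun t => (F t)^T) (fun t => (F' t)^T).
Proof.
move=> pF i j; under eq_fun do rewrite mxE.
by under [X in primitive _ X]eq_fun do rewrite mxE.
Qed.

Lemma mxprimitive_row m n p (F F' : R -> 'M[R]_(m, n)) (G G' : R -> 'M[R]_(m, p)) :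
  mxprimitive F F' -> mxprimitive G G' ->
  mxprimitive (fun t => row_mx (F t) (G t)) (fun t => row_mx (F' t) (G' t)).
Proof.
move=> pF pG i j; under eq_fun do rewrite mxE.
under [X in primitive _ X]eq_fun do rewrite mxE.
by case: (fintype.split j) => k.
Qed.

Lemma mxprimitive_col m n p (F F' : R -> 'M[R]_(m, n)) (G G' : R -> 'M[R]_(p, n)) :
  mxprimitive F F' -> mxprimitive G G' ->
  mxprimitive (fun t => col_mx (F t) (G t)) (fun t => col_mx (F' t) (G' t)).
Proof.
move=> pF pG i j; under eq_fun do rewrite mxE.
under [X in primitive _ X]eq_fun do rewrite mxE.
by case: (fintype.split i) => k.
Qed.

Lemma primitive_trace n (F F' : R -> 'M[R]_n) : mxprimitive F F' ->
  primitive (fun t => \tr (F t)) (fun t => \tr (F' t)).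
Proof. by move=> pF; apply: primitive_sum => i; exact: pF. Qed.

Lemma mxprimitive_eq0 m n (F : R -> 'M[R]_(m, n)) :
  mxprimitive F (fun=> 0) -> F 0 = 0 -> forall t, 0 <= t -> F t = 0.
Proof.
move=> pF F0 t t0; apply/matrixP => i j.
have pij : primitive (fun t => F t i j) (fun=> 0).
  by have := pF i j; under [X in primitive _ X -> _]eq_fun do rewrite mxE.
have := primitive_nonincreasing pij _ (lexx 0) t0.
have := primitive_nonincreasing (primitiveZ (-1) pij) _ (lexx 0) t0.
rewrite F0 mxE mulr0 mulN1r oppr_le0 => H1 H2; apply/eqP; rewrite eq_le.
rewrite H1 ?H2//; first by apply: aeW => r _.
by apply: aeW => r _.
Qed.

Lemma mxlocint_mul m n p (F : R -> 'M[R]_(m, n)) (U : R -> 'M[R]_(n, p)) :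
  (forall i j, continuous (fun t => F t i j)) -> mxlocint U ->
  mxlocint (fun t => F t *m U t).
Proof.
move=> cF lU i j; under eq_fun do rewrite mxE.
by apply: locint_sum => k; exact: locintM.
Qed.

(** A continuous derivative is bounded on [[0, T]], so that [f] is Lipschitz there. *)
Lemma primitive_derive (f f' : R -> R) :
  (forall t : R, is_derive t 1 f (f' t)) -> continuous f' -> primitive f f'.
Proof.
move=> df cf'; split; last by apply: aeW => t _.
move=> T T0.
have [M [Mr MP]] := continuous_bounded_segment T cf'.
have bd x : 0 <= x -> x <= T -> `|f' x| <= Num.max 0 (M + 1).
  move=> x0 xT; rewrite le_max; apply/orP; right.
  by apply: (MP (M + 1)); [rewrite ltrDl|rewrite /= in_itv/= x0].
have cf : continuous f.
  move=> x; apply/differentiable_continuous/derivable1_diffP.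
  exact: (@ex_derive _ _ _ _ _ _ _ (df x)).
apply: (@ac_lipschitz _ _ _ (Num.max 0 (M + 1))); first by rewrite le_max lexx.
move=> x y x0; rewrite le_eqVlt => /orP[/eqP<- _|xy yT].
  by rewrite !subrr normr0 mulr0.
have [c] := @MVT R f f' x y xy (fun z _ => df z) (continuous_subspaceT cf).
rewrite in_itv/= => /andP[xc cy] ->.
rewrite normrM (ger0_norm (_ : 0 <= y - x)) ?subr_ge0 ?(ltW xy)//.
rewrite ler_wpM2r ?subr_ge0 ?(ltW xy)//.
by apply: bd; [exact: le_trans x0 (ltW xc)|exact: le_trans (ltW cy) yT].
Qed.

End MatrixPrimitive.

Section MatrixExponential.
Variable R : realType.
Local Notation mu := (@lebesgue_measure R).

Definition expterm n (A : 'M[R]_n) (j : nat) : 'M[R]_n := (j`!%:R)^-1 *: A ^+ j.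

(** The coefficients of an entry of [L * exp (x A)] as a power series in [x].  The
    factor [L] makes the family stable under termwise differentiation, which replaces
    [L] by [L A]. *)
Definition expcoef m n (L : 'M[R]_(m, n)) (A : 'M[R]_n) i j (k : nat) : R :=
  (L *m expterm A k) i j.

Lemma cvg_mx_entries m n (u : nat -> 'M[R]_(m, n)) (X : 'M[R]_(m, n)) :
  (forall i j, (fun N => u N i j) @ \oo --> X i j) -> u @ \oo --> X.
Proof.
move=> uX; apply/cvgrPdist_le => /= e e0; near=> N.
rewrite /Num.Def.normr/= mx_normrE (bigmax_le _ (ltW e0))//= => i _.
rewrite !mxE/=.
move: i; near: N; apply: filter_forall => /= i.
exact: ((cvgrPdist_le _ _).1 (uX i.1 i.2)).
Unshelve. all: by end_near. Qed.

(** A crude matrix norm, whose powers dominate the entries of the powers of [A]. *)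
Definition mxabs m n (A : 'M[R]_(m, n)) : R := \sum_i \sum_j `|A i j|.

Lemma mxabs_ge0 m n (A : 'M[R]_(m, n)) : 0 <= mxabs A.
Proof. by do 2 apply: sumr_ge0 => ? _. Qed.

Lemma row_le_mxabs m n (A : 'M[R]_(m, n)) i : \sum_j `|A i j| <= mxabs A.
Proof.
rewrite /mxabs (bigD1 i)//= lerDl; apply: sumr_ge0 => a _.
by apply: sumr_ge0.
Qed.

Lemma mxpow_le n (A : 'M[R]_n) k i j : `|(A ^+ k) i j| <= mxabs A ^+ k.
Proof.
elim: k i j => [|k IH] i j.
  by rewrite !expr0 mxE; case: (i == j); rewrite ?normr1 ?normr0.
rewrite !exprS mxE (le_trans (ler_norm_sum _ _ _))//.
apply: (@le_trans _ _ (\sum_c `|A i c| * mxabs A ^+ k)).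
  by apply: ler_sum => c _; rewrite normrM ler_wpM2l.
by rewrite -mulr_suml ler_wpM2r ?exprn_ge0 ?mxabs_ge0// row_le_mxabs.
Qed.

Lemma expcoef_le m n (L : 'M[R]_(m, n)) A i j k :
  `|expcoef L A i j k| <= mxabs L * (mxabs A ^+ k / k`!%:R).
Proof.
rewrite /expcoef mxE (le_trans (ler_norm_sum _ _ _))//.
apply: (@le_trans _ _ (\sum_c `|L i c| * (mxabs A ^+ k / k`!%:R))).
  apply: ler_sum => c _; rewrite normrM ler_wpM2l// mxE normrM mulrC.
  rewrite [`|_^-1|]ger0_norm ?invr_ge0//.
  by rewrite ler_wpM2r ?invr_ge0 ?mxpow_le.
rewrite -mulr_suml ler_wpM2r ?row_le_mxabs// divr_ge0//.
by rewrite exprn_ge0 ?mxabs_ge0.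
Qed.

Lemma is_cvg_expcoef m n (L : 'M[R]_(m, n)) A i j x :
  cvgn (pseries (expcoef L A i j) x).
Proof.
apply: normed_cvg.
apply: (@series_le_cvg _ _ (fun k => mxabs L * exp_coeff (mxabs A * `|x|) k)).
- by move=> k /=.
- move=> k; rewrite mulr_ge0 ?mxabs_ge0// exp_coeff_ge0// mulr_ge0 ?mxabs_ge0//.
- move=> k; rewrite /exp_coeff/= normrM normrX exprMn.
  apply: le_trans (ler_wpM2r _ (expcoef_le _ _ _ _ _)) _; first exact: exprn_ge0.
  by rewrite le_eqVlt; apply/orP; left; apply/eqP; field;
    rewrite pnatr_eq0 -lt0n fact_gt0.
- have -> : (fun k => mxabs L * exp_coeff (mxabs A * `|x|) k) =
            mxabs L *: exp_coeff (mxabs A * `|x|) by [].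
  by apply: is_cvg_seriesZ; exact: is_cvg_series_exp_coeff.
Qed.

Lemma pseries_diffs_expcoef m n (L : 'M[R]_(m, n)) A i j :
  pseries_diffs (expcoef L A i j) = expcoef (L *m A) A i j.
Proof.
apply/funext => k; rewrite /pseries_diffs /expcoef /expterm.
have AS : A *m A ^+ k = A ^+ k.+1 by rewrite exprS.
rewrite -!scalemxAr -[L *m A *m _]mulmxA AS [in LHS]mxE [RHS]mxE factS natrM.
by rewrite invfM !mulrA mulfV ?pnatr_eq0// mul1r.
Qed.

Lemma exptermZ n (A : 'M[R]_n) t k : expterm (t *: A) k = t ^+ k *: expterm A k.
Proof.
suff E : (t *: A) ^+ k = t ^+ k *: A ^+ k by rewrite /expterm E !scalerA mulrC.
elim: k => [|k IH]; first by rewrite !expr0 scale1r.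
rewrite !exprS IH -[LHS]/((t *: A) *m (t ^+ k *: A ^+ k)).
by rewrite -scalemxAl -scalemxAr scalerA.
Qed.

(** The series defining [expmx] is taken in the space of matrices; it converges
    because its entries are dominated by an exponential series. *)
Lemma expmx_entries n (A : 'M[R]_n) t i j :
  (series (expterm (t *: A)) N i j) @[N --> \oo] --> expmx (t *: A) i j.
Proof.
pose X : 'M[R]_n := \matrix_(i, j) limn (pseries (expcoef 1%:M A i j) t).
have cX a b : (series (expterm (t *: A)) N a b) @[N --> \oo] --> X a b.
  rewrite mxE.
  have -> : (fun N => series (expterm (t *: A)) N a b) =
            pseries (expcoef 1%:M A a b) t.
    apply/funext => N; rewrite /pseries /series/= summxE.
    by apply: eq_bigr => k _; rewrite exptermZ /expcoef mul1mx mxE mulrC.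
  exact: is_cvg_expcoef.
suff -> : expmx (t *: A) = X by [].
by apply/cvg_lim => //; exact: cvg_mx_entries.
Qed.

Lemma cvg_sumr (T : Type) (F : set_system T) (FF : Filter F) (I : Type) (r : seq I)
    (f : I -> T -> R) (l : I -> R) :
  (forall k, f k x @[x --> F] --> l k) ->
  (\sum_(k <- r) f k x) @[x --> F] --> \sum_(k <- r) l k.
Proof.
move=> fl; elim: r => [|k r IH].
  by under eq_fun do rewrite big_nil; rewrite big_nil; exact: cvg_cst.
under eq_fun do rewrite big_cons; rewrite big_cons.
exact: cvgD (fl k) IH.
Qed.

Lemma mul_expmxE m n (L : 'M[R]_(m, n)) A t i j :
  (L *m expmx (t *: A)) i j = limn (pseries (expcoef L A i j) t).
Proof.
apply/esym/cvg_lim => //.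
have -> : pseries (expcoef L A i j) t =
    (fun N => \sum_k L i k * series (expterm (t *: A)) N k j).
  apply/funext => N; rewrite /pseries /series/=.
  transitivity ((L *m \sum_(0 <= k < N) expterm (t *: A) k) i j).
    rewrite mulmx_sumr summxE; apply: eq_bigr => k _.
    by rewrite exptermZ -scalemxAr [RHS]mxE mulrC.
  by rewrite mxE.
rewrite mxE; apply: cvg_sumr => k.
by apply: cvgM; [exact: cvg_cst|exact: expmx_entries].
Qed.

Lemma expmx_comm n (A : 'M[R]_n) t : A *m expmx (t *: A) = expmx (t *: A) *m A.
Proof.
apply/matrixP => i j.
have H1 : (\sum_k A i k * series (expterm (t *: A)) N k j) @[N --> \oo] -->
    (A *m expmx (t *: A)) i j.
  rewrite mxE; apply: cvg_sumr => k.
  by apply: cvgM; [exact: cvg_cst|exact: expmx_entries].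
have H2 : (\sum_k series (expterm (t *: A)) N i k * A k j) @[N --> \oo] -->
    (expmx (t *: A) *m A) i j.
  rewrite mxE; apply: cvg_sumr => k.
  by apply: cvgM; [exact: expmx_entries|exact: cvg_cst].
have E : (fun N => \sum_k A i k * series (expterm (t *: A)) N k j) =
         (fun N => \sum_k series (expterm (t *: A)) N i k * A k j).
  apply/funext => N.
  transitivity ((A *m series (expterm (t *: A)) N) i j); first by rewrite mxE.
  transitivity ((series (expterm (t *: A)) N *m A) i j); last by rewrite mxE.
  rewrite /series/= mulmx_sumr mulmx_suml !summxE; apply: eq_bigr => k _.
  rewrite exptermZ /expterm -!scalemxAr -!scalemxAl.
  by have -> : A *m A ^+ k = A ^+ k *m A := etrans (esym (exprS A k)) (exprSr A k).
rewrite -E in H2.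
exact: (cvg_unique _ H1 H2).
Qed.

Lemma is_derive_expmx m n (L : 'M[R]_(m, n)) A i j (t : R) :
  is_derive t 1 (fun t => (L *m expmx (t *: A)) i j)
    ((L *m (A *m expmx (t *: A))) i j).
Proof.
have -> : (fun t => (L *m expmx (t *: A)) i j) =
          (fun t => limn (pseries (expcoef L A i j) t)).
  by apply/funext => s; exact: mul_expmxE.
rewrite mulmxA mul_expmxE -pseries_diffs_expcoef.
apply: (@pseries_snd_diffs _ _ (`|t| + 1)).
- exact: is_cvg_expcoef.
- by rewrite pseries_diffs_expcoef; exact: is_cvg_expcoef.
- by rewrite !pseries_diffs_expcoef; exact: is_cvg_expcoef.
- by rewrite (@ger0_norm _ (_ + 1)) ?addr_ge0// ltrDl.
Qed.

Lemma expmx0 n (A : 'M[R]_n) : expmx (0 *: A) = 1%:M.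
Proof.
rewrite -[LHS]mul1mx; apply/matrixP => i j; rewrite mul_expmxE.
apply/cvg_lim => //; apply: cvg_near_cst; near=> N.
rewrite /pseries /series/=.
have N0 : (0 < N)%N by near: N; exists 1%N.
rewrite big_ltn// expr0 mulr1 big_nat_cond big1 ?addr0.
  by rewrite /expcoef mul1mx /expterm fact0 invr1 scale1r expr0.
by move=> k /andP[/andP[k0 _] _]; rewrite expr0n gtn_eqF// mulr0.
Unshelve. all: by end_near. Qed.

Lemma continuous_expmx m n (L : 'M[R]_(m, n)) A i j :
  continuous (fun t : R => (L *m expmx (t *: A)) i j).
Proof.
move=> x; apply/differentiable_continuous/derivable1_diffP.
exact: (@ex_derive _ _ _ _ _ _ _ (is_derive_expmx L A i j x)).
Qed.

(** The derivative of [exp ((r - x) A) exp (x A)] in [x] vanishes; compare [x = 0]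
    with [x = t], where [r = s + t]. *)
Lemma expmxD n (A : 'M[R]_n) s t :
  expmx ((s + t) *: A) = expmx (s *: A) *m expmx (t *: A).
Proof.
pose r := s + t.
have dr (a b : 'I_n) (x : R) : is_derive x 1 (fun x => expmx ((r - x) *: A) a b)
    (- (A *m expmx ((r - x) *: A)) a b).
  have dg : is_derive x 1 (fun x => r - x) (- 1 : R).
    by have := is_deriveB (is_derive_cst r x (1 : R)) (is_derive_id x (1 : R)); rewrite sub0r.
  have := @is_derive1_comp R (fun x => (1%:M *m expmx (x *: A)) a b) (fun x => r - x)
    x _ _ (is_derive_expmx _ _ _ _ _) dg.
  rewrite mulrN1 !mul1mx /comp/=.
  by under [X in is_derive _ _ X _ -> _]eq_fun do rewrite mul1mx.
have d0 (a b : 'I_n) (x : R) :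
    is_derive x 1 (fun x => (expmx ((r - x) *: A) *m expmx (x *: A)) a b) 0.
  have -> : (fun x => (expmx ((r - x) *: A) *m expmx (x *: A)) a b) =
     \sum_c ((fun x => expmx ((r - x) *: A) a c) * (fun x => expmx (x *: A) c b)).
    by apply/funext => y; rewrite mxE fct_sumE.
  apply: (is_derive_eq (is_derive_sum _)) => [c|].
    have := is_derive_expmx 1%:M A c b x; rewrite !mul1mx.
    under [X in is_derive _ _ X _ -> _]eq_fun do rewrite mul1mx.
    by move=> dc; exact: is_deriveM (dr a c x) dc.
  rewrite big_split/=.
  transitivity ((expmx ((r - x) *: A) *m (A *m expmx (x *: A))) a b -
     (A *m expmx ((r - x) *: A) *m expmx (x *: A)) a b).
    congr (_ + _); first by rewrite mxE.
    rewrite [in RHS]mxE -sumrN.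
    by apply: eq_bigr => c _; rewrite -mulNr [RHS]mulrC.
  by rewrite mulmxA -expmx_comm subrr.
apply/matrixP => a b.
have := is_derive_0_is_cst t 0 (d0 a b).
by rewrite subr0 expmx0 mulmx1 /r addrK => ->.
Qed.

Lemma expmx_mulN n (A : 'M[R]_n) t : expmx (t *: A) *m expmx (- t *: A) = 1%:M.
Proof. by rewrite -expmxD subrr expmx0. Qed.

Lemma mxprimitive_expmx n (A : 'M[R]_n) :
  mxprimitive (fun t => expmx (t *: A)) (fun t => A *m expmx (t *: A)).
Proof.
move=> i j; apply: primitive_derive; last exact: continuous_expmx.
move=> t; have := is_derive_expmx 1%:M A i j t; rewrite !mul1mx.
by under [X in is_derive _ _ X _ -> _]eq_fun do rewrite mul1mx.
Qed.

End MatrixExponential.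

(** * Linear differential equations *)

Section LinearODE.
Variable R : realType.
Local Notation mu := (@lebesgue_measure R).

Lemma mxlocint_expmx n p (A : 'M[R]_n) (U : R -> 'M[R]_(n, p)) :
  mxlocint U -> mxlocint (fun s => expmx (- s *: A) *m U s).
Proof.
move=> lU; apply: mxlocint_mul lU => i j.
have -> : (fun s : R => expmx (- s *: A) i j) =
          (fun s : R => (1%:M *m expmx (s *: A)) i j) \o -%R.
  by apply/funext => s /=; rewrite mul1mx.
move=> s; apply: continuous_comp; first exact: opp_continuous.
exact: continuous_expmx.
Qed.

(** Variation of constants. *)
Lemma linear_ode n p (A : 'M[R]_n) (U : R -> 'M[R]_(n, p)) : mxlocint U ->
  let Y t := expmx (t *: A) *m
    \matrix_(i, j) \int[mu]_(s in `[0, t]) ((expmx (- s *: A) *m U s) i j) in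
  mxprimitive Y (fun t => A *m Y t + U t) /\ Y 0 = 0.
Proof.
move=> lU Y; split; last first.
  rewrite /Y expmx0 mul1mx.
  by apply/matrixP => i j; rewrite !mxE set_itv1 Rintegral_set1.
have lV : mxlocint (fun s => expmx (- s *: A) *m U s).
  exact: mxlocint_expmx.
have pG : mxprimitive
    (fun t => \matrix_(i, j) \int[mu]_(s in `[0, t]) ((expmx (- s *: A) *m U s) i j))
    (fun s => expmx (- s *: A) *m U s).
  move=> i j; under eq_fun do rewrite mxE.
  exact: primitive_integral.
apply: eq_mxprimitive (mxprimitiveM (mxprimitive_expmx A) pG) => // t.
by rewrite !mulmxA expmx_mulN mul1mx.
Qed.

(** [exp (- t A) E t] has derivative zero almost everywhere. *)
Lemma linear_ode_uniq n p (A : 'M[R]_n) (E : R -> 'M[R]_(n, p)) :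
  mxprimitive E (fun t => A *m E t) -> E 0 = 0 -> forall t, 0 <= t -> E t = 0.
Proof.
move=> pE E0 t t0.
have pN : mxprimitive (fun t => expmx (t *: - A)) (fun t => - A *m expmx (t *: - A)).
  exact: mxprimitive_expmx.
have pP : mxprimitive (fun t => expmx (t *: - A) *m E t) (fun=> 0).
  apply: eq_mxprimitive (mxprimitiveM pN pE) => // s.
  by rewrite expmx_comm mulmxN !mulNmx mulmxA addNr.
have := mxprimitive_eq0 pP _ t0; rewrite E0 mulmx0 => /(_ erefl) H.
have := expmx_mulN A t; rewrite scaleNr -scalerN => e1.
by rewrite -[LHS]mul1mx -e1 -mulmxA H mulmx0.
Qed.

Lemma Rintegral_lincomb (I : Type) (r : seq I) (c : I -> R) (u : I -> R -> R) T :
  (forall k, locint (u k)) ->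
  \int[mu]_(s in `[0, T]) (\sum_(k <- r) c k * u k s) =
  \sum_(k <- r) c k * \int[mu]_(s in `[0, T]) u k s.
Proof.
move=> lu.
have lc k : locint (fun s => c k * u k s).
  by apply: locintM => //; exact: cst_continuous.
elim: r => [|k r IH].
  rewrite big_nil; under eq_Rintegral do rewrite big_nil.
  by rewrite Rintegral_cst// mul0r.
rewrite big_cons -IH; under eq_Rintegral do rewrite big_cons.
rewrite RintegralD//; first last.
- by have [] := locint_sum r lc.
- by have [] := lc k.
by rewrite RintegralZl//; have [] := lu k.
Qed.

(** The kernel [C exp (t A) B] is a power series in [t] whose coefficients are the
    Markov parameters up to factorials. *)
Lemma markov_expmx n n' k l (C : 'M[R]_(l, n)) A (B : 'M[R]_(n, k))
    (C' : 'M[R]_(l, n')) A' (B' : 'M[R]_(n', k)) :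
  (forall j, C *m A ^+ j *m B = C' *m A' ^+ j *m B') ->
  forall t, C *m expmx (t *: A) *m B = C' *m expmx (t *: A') *m B'.
Proof.
move=> markov t; apply/matrixP => i j.
have lim m (L : 'M[R]_(l, m)) X (K : 'M[R]_(m, k)) :
    (\sum_c (L *m series (expterm (t *: X)) N) i c * K c j) @[N --> \oo] -->
    (L *m expmx (t *: X) *m K) i j.
  rewrite mxE; apply: cvg_sumr => c; apply: cvgM; last exact: cvg_cst.
  rewrite mxE; under eq_fun do rewrite mxE.
  apply: cvg_sumr => d; apply: cvgM; first exact: cvg_cst.
  exact: expmx_entries.
have term m (L : 'M[R]_(l, m)) X (K : 'M[R]_(m, k)) N :
    \sum_c (L *m series (expterm (t *: X)) N) i c * K c j =
    (\sum_(0 <= a < N) (t ^+ a / a`!%:R) *: (L *m X ^+ a *m K)) i j.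
  transitivity ((L *m series (expterm (t *: X)) N *m K) i j); first by rewrite [RHS]mxE.
  rewrite /series/= mulmx_sumr mulmx_suml; congr (fun_of_matrix _ i j).
  apply: eq_bigr => a _.
  by rewrite exptermZ /expterm scalerA -scalemxAr -scalemxAl.
have H1 := lim _ C A B; have H2 := lim _ C' A' B'.
apply: (cvg_unique _ H1 _) => //.
suff -> : (fun N => \sum_c (C *m series (expterm (t *: A)) N) i c * B c j) =
   (fun N => \sum_c (C' *m series (expterm (t *: A')) N) i c * B' c j) by [].
apply/funext => N; rewrite !term; congr (fun_of_matrix _ i j).
by apply: eq_bigr => a _; rewrite markov.
Qed.

(** The convolution in the input-output map is the variation of constants formula.
    The state may belong to another realisation with the same Markov parameters: the
    given one can have unstable modes that do not show in its transfer matrix, and no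
    bound on its own state would be available. *)
Lemma iomap_state k l (Delta : lti R k l) n (A : 'M[R]_n) (B : 'M[R]_(n, k))
    (C : 'M[R]_(l, n)) (z : R -> 'cV[R]_k) :
  (forall j, lti_C Delta *m lti_A Delta ^+ j *m lti_B Delta = C *m A ^+ j *m B) ->
  mxlocint z ->
  exists eta : R -> 'cV[R]_n,
    [/\ mxprimitive eta (fun t => A *m eta t + B *m z t), eta 0 = 0 &
        forall t, iomap Delta z t = C *m eta t + lti_D Delta *m z t].
Proof.
move=> markov lz.
have lBz : mxlocint (fun t => B *m z t).
  by apply: mxlocint_mul => // i j; exact: cst_continuous.
have [pY Y0] := linear_ode A lBz.
set Y := (fun t => _) in pY Y0; exists Y; split=> // t.
rewrite /iomap; congr (_ + _).
have lV : mxlocint (fun s => expmx (- s *: A) *m (B *m z s)).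
  exact: mxlocint_expmx.
apply/matrixP => i j; rewrite (ord1 j) mxE /Y mulmxA [RHS]mxE.
transitivity (\sum_c (C *m expmx (t *: A)) i c *
    \int[mu]_(s in `[0, t]) ((expmx (- s *: A) *m (B *m z s)) c 0)); last first.
  by apply: eq_bigr => c _; congr (_ * _); rewrite [RHS]mxE.
rewrite -Rintegral_lincomb; last by move=> c; exact: lV.
apply: eq_Rintegral => s _.
rewrite (markov_expmx markov) expmxD.
transitivity ((C *m expmx (t *: A) *m (expmx (- s *: A) *m (B *m z s))) i 0).
  by rewrite !mulmxA.
by rewrite mxE.
Qed.

End LinearODE.

(** * Trajectories of the interconnection *)

Section Trajectories.
Variable R : realType.
Local Notation mu := (@lebesgue_measure R).

Lemma enorm_sqr n (v : 'cV[R]_n) : enorm v ^+ 2 = \sum_i v i 0 ^+ 2.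
Proof. by rewrite sqr_sqrtr// sumr_ge0// => i _; rewrite sqr_ge0. Qed.

Lemma enorm_ge0 n (v : 'cV[R]_n) : 0 <= enorm v.
Proof. exact: sqrtr_ge0. Qed.

Lemma le_enorm n (v : 'cV[R]_n) i : `|v i 0| <= enorm v.
Proof.
rewrite -(@ler_pXn2r _ 2)// ?nnegrE ?enorm_ge0// enorm_sqr real_normK ?num_real//.
by rewrite (bigD1 i)//= lerDl sumr_ge0// => j _; rewrite sqr_ge0.
Qed.

(** On bounded intervals, [|u_i| <= 1 + |u|^2]. *)
Lemma L2e_mxlocint n (u : R -> 'cV[R]_n) : L2e u -> mxlocint u.
Proof.
move=> [mu_ iu] i j; rewrite (ord1 j); split=> // T.
have mT k : measurable_fun (`[0, T] : set R) (fun t : R => u t k 0).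
  apply: measurable_funS (mu_ k) => //.
  by move=> x /=; rewrite !in_itv/= => /andP[->].
have me : measurable_fun (`[0, T] : set R) (fun t : R => enorm (u t) ^+ 2).
  have -> : (fun t : R => enorm (u t) ^+ 2) = (fun t : R => \sum_k u t k 0 ^+ 2).
    by apply/funext => t; rewrite enorm_sqr.
  by apply: measurable_sum => k; exact: measurable_funX.
have ie : mu.-integrable `[0, T] (fun t => (enorm (u t) ^+ 2)%:E).
  apply/integrableP; split; first exact/measurable_EFinP.
  apply: le_lt_trans (iu T); rewrite le_eqVlt; apply/orP; left; apply/eqP.
  by apply: eq_integral => t _; rewrite gee0_abs// lee_fin sqr_ge0.
have i1 : mu.-integrable `[0, T] (cst 1%:E).
  apply: measurable_bounded_integrable => //.
  - exact: (compact_finite_measure (@segment_compact _ 0 T)).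
  - by exists 1; split=> // M M1 x _ /=; rewrite normr1 ltW.
apply: le_integrable (integrableD _ i1 ie) => //.
  by apply/measurable_EFinP; exact: mT.
move=> t _ /=; rewrite lee_fin.
have e0 := enorm_ge0 (u t).
rewrite (ger0_norm (_ : 0 <= 1 + _)); last by rewrite addr_ge0// sqr_ge0.
apply: le_trans (le_enorm _ _) _; nra.
Qed.

Lemma is_derive_mx m n (F : R -> 'M[R]_(m, n)) (F' : 'M[R]_(m, n)) (t : R) :
  is_derive t 1 F F' -> forall i j, is_derive t 1 (fun t => F t i j) (F' i j).
Proof.
move=> [dF <-] i j; apply: DeriveDef; first exact: ((derivable_mxP F t 1).1 dF i j).
by rewrite derive_mx// mxE.
Qed.

Lemma abs_continuous_ac n (a b : R) (x : R -> 'cV[R]_n) i :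
  abs_continuous a b x -> ac a b (fun t => x t i 0).
Proof.
move=> acx e e0; have [d d0 H] := acx e e0; exists d => // m s t st dis sd.
apply: le_lt_trans (H m s t st dis sd); apply: ler_sum => k _.
by have := le_enorm (x (t k) - x (s k)) i; rewrite !mxE.
Qed.

Lemma mxprimitive_trajectory n (x x' : R -> 'cV[R]_n) :
  (forall T : R, abs_continuous 0 T x) ->
  {ae mu, forall t : R, 0 <= t -> is_derive t 1 x (x' t)} -> mxprimitive x x'.
Proof.
move=> acx dx i j; rewrite (ord1 j); split.
  by move=> T T0; exact: abs_continuous_ac.
by apply: (ae_mono dx) => t H t0; apply: is_derive_mx; exact: H.
Qed.

End Trajectories.

(** * Positive semidefinite Hermitian matrices *)

Section HermitianForms.
Local Open Scope sesquilinear_scope.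
Variable C : numClosedFieldType.

Definition psd n (W : 'M[C]_n) : Prop :=
  forall v : 'cV[C]_n, 0 <= (v ^t* *m W *m v) 0 0.

Lemma adjM m n p (A : 'M[C]_(m, n)) (B : 'M[C]_(n, p)) :
  (A *m B) ^t* = B ^t* *m A ^t*.
Proof. by rewrite trmx_mul map_mxM. Qed.

Lemma adjD m n (A B : 'M[C]_(m, n)) : (A + B) ^t* = A ^t* + B ^t*.
Proof. by rewrite linearD map_mxD. Qed.

Lemma adjB m n (A B : 'M[C]_(m, n)) : (A - B) ^t* = A ^t* - B ^t*.
Proof. by rewrite linearB map_mxB. Qed.

Lemma adj_diag n (d : 'rV[C]_n) : (diag_mx d) ^t* = diag_mx (\row_j (d 0 j)^*).
Proof.
by rewrite tr_diag_mx map_diag_mx; congr diag_mx; apply/rowP => j; rewrite !mxE.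
Qed.

Lemma adj11 (A : 'M[C]_1) : (A ^t*) 0 0 = (A 0 0)^*.
Proof. by rewrite !mxE. Qed.

Lemma form_col m n (M : 'M[C]_n) (F : 'M[C]_(n, m)) j :
  (F ^t* *m M *m F) j j = ((col j F) ^t* *m M *m col j F) 0 0.
Proof.
have -> : (col j F) ^t* *m M *m col j F =
    (delta_mx j 0) ^t* *m ((F ^t* *m M *m F) *m delta_mx j 0).
  by rewrite colE adjM !mulmxA.
rewrite -colE [RHS]mxE (bigD1 j)//= big1 ?addr0.
  have -> : ((delta_mx j 0 : 'cV[C]_m) ^t*) 0 j = 1 by rewrite !mxE !eqxx conjC1.
  by rewrite mul1r [RHS]mxE.
by move=> i ij; rewrite !mxE (negbTE ij) conjC0 mul0r.
Qed.

Lemma psd_congr m n (W : 'M[C]_n) (K : 'M[C]_(m, n)) :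
  psd W -> psd (K *m W *m K ^t*).
Proof.
move=> pW v; have := pW (K ^t* *m v).
by rewrite adjM trmxCK !mulmxA.
Qed.

Lemma adj_mul_ge0 n (v : 'cV[C]_n) : 0 <= (v ^t* *m v) 0 0.
Proof. by rewrite mxE; apply: sumr_ge0 => i _; rewrite !mxE mulrC mul_conjC_ge0. Qed.

Lemma adj_mul_eq0 n (v : 'cV[C]_n) : (v ^t* *m v) 0 0 = 0 -> v = 0.
Proof.
rewrite mxE => /eqP; rewrite psumr_eq0 => [/allP H|i _]; last first.
  by rewrite !mxE mulrC mul_conjC_ge0.
apply/matrixP => i j; rewrite (ord1 j) mxE.
have := H i (mem_index_enum _); rewrite !mxE mulrC mul_conjC_eq0.
by move=> /eqP.
Qed.

(** If [W v] were nonzero, a small step from [v] in the direction [- W v] would make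
    the form negative. *)
Lemma psd_kernel n (W : 'M[C]_n) (v : 'cV[C]_n) : W ^t* = W -> psd W ->
  (v ^t* *m W *m v) 0 0 = 0 -> W *m v = 0.
Proof.
move=> hW pW v0; pose y := W *m v; apply: adj_mul_eq0; rewrite -/y.
set a := (y ^t* *m y) 0 0; set b := (y ^t* *m W *m y) 0 0.
have a0 : 0 <= a by exact: adj_mul_ge0.
have b0 : 0 <= b by exact: pW.
have b1 : 0 < b + 1 by rewrite ltr_wpDl.
apply/eqP; apply: contraT => an0.
have a_gt0 : 0 < a by rewrite lt_def an0.
pose t := a / (b + 1).
have t0 : 0 < t by rewrite divr_gt0.
have tr : t^* = t by apply: conj_Creal; rewrite ger0_real// ltW.
have := pW (v - t *: y).
have -> : (v - t *: y) ^t* = v ^t* - t *: y ^t*.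
  by rewrite adjB; congr (_ - _); rewrite linearZ map_mxZ; congr (_ *: _).
rewrite !mulmxBl !mulmxBr -!scalemxAl -!scalemxAr.
have vWy : v ^t* *m W *m y = y ^t* *m y by rewrite {2}/y adjM hW.
have yWv : y ^t* *m W *m v = y ^t* *m y by rewrite -mulmxA.
rewrite vWy yWv.
have -> : (v ^t* *m W *m v - t *: (y ^t* *m y) -
   (t *: (y ^t* *m y) - t *: (t *: (y ^t* *m W *m y)))) 0 0
   = 0 - t * a - (t * a - t * (t * b)).
  by rewrite -v0 /a /b !mxE.
have -> : 0 - t * a - (t * a - t * (t * b)) = t * (t * b - a - a) by ring.
rewrite pmulr_rge0// => H.
have : t * b <= a.
  rewrite /t mulrAC ler_pdivrMr// ler_wpM2l// lerDl ler01//.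
move=> tba; have : a <= 0.
  rewrite -subr_ge0 sub0r; apply: le_trans H _.
  by rewrite gerDr subr_le0.
by rewrite (lt_geF a_gt0).
Qed.

Lemma hermitian_spectral n (W : 'M[C]_n) : W ^t* *m W = W *m W ^t* ->
  exists2 U : 'M[C]_n, U *m U ^t* = 1%:M /\ U ^t* *m U = 1%:M &
  exists d : 'rV[C]_n, W = U ^t* *m diag_mx d *m U.
Proof.
move=> WW; have /orthomx_spectralP : W \is normalmx by apply/normalmxP.
set U := spectralmx W; have uU := spectral_unitarymx W.
rewrite invmx_unitary// -/U => WE; exists U; last by exists (spectral_diag W).
have UU : U *m U ^t* = 1%:M by apply/unitarymxP.
by split=> //; apply: mulmx1C.
Qed.

Lemma psd_spectral n (W : 'M[C]_n) : W ^t* = W -> psd W ->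
  exists2 U : 'M[C]_n, U *m U ^t* = 1%:M /\ U ^t* *m U = 1%:M &
  exists2 d : 'rV[C]_n, forall j, 0 <= d 0 j & W = U ^t* *m diag_mx d *m U.
Proof.
move=> hW pW; have [|U [UU UU'] [d WE]] := @hermitian_spectral _ W.
  by rewrite hW.
exists U => //; exists d => // j.
have := psd_congr U pW (delta_mx j 0).
have -> : U *m W *m U ^t* = diag_mx d.
  by rewrite WE !mulmxA UU mul1mx -mulmxA UU mulmx1.
have := form_col (diag_mx d) 1%:M j.
rewrite colE mul1mx => <-; rewrite mulmx1 trmx1 map_mx1 mul1mx.
by rewrite mxE eqxx.
Qed.

(** In an orthonormal eigenbasis of [W] the trace is a combination of values of the
    form of [M], weighted by the eigenvalues of [W]. *)
Lemma trace_psd_ge0 n (M W : 'M[C]_n) : W ^t* = W -> psd W -> psd M ->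
  0 <= \tr (M *m W).
Proof.
move=> hW pW pM; have [U [UU UU'] [d d0 ->]] := psd_spectral hW pW.
rewrite !mulmxA mxtrace_mulC !mulmxA; apply: sumr_ge0 => j _.
rewrite mul_mx_diag mxE mulr_ge0//.
have := form_col M (U ^t*) j; rewrite trmxCK => ->.
exact: pM.
Qed.

(** The equation [A W + W A^* = 0] says that [A] is skew-adjoint for the form dual to
    [W].  Concretely, [W = F F^*] and [A F = F Om] with [Om] skew-Hermitian, and
    diagonalising [Om] writes [W] as a sum of [f f^*] over eigenvectors [f] of [A] with
    imaginary eigenvalues. *)
Lemma skew_psd_trace n (A W M : 'M[C]_n) : W ^t* = W -> psd W ->
  A *m W + W *m A ^t* = 0 ->
  (forall (f : 'cV[C]_n) (lam : C), lam^* = - lam -> A *m f = lam *: f ->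
    0 <= (f ^t* *m M *m f) 0 0) ->
  0 <= \tr (M *m W).
Proof.
move=> hW pW AW FM; have [U [UU UU'] [d d0 WE]] := psd_spectral hW pW.
pose s j := sqrtC (d 0 j).
have s0 j : 0 <= s j by rewrite sqrtC_ge0.
have sr j : (s j)^* = s j by apply: conj_Creal; rewrite ger0_real.
have ss j : s j * s j = d 0 j by rewrite -expr2 sqrtCK.
pose S := diag_mx (\row_j s j).
have SS : S *m S ^t* = diag_mx d.
  rewrite /S adj_diag mulmx_diag; congr diag_mx; apply/matrixP => i j.
  by rewrite (ord1 i) !mxE sr ss.
have [B BE] : exists B, B = U *m A *m U ^t* by eexists.
have Brel i j : B i j * d 0 j + d 0 i * (B j i)^* = 0.
  have : B *m diag_mx d + diag_mx d *m B ^t* = 0.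
    have -> : B *m diag_mx d = U *m (A *m W) *m U ^t*.
      by rewrite WE BE !mulmxA -[_ *m U *m U ^t*]mulmxA UU mulmx1.
    have -> : diag_mx d *m B ^t* = U *m (W *m A ^t*) *m U ^t*.
      by rewrite WE BE !adjM trmxCK !mulmxA UU mul1mx.
    by rewrite -mulmxDl -mulmxDr AW mulmx0 mul0mx.
  move=> /matrixP/(_ i j); rewrite mul_mx_diag mul_diag_mx !mxE.
  by [].
(* rows of Om where s vanishes are 0, by the convention 0^-1 = 0 *)
pose Om : 'M[C]_n := \matrix_(i, j) ((s i)^-1 * B i j * s j).
have OmS : Om ^t* = - Om.
  apply/matrixP => i j; rewrite !mxE !rmorphM fmorphV/= !sr.
  have [si0|si0] := eqVneq (s i) 0; first by rewrite si0 invr0 mulr0 !mul0r oppr0.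
  have [sj0|sj0] := eqVneq (s j) 0; first by rewrite sj0 invr0 mulr0 !mul0r oppr0.
  have := Brel i j; rewrite -!ss => H.
  have {}H : s i * (B j i)^* * s i = - (B i j * s j * s j).
    by apply/eqP; rewrite -addr_eq0 -[X in _ == X]H; apply/eqP; ring.
  apply: (mulfI si0); apply: (mulIf sj0).
  rewrite mulrN mulNr !mulrA mulfV// mul1r -H.
  have -> : s i * (s j)^-1 * (B j i)^* * s i * s j =
            s i * (B j i)^* * s i * ((s j)^-1 * s j) by ring.
  by rewrite mulVf// mulr1.
pose F := U ^t* *m S.
have WF : W = F *m F ^t* by rewrite /F adjM trmxCK !mulmxA -(mulmxA _ S) SS -WE.
have AF : A *m F = F *m Om.
  have -> : A *m F = U ^t* *m (B *m S).
    by rewrite /F BE !mulmxA UU' mul1mx -[_ *m U ^t* *m _]mulmxA.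
  rewrite /F -mulmxA; congr (_ *m _).
  apply/matrixP => i j; rewrite mul_mx_diag mul_diag_mx !mxE.
  have [si0|si0] := eqVneq (s i) 0; last by rewrite !mulrA mulfV// mul1r.
  rewrite si0 !mul0r; have := Brel i j; rewrite -[d 0 i]ss si0 !mul0r addr0.
  by rewrite -ss mulrA => /eqP; rewrite mulf_eq0 => /orP[/eqP//|/eqP->]; rewrite mulr0.
have [|V [VV VV'] [e OmE]] := @hermitian_spectral _ Om.
  by rewrite OmS mulNmx mulmxN.
have e0 j : (e 0 j)^* = - e 0 j.
  have : diag_mx e = V *m Om *m V ^t*.
    by rewrite OmE !mulmxA VV mul1mx -mulmxA VV mulmx1.
  move=> eE; have /matrixP/(_ j j) : (diag_mx e) ^t* = - diag_mx e.
    by rewrite eE !adjM trmxCK OmS mulmxA mulmxN mulNmx.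
  by rewrite !mxE eqxx !mulr1n.
pose G := F *m V ^t*.
have WG : W = G *m G ^t*.
  rewrite WF /G adjM trmxCK.
  by rewrite !mulmxA -(mulmxA _ _ V) VV' mulmx1.
have AG : A *m G = G *m diag_mx e.
  by rewrite /G mulmxA AF OmE !mulmxA -(mulmxA _ V) VV mulmx1.
rewrite WG mulmxA mxtrace_mulC mulmxA; apply: sumr_ge0 => j _.
rewrite form_col; apply: (FM _ (e 0 j)) => //.
have -> : A *m col j G = col j (A *m G) by rewrite !colE mulmxA.
by rewrite AG; apply/colP => i; rewrite mul_mx_diag !mxE mulrC.
Qed.

End HermitianForms.

(** * The dual of the Kalman-Yakubovich-Popov lemma *)

Section KYPDual.
Local Open Scope sesquilinear_scope.
Variable C : numClosedFieldType.

Lemma psd_ulsub n k (W11 : 'M[C]_n) (W12 : 'M[C]_(n, k)) (W21 : 'M[C]_(k, n)) (W22 : 'M[C]_k) :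
  psd (block_mx W11 W12 W21 W22) -> psd W11.
Proof.
move=> pW v; have := pW (col_mx v 0).
rewrite tr_col_mx map_row_mx mul_row_block mul_row_col.
by rewrite trmx0 map_mx0 !mul0mx !addr0 mulmx0 addr0.
Qed.

(** By [psd_kernel] the kernel of [W11] is contained in that of [W21], so that [W21]
    factors through [W11]. *)
Lemma psd_feedback n k (W11 : 'M[C]_n) (W12 : 'M[C]_(n, k)) (W21 : 'M[C]_(k, n)) (W22 : 'M[C]_k) :
  let W := block_mx W11 W12 W21 W22 in W ^t* = W -> psd W ->
  exists K : 'M[C]_(k, n), K *m W11 = W21.
Proof.
move=> W hW pW; have p11 := psd_ulsub pW.
have h11 : W11 ^t* = W11.
  by move: hW; rewrite /W tr_block_mx map_block_mx => /eq_block_mx[].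
have [U [UU UU'] [d d0 WE]] := psd_spectral h11 p11.
exists (W21 *m U ^t* *m diag_mx (\row_j (d 0 j)^-1) *m U).
have -> : W21 *m U ^t* *m diag_mx (\row_j (d 0 j)^-1) *m U *m W11 =
    W21 *m U ^t* *m (diag_mx (\row_j (d 0 j)^-1) *m diag_mx d) *m U.
  by rewrite WE !mulmxA -(mulmxA _ U) UU mulmx1.
suff -> : W21 *m U ^t* *m (diag_mx (\row_j (d 0 j)^-1) *m diag_mx d) = W21 *m U ^t*.
  by rewrite -mulmxA UU' mulmx1.
rewrite mulmx_diag; apply/matrixP => i j; rewrite mul_mx_diag mxE [X in _ * X]mxE.
rewrite [X in _ * (X * _)]mxE.
have [dj0|dj0] := eqVneq (d 0 j) 0; last by rewrite mulVf// mulr1.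
rewrite dj0 mulr0 mulr0; apply/esym.
pose u := col j (U ^t*).
have u0 : (u ^t* *m W11 *m u) 0 0 = 0.
  rewrite -form_col trmxCK WE !mulmxA UU mul1mx -mulmxA UU mulmx1.
  by rewrite mxE eqxx.
have := psd_kernel hW pW (v := col_mx u 0).
rewrite tr_col_mx map_row_mx mul_row_block mul_row_col trmx0 map_mx0 !mul0mx.
rewrite !addr0 mulmx0 addr0 u0 => /(_ erefl).
rewrite mul_block_col !mulmx0 !addr0 -[0 in RHS]col_mx0 => /eq_col_mx[_].
rewrite /u colE mulmxA -colE => /colP/(_ i).
by rewrite [col _ _ _ _]mxE [X in _ = X -> _]mxE.
Qed.

(** Write [W = T W11 T^* + E L E^*] with [T = (1; K)], [E = (0; 1)] and [L] the Schur
    complement.  The closed loop [A + B K] is skew with respect to [W11], which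
    therefore splits along its imaginary eigenvectors: there the frequency condition
    applies at finite frequencies.  The part of [L] is the condition at infinity. *)
Lemma kyp_dual n k (A : 'M[C]_n) (B : 'M[C]_(n, k)) (M : 'M[C]_(n + k))
    (W11 : 'M[C]_n) (W12 : 'M[C]_(n, k)) (W21 : 'M[C]_(k, n)) (W22 : 'M[C]_k) :
  let W := block_mx W11 W12 W21 W22 in W ^t* = W -> psd W ->
  (A *m W11 + B *m W21) + (A *m W11 + B *m W21) ^t* = 0 ->
  (forall (f : 'cV[C]_n) g (lam : C), lam^* = - lam ->
     A *m f + B *m g = lam *: f ->
     0 <= ((col_mx f g) ^t* *m M *m col_mx f g) 0 0) ->
  (forall g, 0 <= ((col_mx (0 : 'cV[C]_n) g) ^t* *m M *m col_mx 0 g) 0 0) ->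
  0 <= \tr (M *m W).
Proof.
move=> W hW pW AW FM F0.
have [K KW] := psd_feedback hW pW.
have [h11 h21 h12 h22] : [/\ W11 ^t* = W11, W21 ^t* = W12, W12 ^t* = W21 & W22 ^t* = W22].
  by move: hW; rewrite /W tr_block_mx map_block_mx => /eq_block_mx[].
have KW' : W11 *m K ^t* = W12 by rewrite -h11 -adjM KW.
pose L := W22 - K *m W11 *m K ^t*.
have hL : L ^t* = L by rewrite /L adjB !adjM trmxCK h11 h22 mulmxA.
pose T : 'M[C]_(n + k, n) := col_mx 1%:M K.
pose E : 'M[C]_(n + k, k) := col_mx 0 1%:M.
have TE : T ^t* = row_mx 1%:M (K ^t*).
  by rewrite /T tr_col_mx map_row_mx trmx1 map_mx1.
have EE : E ^t* = row_mx 0 1%:M.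
  by rewrite /E tr_col_mx map_row_mx trmx0 map_mx0 trmx1 map_mx1.
have WE : W = T *m W11 *m T ^t* + E *m L *m E ^t*.
  have -> : T *m W11 = col_mx W11 W21 by rewrite /T mul_col_mx mul1mx KW.
  have -> : E *m L = col_mx 0 L by rewrite /E mul_col_mx mul1mx mul0mx.
  rewrite TE EE !mul_col_row !mulmx1 KW' !mulmx0 add_block_mx !addr0.
  by rewrite /W /L KW addrC subrK.
have pL : psd L.
  move=> u; have := pW (col_mx (- (K ^t* *m u)) u); rewrite WE.
  set x := col_mx _ u.
  have xT : T ^t* *m x = 0 by rewrite TE mul_row_col mul1mx addNr.
  have xE : E ^t* *m x = u by rewrite EE mul_row_col mul0mx mul1mx add0r.
  rewrite mulmxDr mulmxDl -!(mulmxA _ _ x).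
  have xE' : x ^t* *m E = u ^t* by rewrite -xE adjM trmxCK.
  by rewrite xT !mulmx0 add0r xE !mulmxA xE'.
have p11 := psd_ulsub pW.
rewrite WE mulmxDr mxtraceD addr_ge0//.
- rewrite !mulmxA mxtrace_mulC !mulmxA.
  apply: (@skew_psd_trace _ _ (A + B *m K)) => //.
    have -> : W11 *m (A + B *m K) ^t* = ((A + B *m K) *m W11) ^t*.
      by rewrite adjM h11.
    by rewrite mulmxDl -[B *m K *m _]mulmxA KW.
  move=> f lam lr Af.
  have := FM f (K *m f) lam lr; rewrite mulmxA -mulmxDl => /(_ Af).
  have -> : col_mx f (K *m f) = T *m f by rewrite /T mul_col_mx mul1mx.
  by rewrite adjM !mulmxA.
- rewrite !mulmxA mxtrace_mulC !mulmxA.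
  apply: trace_psd_ge0 => // g.
  have := F0 g.
  have -> : col_mx 0 g = E *m g by rewrite /E mul_col_mx mul1mx mul0mx.
  by rewrite adjM !mulmxA.
Qed.

End KYPDual.

Section RealForms.
Local Open Scope sesquilinear_scope.
Variable R : realType.
Local Open Scope complex_scope.

Definition rpsd n (W : 'M[R]_n) : Prop :=
  forall v : 'cV[R]_n, 0 <= (v^T *m W *m v) 0 0.

Lemma cmxM m n p (A : 'M[R]_(m, n)) (B : 'M[R]_(n, p)) :
  cmx (A *m B) = cmx A *m cmx B.
Proof. exact: map_mxM. Qed.

Lemma cmxD m n (A B : 'M[R]_(m, n)) : cmx (A + B) = cmx A + cmx B.
Proof. exact: map_mxD. Qed.

Lemma cmx0 m n : cmx (0 : 'M[R]_(m, n)) = 0.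
Proof. exact: map_mx0. Qed.

Lemma conj_real (x : R) : Num.conj (x%:C) = x%:C.
Proof. by apply: conj_Creal; rewrite complex_real. Qed.

Lemma adj_cmx m n (A : 'M[R]_(m, n)) : (cmx A) ^t* = cmx A^T.
Proof. by apply/matrixP => i j; rewrite !mxE conj_real. Qed.

Lemma cmx_tr m n (A : 'M[R]_(m, n)) : (cmx A)^T = cmx A^T.
Proof. by rewrite /cmx map_trmx. Qed.

Lemma trace_cmx n (A : 'M[R]_n) : \tr (cmx A) = (\tr A)%:C.
Proof. by rewrite /cmx -trace_map_mx. Qed.

Lemma complex_split m n (v : 'M[R[i]]_(m, n)) :
  v = cmx (map_mx (@complex.Re R) v) + 'i *: cmx (map_mx (@complex.Im R) v).
Proof. by apply/matrixP => i j; rewrite !mxE -complexE. Qed.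

Lemma form_iota (T : comNzRingType) (c : T) n (X Y : 'rV[T]_n) (M : 'M[T]_n)
    (a b : 'cV[T]_n) : c * c = -1 ->
  (X - c *: Y) *m M *m (a + c *: b) =
  X *m M *m a + Y *m M *m b + c *: (X *m M *m b - Y *m M *m a).
Proof.
move=> cc; rewrite mulmxDr mulmxBl -(scalemxAl c Y) mulmxBl -(scalemxAl c (Y *m M)).
rewrite mulmxBl -!scalemxAr -(scalemxAl c (Y *m M)) scalerA cc scaleN1r opprK.
rewrite scalerBr -!addrA; congr (_ + _).
by rewrite addrC [_ + Y *m M *m b]addrC -addrA.
Qed.

(** The cross terms cancel because [A] is symmetric. *)
Lemma form_complex n (A : 'M[R]_n) (a b : 'cV[R]_n) : A^T = A ->
  let v := cmx a + 'i *: cmx b in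
  (v ^t* *m cmx A *m v) 0 0 = ((a^T *m A *m a) 0 0 + (b^T *m A *m b) 0 0)%:C.
Proof.
move=> sA v.
have -> : v ^t* = cmx a^T - 'i *: cmx b^T.
  rewrite /v adjD adj_cmx; congr (_ + _).
  apply/matrixP => i j; rewrite !mxE rmorphM/= conj_real.
  by rewrite -mulNr; congr (_ * _); rewrite /Num.conj/=; simpc.
have ab : b^T *m A *m a = a^T *m A *m b.
  have : (b^T *m A *m a)^T = b^T *m A *m a by rewrite [LHS]mx11_scalar [RHS]mx11_scalar mxE.
  by rewrite !trmx_mul trmxK sA mulmxA => <-.
rewrite form_iota -?expr2 ?sqr_i// -!cmxM ab subrr scaler0 addr0 -cmxD.
by rewrite !mxE.
Qed.

Lemma psd_cmx n (A : 'M[R]_n) : A^T = A -> rpsd A -> psd (cmx A).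
Proof.
move=> sA pA v; rewrite [v]complex_split form_complex//.
by rewrite ler0c addr_ge0//; exact: pA.
Qed.

Lemma rtrace_psd_ge0 n (M W : 'M[R]_n) : M^T = M -> W^T = W -> rpsd M -> rpsd W ->
  0 <= \tr (M *m W).
Proof.
move=> sM sW pM pW; rewrite -ler0c -trace_cmx cmxM.
apply: trace_psd_ge0; [by rewrite adj_cmx sW|exact: psd_cmx|exact: psd_cmx].
Qed.

End RealForms.

(** * Quadratic forms, Lyapunov functions and frequency conditions *)

Section QuadraticForms.
Variable R : realType.

Definition qf n (M : 'M[R]_n) (v : 'cV[R]_n) : R := (v^T *m M *m v) 0 0.
Definition nsq n (v : 'cV[R]_n) : R := (v^T *m v) 0 0.

Lemma nsqE n (v : 'cV[R]_n) : nsq v = \sum_i v i 0 ^+ 2.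
Proof. by rewrite /nsq mxE; apply: eq_bigr => i _; rewrite mxE expr2. Qed.

Lemma nsq_ge0 n (v : 'cV[R]_n) : 0 <= nsq v.
Proof. by rewrite nsqE sumr_ge0// => i _; rewrite sqr_ge0. Qed.

Lemma nsq_eq0 n (v : 'cV[R]_n) : nsq v = 0 -> v = 0.
Proof.
rewrite nsqE => /eqP; rewrite psumr_eq0 => [/allP H|i _]; last exact: sqr_ge0.
apply/colP => i; rewrite mxE; have := H i (mem_index_enum _).
by rewrite sqrf_eq0 => /eqP.
Qed.

Lemma nsq_col m n (a : 'cV[R]_m) (b : 'cV[R]_n) : nsq (col_mx a b) = nsq a + nsq b.
Proof. by rewrite /nsq tr_col_mx mul_row_col mxE. Qed.

Lemma le_nsq n (v : 'cV[R]_n) i : v i 0 ^+ 2 <= nsq v.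
Proof. by rewrite nsqE (bigD1 i)//= lerDl sumr_ge0// => j _; rewrite sqr_ge0. Qed.

Lemma qfE n (A : 'M[R]_n) v : qf A v = \sum_i \sum_j v i 0 * A i j * v j 0.
Proof.
rewrite /qf mxE exchange_big/=; apply: eq_bigr => j _.
by rewrite mxE mulr_suml; apply: eq_bigr => i _; rewrite mxE.
Qed.

Lemma qfD n (M N : 'M[R]_n) v : qf (M + N) v = qf M v + qf N v.
Proof. by rewrite /qf mulmxDr mulmxDl mxE. Qed.

Lemma qfB n (M N : 'M[R]_n) v : qf (M - N) v = qf M v - qf N v.
Proof. by rewrite /qf mulmxBr mulmxBl !mxE. Qed.

Lemma qfZ n c (M : 'M[R]_n) v : qf (c *: M) v = c * qf M v.
Proof. by rewrite /qf -scalemxAr -scalemxAl mxE. Qed.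

Lemma qfN n (M : 'M[R]_n) v : qf (- M) v = - qf M v.
Proof. by rewrite /qf mulmxN mulNmx mxE. Qed.

Lemma qf1 n (v : 'cV[R]_n) : qf 1%:M v = nsq v.
Proof. by rewrite /qf mulmx1. Qed.

Lemma qf_congr m n (M : 'M[R]_m) (K : 'M[R]_(m, n)) v :
  qf (K^T *m M *m K) v = qf M (K *m v).
Proof. by rewrite /qf trmx_mul !mulmxA. Qed.

Lemma tr11 (A : 'M[R]_1) : A^T = A.
Proof. by apply/matrixP => i j; rewrite mxE !ord1. Qed.

Lemma qf_trace n (M : 'M[R]_n) v : qf M v = \tr (M *m (v *m v^T)).
Proof. by rewrite mulmxA mxtrace_mulC mulmxA /mxtrace big_ord1. Qed.

Lemma bilin_sym n (M : 'M[R]_n) (u v : 'cV[R]_n) : M^T = M ->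
  (u^T *m M *m v) 0 0 = (v^T *m M *m u) 0 0.
Proof. by move=> sM; rewrite -[u^T *m M *m v]tr11 !trmx_mul trmxK sM mulmxA. Qed.

Lemma qf_le_entries n (M : 'M[R]_n) (d : R) v : 0 <= d ->
  (forall i j, `|M i j| <= d) -> `|qf M v| <= d * (n * n)%:R * nsq v.
Proof.
move=> d0 Md.
rewrite qfE.
apply: le_trans (ler_norm_sum _ _ _) _.
apply: (@le_trans _ _ (\sum_(i < n) \sum_(j < n) d * nsq v)).
  apply: ler_sum => i _; apply: le_trans (ler_norm_sum _ _ _) _.
  apply: ler_sum => j _; rewrite !normrM.
  have hi := le_nsq v i; have hj := le_nsq v j.
  have h : `|v i 0| * `|v j 0| <= nsq v.
    rewrite -real_normK ?num_real// in hi; rewrite -real_normK ?num_real// in hj.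
    nra.
  rewrite [_ * `|M i j|]mulrC -mulrA.
  by rewrite ler_pM// mulr_ge0.
rewrite !sumr_const !card_ord -mulrnA -[X in X <= _]mulr_natr.
by rewrite -mulrA [nsq v * _]mulrC mulrA.
Qed.

Lemma qf_bound n (M : 'M[R]_n) : exists2 K, 0 <= K & forall v, `|qf M v| <= K * nsq v.
Proof.
exists (mxabs M * (n * n)%:R); first by rewrite mulr_ge0 ?mxabs_ge0.
move=> v; apply: qf_le_entries; first exact: mxabs_ge0.
move=> i j; apply: le_trans (row_le_mxabs M i).
by rewrite (bigD1 j)//= lerDl sumr_ge0.
Qed.

Lemma primitive_qf n (P : 'M[R]_n) (x x' : R -> 'cV[R]_n) : P^T = P ->
  mxprimitive x x' ->
  primitive (fun t => qf P (x t)) (fun t => 2 * ((x t)^T *m P *m x' t) 0 0).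
Proof.
move=> sP px.
have := mxprimitiveM (mxprimitive_mulr P (mxprimitive_tr px)) px.
move=> /(_ 0 0).
under [X in primitive _ X -> _]eq_fun do rewrite mxE bilin_sym// -[_ + _]mulr2n -mulr_natl.
by [].
Qed.

End QuadraticForms.

Section Separation.
Variable R : realType.

Let ip N (x y : 'rV[R]_N) : R := \sum_i x 0 i * y 0 i.

(** The first order condition of a minimisation: divide by [t] and let it tend to 0. *)
Lemma lin_le_sq (p q : R) : 0 <= q ->
  (forall t, 0 < t -> t <= 1 -> t * p <= t ^+ 2 * q) -> p <= 0.
Proof.
move=> q0 H; rewrite leNgt; apply/negP => p0.
have pq : 0 < p + q + 1 by lra.
have t0 : 0 < p / (p + q + 1) by rewrite divr_gt0.
have := H _ t0; rewrite ler_pdivrMr// mul1r => /(_ ltac:(lra)).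
rewrite expr2 -mulrA ler_pM2l// mulrAC ler_pdivlMr//; nra.
Qed.

(** Let [c] be the point of the closure of [K] nearest to [M], which exists by
    compactness.  The first order conditions say that [M - c] is nonpositive on [K] and
    orthogonal to [c].  Either [c = M], or [c - M] separates.  As [K] need not be
    closed, the first case only gives approximation. *)
Lemma cone_separation N (K : set 'rV[R]_N) (M : 'rV[R]_N) :
  (forall x y, K x -> K y -> K (x + y)) ->
  (forall c x, 0 <= c -> K x -> K (c *: x)) -> K 0 ->
  (forall e, 0 < e -> exists2 k, K k & forall i, `|M 0 i - k 0 i| <= e) \/
  exists2 W, forall k, K k -> 0 <= ip W k & ip W M < 0.
Proof.
move=> KD KZ K0.
pose f (x : 'rV[R]_N) : R := \sum_i (M 0 i - x 0 i) ^+ 2.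
have cf : continuous f.
  move=> x; rewrite /f.
  apply: (@cvg_sumr R _ (nbhs x) (nbhs_filter x)) => i; rewrite expr2; under eq_fun do rewrite expr2.
  have ci : (M 0 i - (y : 'rV[R]_N) 0 i) @[y --> x] --> M 0 i - x 0 i.
    exact: cvgB (cvg_cst (M 0 i)) (@coord_continuous R 1 N 0 i x).
  exact: cvgM.
pose A : set 'rV[R]_N := closure K `&` [set x | f x <= f 0].
have clP x : closure K x <-> forall e : R, 0 < e -> exists2 k, K k & `|x - k| < e.
  split=> [Kx e e0|H B /nbhs_ballP[r /= r0 rB]].
    have [k [Kk]] := Kx _ (nbhsx_ballx x e e0).
    by rewrite -ball_normE => ?; exists k.
  have [k Kk xk] := H r r0; exists k; split=> //; apply: rB.
  by rewrite -ball_normE.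
have A0 : A 0 by split => //=; apply/clP => e e0; exists 0 => //; rewrite subrr normr0.
have cA : compact A.
  apply: bounded_closed_compact; last first.
    apply: closedI; first exact: closed_closure.
    apply: (@preimage_closed _ _ f [set y | y <= f 0]); last exact: closed_le.
    by move=> x _; exact: cf.
  exists (`|M| + f 0 + 1); split; first exact: num_real.
  move=> y yM v [_ /= fv]; apply: le_trans (ltW yM).
  have le_coord (u : 'rV[R]_N) i : `|u 0 i| <= `|u|.
    rewrite [leRHS]/Num.Def.normr/= mx_normrE.
    exact: (le_bigmax _ (fun i => `|u i.1 i.2|) (0, i)).
  have f00 : 0 <= f 0 by apply: sumr_ge0 => i _; rewrite sqr_ge0.
  rewrite [leLHS]/Num.Def.normr/= mx_normrE (bigmax_le _ _)//=.
    by rewrite !addr_ge0.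
  move=> [i0 i] _ /=; rewrite (ord1 i0).
  have fi : `|M 0 i - v 0 i| ^+ 2 <= f 0.
    rewrite real_normK ?num_real//; apply: le_trans fv.
    by rewrite /f (bigD1 i)//= lerDl sumr_ge0// => j _; rewrite sqr_ge0.
  have -> : v 0 i = M 0 i - (M 0 i - v 0 i) by ring.
  apply: le_trans (ler_normB _ _) _; rewrite -addrA lerD//.
  by have := normr_ge0 (M 0 i - v 0 i); nra.
have [c cA' cmin] := @compact_EVT_min _ _ f A (ex_intro _ 0 A0) cA (continuous_subspaceT cf).
have {cA'} [Kc fc] : A c by rewrite inE in cA'.
have {}cmin x : closure K x -> f c <= f x.
  move=> Kx; have [fx|/ltW fx] := leP (f x) (f 0); first by apply: cmin; rewrite inE.
  exact: le_trans fc fx.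
have fE (y : 'rV[R]_N) (t : R) : f (c + t *: y) =
    f c - 2 * t * ip (M - c) y + t ^+ 2 * ip y y.
  rewrite /f /ip !mulr_sumr -sumrN -!big_split/=; apply: eq_bigr => i _.
  by rewrite !mxE; ring.
have ipy y : 0 <= ip y y by apply: sumr_ge0 => i _; rewrite -expr2 sqr_ge0.
have ipK k : K k -> ip (M - c) k <= 0.
  move=> Kk; apply: (@lin_le_sq _ (ip k k)) => // t t0 _.
  have : f c <= f (c + t *: k).
    apply: cmin; apply/clP => e e0; have [k' Kk' ck'] := (clP c).1 Kc e e0.
    exists (k' + t *: k); first by apply: KD => //; apply: KZ => //; exact: ltW.
    by rewrite opprD addrACA subrr addr0.
  by rewrite fE; have := ipy _ k; nra.
have clZ (s : R) : 0 <= s -> closure K (s *: c).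
  move=> s0; apply/clP => e e0.
  have s1 : 0 < s + 1 by lra.
  have [k Kk ck] := (clP c).1 Kc (e / (s + 1)) (divr_gt0 e0 s1).
  exists (s *: k); first exact: KZ.
  rewrite -scalerBr normrZ ger0_norm//.
  rewrite ltr_pdivlMr// in ck; apply: le_lt_trans ck.
  by rewrite mulrC ler_wpM2l// lerDl.
have ipc : ip (M - c) c = 0.
  apply/eqP; rewrite eq_le; apply/andP; split.
    apply: (@lin_le_sq _ (ip c c)) => // t t0 _.
    have := cmin ((1 + t) *: c) (clZ _ _); rewrite scalerDl scale1r fE.
    by move=> /(_ ltac:(lra)); have := ipy _ c; nra.
  rewrite -oppr_le0; apply: (@lin_le_sq _ (ip c c)) => // t t0 t1.
  have := cmin ((1 - t) *: c) (clZ _ _); rewrite scalerBl scale1r -scaleNr fE.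
  by move=> /(_ ltac:(lra)); have := ipy _ c; rewrite sqrrN; nra.
have [cM|cM] := eqVneq c M.
  left=> e e0; have [k Kk ck] := (clP c).1 Kc e e0; exists k => // i.
  rewrite -cM; apply: le_trans (ltW ck).
  rewrite [leRHS]/Num.Def.normr/= mx_normrE.
  by apply: le_trans; last exact: (le_bigmax _ _ (0, i)); rewrite !mxE.
right; exists (c - M).
  move=> k Kk; have := ipK k Kk; rewrite -oppr_ge0; congr (_ <= _).
  by rewrite /ip -sumrN; apply: eq_bigr => i _; rewrite !mxE; ring.
have -> : ip (c - M) M = - ip (M - c) (M - c) - ip (M - c) c.
  by rewrite /ip -!sumrN -big_split/=; apply: eq_bigr => i _; rewrite !mxE; ring.
rewrite ipc subr0 oppr_lt0 lt_def ipy andbT; apply: contra cM.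
rewrite psumr_eq0 => [/allP H|i _]; last by rewrite -expr2 sqr_ge0.
apply/eqP/rowP => i; have := H i (mem_index_enum _).
by rewrite -expr2 sqrf_eq0 !mxE subr_eq0 => /eqP.
Qed.

Lemma ip_mxvec n (w : 'rV[R]_(n * n)) (k : 'M[R]_n) :
  ip w (mxvec k) = \tr ((vec_mx w)^T *m k).
Proof.
rewrite -[in LHS](vec_mxK w); move: (vec_mx w) => W.
rewrite /ip (reindex (uncurry (@mxvec_index n n)))/=; last exact: curry_mxvec_bij.
rewrite (eq_bigr (fun p => (fun i j => W i j * k i j) p.1 p.2)); last first.
  by case=> i j _ /=; rewrite !mxvecE.
rewrite -(pair_bigA _ (fun i j => W i j * k i j)).
rewrite exchange_big /mxtrace; apply: eq_bigr => j _.
by rewrite mxE; apply: eq_bigr => i _; rewrite mxE.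
Qed.

(** Only tested on symmetric matrices, a separating functional can be symmetrised;
    closeness of entries becomes closeness of quadratic forms. *)
Lemma sym_separation n (K : set 'M[R]_n) (M : 'M[R]_n) :
  (forall x y, K x -> K y -> K (x + y)) ->
  (forall c x, 0 <= c -> K x -> K (c *: x)) -> K 0 ->
  (forall k, K k -> k^T = k) -> M^T = M ->
  (forall e, 0 < e -> exists2 k, K k & forall v, `|qf (M - k) v| <= e * nsq v) \/
  exists W, [/\ W^T = W, forall k, K k -> 0 <= \tr (W *m k) & \tr (W *m M) < 0].
Proof.
move=> KD KZ K0 Ksym sM.
have [|||approx|[w wK wM]] := @cone_separation _ [set mxvec k | k in K] (mxvec M).
- move=> _ _ [x Kx <-] [y Ky <-]; exists (x + y); [exact: KD|exact: linearD].
- move=> c _ c0 [x Kx <-]; exists (c *: x); [exact: KZ|exact: linearZ].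
- by exists 0 => //; exact: linear0.
- left=> e e0.
  have n0 : 0 < (n * n)%:R + 1 :> R by rewrite ltr_wpDl.
  have [_ [k Kk <-] Mk] := approx (e / ((n * n)%:R + 1)) (divr_gt0 e0 n0).
  exists k => // v.
  apply: le_trans (qf_le_entries _ (d := e / ((n * n)%:R + 1)) _ _) _.
  + by rewrite divr_ge0 ?ltW.
  + by move=> i j; have := Mk (mxvec_index i j); rewrite !mxvecE !mxE.
  + rewrite ler_wpM2r ?nsq_ge0// mulrAC ler_pdivrMr// ler_wpM2l ?(ltW e0)//.
    by rewrite lerDl.
- right; exists (vec_mx w + (vec_mx w)^T).
  have E k : k^T = k -> \tr ((vec_mx w + (vec_mx w)^T) *m k) = 2 * ip w (mxvec k).
    move=> sk; rewrite ip_mxvec mulmxDl mxtraceD mulr_natl mulr2n; congr (_ + _).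
    by rewrite -mxtrace_tr trmx_mul sk mxtrace_mulC.
  split.
  + by rewrite linearD/= trmxK addrC.
  + move=> k Kk; rewrite E; last exact: Ksym.
    by rewrite mulr_ge0//; apply: wK; exists k.
  + by rewrite E// pmulr_rlt0.
Qed.

End Separation.

Section Lyapunov.
Local Open Scope sesquilinear_scope.
Variable R : realType.

Lemma mxtraceN n (A : 'M[R]_n) : \tr (- A) = - \tr A.
Proof. exact: raddfN. Qed.

Lemma outer_sym n (v : 'cV[R]_n) : (v *m v^T)^T = v *m v^T.
Proof. by rewrite trmx_mul trmxK. Qed.

Lemma outer_rpsd n (v : 'cV[R]_n) : rpsd (v *m v^T).
Proof.
move=> u; rewrite mulmxA -mulmxA -[v^T *m u]trmxK trmx_mul trmxK.
by rewrite mxE big_ord1 [X in _ * X]mxE -expr2 sqr_ge0.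
Qed.

(** Apply the factors [a - r] to [v] one after the other.  Between the last vector
    outside the kernel of [W] and the next one, [a] acts as [r] modulo this kernel.
    With the linear factors of the characteristic polynomial of [a], this yields an
    eigenvector modulo the kernel without forming a quotient space. *)
Lemma first_kernel_hit (F : fieldType) n m (W : 'M[F]_(m, n)) (a : 'M[F]_n)
    (rs : seq F) (v : 'cV[F]_n) :
  W *m v != 0 -> W *m (foldr (fun r u => (a - r%:M) *m u) v rs) = 0 ->
  exists2 r, r \in rs & exists2 y : 'cV[F]_n, W *m y != 0 & W *m (a *m y) = r *: (W *m y).
Proof.
elim: rs => [|r rs IH] Wv /=; first by move=> W0; rewrite W0 eqxx in Wv.
set u := foldr _ _ _ in IH *; move=> Wu.
have [Wu0|Wu0] := eqVneq (W *m u) 0.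
  by have [r' r'rs H] := IH Wv Wu0; exists r' => //; rewrite inE r'rs orbT.
exists r; first by rewrite inE eqxx.
exists u => //; apply/eqP; rewrite -subr_eq0 -Wu mulmxBl mulmxBr.
by rewrite mul_scalar_mx -scalemxAr.
Qed.

Lemma foldr_mulmx (F : fieldType) n (a : 'M[F]_n) (rs : seq F) (v : 'cV[F]_n) :
  foldr (fun r u => (a - r%:M) *m u) v rs =
  foldr (fun r b => (a - r%:M) *m b) 1%:M rs *m v.
Proof. by elim: rs => [|r rs IH] /=; rewrite ?mul1mx// IH mulmxA. Qed.

(** If [W] is nonzero, [first_kernel_hit] and the theorem of Cayley and Hamilton give
    an eigenvalue [r] of [A] and [y] with [W y <> 0] and [W A^T y = r W y].  Then
    [y^* (A W + W A^T) y = 2 Re r y^* W y] is negative. *)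
Lemma hurwitz_no_growth n (A W : 'M[R]_n) : hurwitz A -> W^T = W -> rpsd W ->
  rpsd (A *m W + W *m A^T) -> W = 0.
Proof.
move=> hA sW pW pAW.
apply/eqP; apply: contraT => W0.
case: n A W hA sW pW pAW W0 => [|n] A W hA sW pW pAW W0.
  by rewrite [W]flatmx0 eqxx in W0.
have [v Wv] : exists v : 'cV[R[i]]_n.+1, cmx W *m v != 0.
  apply: contrapT => H; move/negP: W0; apply; apply/eqP/matrixP => i j.
  have := H; apply: contra_notP => Wij; exists (delta_mx j 0).
  apply/negP => /eqP; rewrite -colE => /colP/(_ i); rewrite !mxE => /complexI.
  by rewrite -[X in _ = X -> _]/(0 : R) => W0ij; apply: Wij; rewrite W0ij mxE.
pose a := cmx A^T.
have [rs rsE] := closed_field_poly_normal (char_poly a).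
have CH : foldr (fun r b => (a - r%:M) *m b) 1%:M rs = 0.
  rewrite -(Cayley_Hamilton a) rsE (monicP (char_poly_monic a)) scale1r.
  elim: rs {rsE} => [|r rs IH] /=; first by rewrite big_nil; exact: esym (rmorph1 _).
  by rewrite big_cons rmorphM rmorphB/= horner_mx_X horner_mx_C IH.
have [|r rrs [y Wy yr]] := @first_kernel_hit _ _ _ (cmx W) a rs v Wv.
  by rewrite foldr_mulmx CH mul0mx mulmx0.
have rA : complex.Re r < 0.
  apply: hA; rewrite eigenvalue_root_char.
  have -> : char_poly (cmx A) = char_poly a.
    rewrite /a -cmx_tr /char_poly -[in LHS]det_tr; congr (\det _).
    by apply/matrixP => i j; rewrite !mxE eq_sym.
  rewrite rsE rootZ ?lead_coef_eq0 ?monic_neq0 ?char_poly_monic//.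
  by rewrite root_prod_XsubC.
have hW : (cmx W) ^t* = cmx W by rewrite adj_cmx sW.
have pW' : psd (cmx W) by exact: psd_cmx.
set g := (y ^t* *m cmx W *m y) 0 0.
have g0 : 0 < g.
  rewrite lt_def pW' andbT; apply: contra Wy => /eqP g0.
  by rewrite (psd_kernel hW pW' g0).
have sAW : (A *m W + W *m A^T)^T = A *m W + W *m A^T.
  by rewrite linearD/= !trmx_mul trmxK sW addrC.
have := psd_cmx sAW pAW y.
have -> : (y ^t* *m cmx (A *m W + W *m A^T) *m y) 0 0 = (r + Num.conj r) * g.
  have yWa : (y ^t* *m (cmx W *m a) *m y) 0 0 = r * g.
    by rewrite -mulmxA -[cmx W *m a *m y]mulmxA yr -scalemxAr mxE mulmxA.
  rewrite cmxD mulmxDr mulmxDl [LHS]mxE.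
  have -> : y ^t* *m cmx (A *m W) *m y = (y ^t* *m (cmx W *m a) *m y) ^t*.
    by rewrite !adjM trmxCK hW /a adj_cmx trmxK cmxM !mulmxA.
  rewrite adj11 yWa cmxM yWa rmorphM/= (conj_Creal (ger0_real (ltW g0))).
  by rewrite -mulrDl addrC.
have -> : r + Num.conj r = (2 * complex.Re r)%:C%C.
  by rewrite rmorphM/= rmorph_nat; exact: addcJ.
rewrite pmulr_lge0// ler0c.
by rewrite pmulr_rge0// leNgt rA.
Qed.

(** The identity matrix is separated from the cone of matrices [A^T P + P A - Z] with
    [P] negative and [Z] positive semidefinite, unless it can be approximated by them,
    which suffices.  A separating matrix is the negative of a covariance [W'] that grows
    along [A], and [hurwitz_no_growth] excludes it. *)
Lemma lyapunov n (A : 'M[R]_n) : hurwitz A -> exists P : 'M[R]_n,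
  [/\ P^T = P, forall v, qf P v <= 0 & forall v, nsq v <= 2 * (v^T *m P *m (A *m v)) 0 0].
Proof.
move=> hA.
pose K : set 'M[R]_n := [set k | exists P Z : 'M[R]_n,
  [/\ P^T = P, rpsd (- P), Z^T = Z, rpsd Z & k = A^T *m P + P *m A - Z]].
have rpsdD (X Y : 'M[R]_n) : rpsd X -> rpsd Y -> rpsd (X + Y).
  by move=> pX pY v; rewrite -/(qf _ v) qfD addr_ge0//; [exact: pX|exact: pY].
have rpsdZ (c : R) (X : 'M[R]_n) : 0 <= c -> rpsd X -> rpsd (c *: X).
  by move=> c0 pX v; rewrite -/(qf _ v) qfZ mulr_ge0//; exact: pX.
have rpsd0 : rpsd (0 : 'M[R]_n) by move=> v; rewrite mulmx0 mul0mx mxE.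
have [|||||approx|[W [sW KW W1]]] := @sym_separation R n K 1%:M.
- move=> _ _ [P [Z [sP pP sZ pZ ->]]] [P' [Z' [sP' pP' sZ' pZ' ->]]].
  exists (P + P'), (Z + Z'); split.
  + by rewrite linearD/= sP sP'.
  + by rewrite opprD; exact: rpsdD.
  + by rewrite linearD/= sZ sZ'.
  + exact: rpsdD.
  + by rewrite mulmxDr mulmxDl opprD addrACA [X in X + _ = _]addrACA.
- move=> c _ c0 [P [Z [sP pP sZ pZ ->]]]; exists (c *: P), (c *: Z); split.
  + by rewrite linearZ/= sP.
  + by rewrite -scalerN; exact: rpsdZ.
  + by rewrite linearZ/= sZ.
  + exact: rpsdZ.
  + by rewrite -scalemxAr -scalemxAl scalerBr scalerDr.
- exists 0, 0; split; rewrite ?trmx0 ?oppr0//.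
  by rewrite mulmx0 mul0mx !addr0.
- move=> _ [P [Z [sP pP sZ pZ ->]]].
  by rewrite linearB linearD/= !trmx_mul trmxK sP sZ [_ + P *m A]addrC.
- exact: trmx1.
- have [k [P [Z [sP pP sZ pZ ->]]] H] := approx 2^-1 ltac:(by rewrite invr_gt0).
  exists (2 *: P); split.
  + by rewrite linearZ/= sP.
  + move=> v; rewrite qfZ; have := pP v; rewrite -/(qf _ v) -scaleN1r qfZ; lra.
  + move=> v; have := H v; have := pZ v; rewrite -/(qf _ v) !qfB qfD qf1 => Zv.
    have -> : qf (A^T *m P) v = (v^T *m P *m (A *m v)) 0 0.
      rewrite -{2}sP -[in RHS](tr11 (v^T *m P^T *m (A *m v))) !trmx_mul !trmxK.
      by rewrite /qf !mulmxA.
    have -> : qf (P *m A) v = (v^T *m P *m (A *m v)) 0 0 by rewrite /qf !mulmxA.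
    rewrite -scalemxAr -scalemxAl [X in _ -> _ <= 2 * X]mxE => /ler_normlW; lra.
- exfalso.
  pose W' := - W.
  have sW' : W'^T = W' by rewrite /W' linearN/= sW.
  have pW' : rpsd W'.
    move=> v; rewrite -/(qf _ v) qf_trace.
    have := KW (- (v *m v^T)); rewrite mulmxN mxtraceN /W' mulNmx mxtraceN; apply.
    exists 0, (v *m v^T); split; rewrite ?trmx0 ?oppr0//.
    * exact: outer_sym.
    * exact: outer_rpsd.
    * by rewrite mulmx0 mul0mx addr0 sub0r.
  have := hurwitz_no_growth hA sW' pW' _ => /(_ _)/eqP.
  rewrite /W' oppr_eq0 => H; move: W1.
  suff /eqP -> : W == 0 by rewrite mul0mx mxtrace0 ltxx.
  apply: H => v; rewrite -/(qf _ v) qf_trace.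
  have := KW (A^T *m (- (v *m v^T)) + (- (v *m v^T)) *m A).
  set V := v *m v^T => KWV.
  have -> : \tr ((A *m - W + - W *m A^T) *m V) =
            \tr (W *m (A^T *m - V + - V *m A)).
    rewrite mulmxDl mulmxDr !mxtraceD !(mulmxN, mulNmx) !mxtraceN addrC.
    by congr (- _ - _); [rewrite mulmxA|rewrite -mulmxA mxtrace_mulC mulmxA].
  apply: KWV; exists (- V), 0; split; rewrite ?trmx0 ?opprK//.
  * by rewrite linearN/= outer_sym.
  * exact: outer_rpsd.
  * by rewrite subr0.
Qed.

(** Along [x' = A x] the form of [P] cannot decrease.  If it starts at a positive value
    then [|x|^2] stays bounded away from 0, and a form [- P1] as in [lyapunov] decreases
    at a constant rate although it is nonnegative. *)
Lemma lyapunov_sign n (A P : 'M[R]_n) : hurwitz A -> P^T = P ->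
  (forall v : 'cV[R]_n, 0 <= (v^T *m P *m (A *m v)) 0 0) -> forall v, qf P v <= 0.
Proof.
move=> hA sP PA v; rewrite leNgt; apply/negP => m0.
have [P1 [sP1 nP1 dP1]] := lyapunov hA.
have [K K0 PK] := qf_bound P.
pose x t := expmx (t *: A) *m v.
have px : mxprimitive x (fun t => A *m x t).
  have := mxprimitive_mulr v (mxprimitive_expmx A).
  by apply: eq_mxprimitive => t //; rewrite /x mulmxA.
have x0 : x 0 = v by rewrite /x expmx0 mul1mx.
set m := qf P v in m0.
have mP t : 0 <= t -> m <= qf P (x t).
  move=> t0; have := primitive_nonincreasing (primitiveZ (-1) (primitive_qf sP px)) _ (lexx 0) t0.
  rewrite x0 !mulN1r lerN2; apply.
  by apply: aeW => r _; rewrite mulN1r oppr_le0 mulr_ge0.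
have K1 : 0 < K + 1 by lra.
have mx t : 0 <= t -> m / (K + 1) <= nsq (x t).
  move=> t0; rewrite ler_pdivrMr//.
  have := mP t t0; have := PK (x t); have := nsq_ge0 (x t).
  have := ler_norm (qf P (x t)); nra.
have mK : 0 < m / (K + 1) by rewrite divr_gt0.
set d := m / (K + 1) in mx mK.
have pid : primitive (fun t : R => t) (fun=> 1).
  have did (t : R) : is_derive t 1 (fun t : R => t) (1 : R) by exact: is_derive_id.
  by apply: (primitive_derive did); exact: cst_continuous.
have pV := primitiveD (primitiveZ (-1) (primitive_qf sP1 px)) (primitiveZ d pid).
pose T := (- qf P1 v + 1) / d.
have T0 : 0 <= T by rewrite divr_ge0 ?(ltW mK)// addr_ge0// oppr_ge0 nP1.
have := primitive_nonincreasing pV _ (lexx 0) T0.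
rewrite x0 /T [d * (_ / d)]mulrC divfK ?gt_eqF// mulr0 addr0 !mulN1r -/T => H.
have : - qf P1 (x T) + (- qf P1 v + 1) <= - qf P1 v.
  apply: H; apply: aeW => t t0; rewrite mulN1r mulr1 addrC subr_le0.
  by apply: le_trans (mx t t0) (dP1 _).
have := nP1 (x T); lra.
Qed.

(** Separate [M] from the cone of matrices [Z - L P], where [Z] is positive semidefinite
    and [L P] is the matrix of the form [2 x^T P (A x + B u)].  A separating [W] is
    positive semidefinite and orthogonal to all [L P], which means that
    [A W11 + B W21] is skew, and [kyp_dual] excludes it.  The slack [e] is due to the
    cone not being closed. *)
Lemma kyp_approx n k (A : 'M[R]_n) (B : 'M[R]_(n, k)) (M : 'M[R]_(n + k)) : M^T = M ->
  (forall (f : 'cV[R[i]]_n) g (lam : R[i]), Num.conj lam = - lam ->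
     cmx A *m f + cmx B *m g = lam *: f ->
     0 <= ((col_mx f g) ^t* *m cmx M *m col_mx f g) 0 0) ->
  (forall g, 0 <= ((col_mx (0 : 'cV[R[i]]_n) g) ^t* *m cmx M *m col_mx 0 g) 0 0) ->
  forall e, 0 < e -> exists2 P : 'M[R]_n, P^T = P & forall x u,
    - e * (nsq x + nsq u) <=
    2 * (x^T *m P *m (A *m x + B *m u)) 0 0 + qf M (col_mx x u).
Proof.
move=> sM FM F0.
pose L (P : 'M[R]_n) := block_mx (A^T *m P + P *m A) (P *m B) (B^T *m P) (0 : 'M[R]_k).
have LD (P Q : 'M[R]_n) : L (P + Q) = L P + L Q.
  rewrite /L add_block_mx addr0 !mulmxDr !mulmxDl; congr block_mx.
  by rewrite addrACA.
have LZ c (P : 'M[R]_n) : L (c *: P) = c *: L P.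
  by rewrite /L scale_block_mx scaler0 -!scalemxAr -!scalemxAl scalerDr.
have Lqf (P : 'M[R]_n) x u : P^T = P ->
    qf (L P) (col_mx x u) = 2 * (x^T *m P *m (A *m x + B *m u)) 0 0.
  move=> sP; rewrite /qf tr_col_mx mul_row_block mul_row_col mulmx0 addr0.
  rewrite !mulmxDr !mulmxDl.
  have -> : x^T *m (A^T *m P) *m x = x^T *m P *m (A *m x).
    by rewrite -[LHS]tr11 !trmx_mul !trmxK sP !mulmxA.
  have -> : u^T *m (B^T *m P) *m x = x^T *m P *m (B *m u).
    by rewrite -[LHS]tr11 !trmx_mul !trmxK sP !mulmxA.
  have -> : x^T *m (P *m A) *m x = x^T *m P *m (A *m x) by rewrite !mulmxA.
  have -> : x^T *m (P *m B) *m u = x^T *m P *m (B *m u) by rewrite !mulmxA.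
  by rewrite -addrA addrACA -mulr2n -scaler_nat mxE.
have Lsym (P : 'M[R]_n) : P^T = P -> (L P)^T = L P.
  move=> sP; rewrite /L tr_block_mx trmx0 linearD/= !trmx_mul !trmxK sP.
  by rewrite [_ + A^T *m P]addrC.
pose K : set 'M[R]_(n + k) := [set m | exists Z P,
  [/\ Z^T = Z, rpsd Z, P^T = P & m = Z - L P]].
have rpsdD (X Y : 'M[R]_(n + k)) : rpsd X -> rpsd Y -> rpsd (X + Y).
  by move=> pX pY v; rewrite -/(qf _ v) qfD addr_ge0//; [exact: pX|exact: pY].
have rpsdZ (c : R) (X : 'M[R]_(n + k)) : 0 <= c -> rpsd X -> rpsd (c *: X).
  by move=> c0 pX v; rewrite -/(qf _ v) qfZ mulr_ge0//; exact: pX.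
have rpsd0 : rpsd (0 : 'M[R]_(n + k)) by move=> v; rewrite mulmx0 mul0mx mxE.
have L0 : L 0 = 0 by rewrite -(scale0r (0 : 'M[R]_n)) LZ scale0r.
have [|||||approx|[W [sW KW W1]]] := @sym_separation R _ K M.
- move=> _ _ [Z [P [sZ pZ sP ->]]] [Z' [P' [sZ' pZ' sP' ->]]].
  exists (Z + Z'), (P + P'); split.
  + by rewrite linearD/= sZ sZ'.
  + exact: rpsdD.
  + by rewrite linearD/= sP sP'.
  + by rewrite LD opprD addrACA.
- move=> c _ c0 [Z [P [sZ pZ sP ->]]]; exists (c *: Z), (c *: P); split.
  + by rewrite linearZ/= sZ.
  + exact: rpsdZ.
  + by rewrite linearZ/= sP.
  + by rewrite LZ scalerBr.
- by exists 0, 0; split; rewrite ?trmx0 ?L0 ?subr0.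
- by move=> _ [Z [P [sZ pZ sP ->]]]; rewrite linearB/= sZ Lsym.
- exact: sM.
- move=> e e0; have [m [Z [P [sZ pZ sP ->]]] H] := approx e e0.
  exists P => // x u; have := H (col_mx x u); have := pZ (col_mx x u).
  rewrite -/(qf _ _) opprB addrCA qfD qfB Lqf// nsq_col => Zv /ler_normlP[]; lra.
- exfalso.
  have pW : rpsd W.
    move=> v; rewrite -/(qf _ v) qf_trace; apply: KW.
    exists (v *m v^T), 0; split; rewrite ?trmx0 ?L0 ?subr0//.
      exact: outer_sym.
    exact: outer_rpsd.
  have WL P : P^T = P -> \tr (W *m L P) = 0.
    move=> sP; apply/eqP; rewrite eq_le; apply/andP; split.
      rewrite -oppr_ge0 -mxtraceN -mulmxN; apply: KW.
      by exists 0, P; split; rewrite ?trmx0 ?sub0r.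
    apply: KW; exists 0, (- P); split; rewrite ?trmx0 ?sub0r//.
      by rewrite linearN/= sP.
    by rewrite -[- P]scaleN1r LZ scaleN1r opprK.
  have [W11 [W12 [W21 [W22 WE]]]] : exists W11 W12 W21 W22,
      W = block_mx W11 W12 W21 W22 :> 'M[R]_(n + k).
    by exists (ulsubmx W), (ursubmx W), (dlsubmx W), (drsubmx W); rewrite submxK.
  have [s11 s21] : W11^T = W11 /\ W21^T = W12.
    by move: sW; rewrite WE tr_block_mx => /eq_block_mx[].
  pose Th := A *m W11 + B *m W21.
  have trL P : P^T = P -> \tr (W *m L P) = 2 * \tr (Th *m P).
    move=> sP; rewrite WE /L mulmx_block mxtrace_block !mulmx0 addr0 mulmxDr.
    rewrite !mxtraceD.
    have e1 : \tr (W11 *m (A^T *m P)) = \tr (A *m W11 *m P).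
      by rewrite -mxtrace_tr !trmx_mul trmxK s11 sP -mulmxA mxtrace_mulC.
    have e2 : \tr (W11 *m (P *m A)) = \tr (A *m W11 *m P).
      by rewrite mulmxA mxtrace_mulC !mulmxA.
    have e3 : \tr (W12 *m (B^T *m P)) = \tr (B *m W21 *m P).
      by rewrite -mxtrace_tr !trmx_mul trmxK -s21 trmxK sP -mulmxA mxtrace_mulC.
    have e4 : \tr (W21 *m (P *m B)) = \tr (B *m W21 *m P).
      by rewrite mulmxA mxtrace_mulC !mulmxA.
    rewrite e1 e2 e3 e4 /Th mulmxDl mxtraceD; ring.
  have Th0 : Th + Th^T = 0.
    have sT : (Th + Th^T)^T = Th + Th^T by rewrite linearD/= trmxK addrC.
    have := WL _ sT; rewrite trL// => /eqP; rewrite mulf_eq0 pnatr_eq0/= => /eqP tr0.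
    have tr0' : \tr ((Th + Th^T)^T *m (Th + Th^T)) = 0.
      rewrite sT mulmxDl mxtraceD tr0 add0r -mxtrace_tr trmx_mul trmxK sT.
      by rewrite mxtrace_mulC.
    apply/matrixP => i j; rewrite [RHS]mxE.
    move: tr0'; move: (Th + Th^T) => Y.
    rewrite /mxtrace => /eqP; rewrite psumr_eq0 => [/allP H|b _]; last first.
      by rewrite mxE sumr_ge0// => a _; rewrite mxE -expr2 sqr_ge0.
    have := H j (mem_index_enum _); rewrite mxE psumr_eq0 => [/allP H'|a _]; last first.
      by rewrite mxE -expr2 sqr_ge0.
    by have := H' i (mem_index_enum _); rewrite mxE -expr2 sqrf_eq0 => /eqP.
  have hW : cmx W ^t* = cmx W by rewrite adj_cmx sW.
  have pW' : psd (cmx W) by exact: psd_cmx.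
  have WE' : cmx W = block_mx (cmx W11) (cmx W12) (cmx W21) (cmx W22).
    by rewrite WE /cmx map_block_mx.
  rewrite WE' in hW pW'.
  have := kyp_dual (A := cmx A) (B := cmx B) (M := cmx M) hW pW'.
  rewrite -!cmxM -!cmxD adj_cmx -cmxD Th0 cmx0 => /(_ erefl FM F0).
  by rewrite -WE' -cmxM trace_cmx ler0c mxtrace_mulC leNgt W1.
Qed.

(** The Kalman-Yakubovich-Popov lemma.  The slack on the state in [kyp_approx] is moved
    to the input by adding a small multiple of a Lyapunov form, which dominates
    [|x|^2] and whose cross term with [B u] is absorbed by completing a square. *)
Lemma kyp n k (A : 'M[R]_n) (B : 'M[R]_(n, k)) (M : 'M[R]_(n + k)) : M^T = M ->
  hurwitz A ->
  (forall (f : 'cV[R[i]]_n) g (lam : R[i]), Num.conj lam = - lam ->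
     cmx A *m f + cmx B *m g = lam *: f ->
     0 <= ((col_mx f g) ^t* *m cmx M *m col_mx f g) 0 0) ->
  (forall g, 0 <= ((col_mx (0 : 'cV[R[i]]_n) g) ^t* *m cmx M *m col_mx 0 g) 0 0) ->
  forall e, 0 < e -> exists2 P : 'M[R]_n, P^T = P & forall x u,
    - e * nsq u <=
    2 * (x^T *m P *m (A *m x + B *m u)) 0 0 + qf M (col_mx x u).
Proof.
move=> sM hA FM F0 e e0.
have [P1 [sP1 _ dP1]] := lyapunov hA.
have [c c0 Bc] := qf_bound ((P1 *m B)^T *m (P1 *m B)).
pose d := e / (4 * c + 1).
have c1 : 0 < 4 * c + 1 by lra.
have d0 : 0 < d by rewrite divr_gt0.
have [P sP HP] := kyp_approx sM FM F0 d0.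
exists (P + (2 * d) *: P1); first by rewrite linearD linearZ/= sP sP1.
move=> x u; have := HP x u; have := dP1 x.
have de : d * (4 * c + 1) = e by rewrite /d divfK// gt_eqF.
have -> : (x^T *m (P + (2 * d) *: P1) *m (A *m x + B *m u)) 0 0 =
   (x^T *m P *m (A *m x + B *m u)) 0 0 + 2 * d * ((x^T *m P1 *m (A *m x)) 0 0 +
    (x^T *m P1 *m (B *m u)) 0 0).
  rewrite [x^T *m (P + _)]mulmxDr mulmxDl -scalemxAr -scalemxAl.
  rewrite [x^T *m P1 *m (_ + _)]mulmxDr [LHS]mxE; congr (_ + _).
  by rewrite [LHS]mxE; congr (_ * _); rewrite [LHS]mxE.
have cross : - nsq x / 4 - 4 * (c * nsq u) / 4 <= (x^T *m P1 *m (B *m u)) 0 0.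
  pose y := P1 *m B *m u.
  have -> : (x^T *m P1 *m (B *m u)) 0 0 = (x^T *m y) 0 0 by rewrite /y !mulmxA.
  have yc : nsq y <= c * nsq u.
    apply: le_trans (le_trans (ler_norm _) (Bc u)).
    by rewrite -[nsq y]qf1 /y -qf_congr mulmx1.
  have : 0 <= nsq (x + 2 *: y) by exact: nsq_ge0.
  have -> : nsq (x + 2 *: y) = nsq x + 4 * (x^T *m y) 0 0 + 4 * nsq y.
    rewrite !nsqE mxE !mulr_sumr -!big_split/=; apply: eq_bigr => i _.
    by rewrite !mxE; ring.
  lra.
have := nsq_ge0 x; have := nsq_ge0 u.
set p := (x^T *m P *m _) 0 0; set a := (x^T *m P1 *m (A *m x)) 0 0 in cross *.
set b := (x^T *m P1 *m (B *m u)) 0 0 in cross *.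
set q := qf M _.
move=> u0 x0 H1 H2.
have : d * nsq x <= d * (2 * a) by rewrite ler_wpM2l// ltW.
have : d * (- nsq x / 4 - 4 * (c * nsq u) / 4) <= d * b by rewrite ler_wpM2l// ltW.
have -> : - e * nsq u = - (d * nsq u) - 4 * (d * (c * nsq u)) by rewrite -de; ring.
have := mulr_ge0 (ltW d0) (mulr_ge0 c0 u0).
have := mulr_ge0 (ltW d0) x0.
have := mulr_ge0 (ltW d0) u0.
lra.
Qed.

End Lyapunov.

(** * Transfer matrices and resolvents *)

Section Realisation.
Variable R : realType.
Local Notation tofrac := (@fraction.FracField.tofrac {poly R}).
Local Notation toC := (real_complex R).

(** The representative chosen by [repr] is a fraction equal to [f]; it has to be
    compared in the quotient, since nothing else is known about it. *)
Lemma tofrac_repr (f : {fraction {poly R}}) :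
  let r := fraction.frac (generic_quotient.repr f) in
  r.2 != 0 /\ f * tofrac r.2 = tofrac r.1.
Proof.
move=> r; have d0 : r.2 != 0 := fraction.denom_ratioP (generic_quotient.repr f).
split=> //; rewrite -{1}[f]generic_quotient.reprK; unlock fraction.FracField.tofrac.
rewrite -[LHS]fraction.FracField.pi_mul.
apply/generic_quotient.eqmodP; rewrite /= fraction.FracField.equivfE.
rewrite /fraction.FracField.mulf !fraction.numden_Ratio ?oner_neq0 ?mulr1//.
by rewrite mulrC.
Qed.

Lemma tofracI (p q : {poly R}) : tofrac p = tofrac q -> p = q.
Proof. by move=> /eqP; rewrite fraction.tofrac_eq => /eqP. Qed.

Lemma rnum_rden (f : {fraction {poly R}}) :
  [/\ rden f != 0, coprimep (rnum f) (rden f) & f * tofrac (rden f) = tofrac (rnum f)].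
Proof.
have [d0 fE] := tofrac_repr f; set r := fraction.frac _ in d0 fE.
have g0 : gcdp r.1 r.2 != 0 by rewrite gcdp_eq0 negb_and d0 orbT.
have e1 : r.1 = rnum f * gcdp r.1 r.2 by rewrite /rnum -/r divpK// dvdp_gcdl.
have e2 : r.2 = rden f * gcdp r.1 r.2 by rewrite /rden -/r divpK// dvdp_gcdr.
split.
- by apply: contra d0 => /eqP r0; rewrite e2 r0 mul0r.
- by apply: coprimep_div_gcd; rewrite d0 orbT.
- apply: (@mulIf _ (tofrac (gcdp r.1 r.2))); first by rewrite fraction.tofrac_eq0.
  by rewrite -mulrA -!rmorphM/= -e1 -e2.
Qed.

Definition adj_char n (A : 'M[R]_n) : 'M[{poly R}]_n := \adj (char_poly_mx A).

(** [C (sI - A)^-1 B] multiplied by the characteristic polynomial of [A]. *)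
Definition resolvent_num k l n (C : 'M[R]_(l, n)) (A : 'M[R]_n) (B : 'M[R]_(n, k)) :
    'M[{poly R}]_(l, k) :=
  map_mx polyC C *m adj_char A *m map_mx polyC B.

(** The equality of the two fractional expressions of an entry of the transfer matrix,
    cleared of denominators.  Every property of the transfer matrix used below follows
    from this polynomial identity. *)
Lemma transfer_resolvent k l n A B C D (G := transfer (@Lti R k l n A B C D)) i j :
  rnum (G i j) * char_poly A =
  rden (G i j) * (resolvent_num C A B i j + (D i j)%:P * char_poly A).
Proof.
have [d0 _ GE] := rnum_rden (G i j).
have chi0 : tofrac (char_poly A) != 0.
  by rewrite fraction.tofrac_eq0 monic_neq0// char_poly_monic.
have Gchi : G i j * tofrac (char_poly A) =
    tofrac (resolvent_num C A B i j + (D i j)%:P * char_poly A).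
  rewrite /G /transfer/= mxE mulrDl [RHS]rmorphD/=; congr (_ + _);
    last by rewrite mxE rmorphM.
  have -> : invmx (map_mx tofrac (char_poly_mx A)) =
     (tofrac (char_poly A))^-1 *: map_mx tofrac (adj_char A).
    rewrite /invmx unitmxE unitfE det_map_mx chi0; congr (_ *: _).
    by rewrite /adj_char map_mx_adj.
  rewrite -scalemxAr -scalemxAl mxE mulrAC mulVf// mul1r.
  rewrite /resolvent_num -[tofrac (_ i j)]/(tofrac _).
  have cst m p (E : 'M[R]_(m, p)) : map_mx (fun a : R => tofrac a%:P) E =
      map_mx tofrac (map_mx polyC E) by rewrite -map_mx_comp.
  by rewrite !cst -!map_mxM mxE.
apply: tofracI; rewrite !rmorphM/= -GE -Gchi; ring.
Qed.

Lemma size_sign m : size ((-1) ^+ m : {poly R}) = 1%N.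
Proof. by rewrite -signr_odd; case: (odd m); rewrite ?expr1 ?size_polyN size_poly1. Qed.

Lemma size_adj_char n (A : 'M[R]_n.+1) i j : (size (adj_char A i j) <= n.+1)%N.
Proof.
rewrite /adj_char mxE /cofactor.
apply: leq_trans (size_polyMleq _ _) _.
have -> : size ((-1) ^+ (j + i) : {poly R}) = 1%N by rewrite size_sign.
rewrite add1n/= /determinant; apply: leq_trans (size_sum _ _ _) _.
apply/bigmax_leqP => s _; apply: leq_trans (size_polyMleq _ _) _.
rewrite size_sign add1n/=; apply: leq_trans (size_poly_prod_leq _ _) _.
rewrite card_ord leq_subLR.
apply: (@leq_ltn_trans (\sum_(i0 < n) 2)%N).
  apply: leq_sum => c _; rewrite !mxE.
  apply: leq_trans (size_polyD _ _) _; rewrite geq_max size_polyN size_polyC.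
  apply/andP; split; last by case: (_ != 0).
  by case: (_ == _); rewrite ?mulr1n ?mulr0n ?size_polyX ?size_poly0.
by rewrite sum_nat_const card_ord muln2 -addnn addnS ltnS.
Qed.

(** Modulo the characteristic polynomial, multiplying the adjugate of [sI - A] by [A]
    amounts to multiplying it by [s]. *)
Lemma adj_horner n (A : 'M[R]_n.+1) (p : {poly R}) : exists T : 'M[{poly R}]_n.+1,
  adj_char A *m map_mx polyC (horner_mx A p) = p *: adj_char A + char_poly A *: T.
Proof.
have adjA : adj_char A *m map_mx polyC A = 'X *: adj_char A - (char_poly A)%:M.
  rewrite -[(char_poly A)%:M](mul_adj_mx (char_poly_mx A)) /char_poly_mx.
  by rewrite mulmxBr mul_mx_scalar opprB addrC subrK.
elim/poly_ind: p => [|p c [T TE]].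
  by exists 0; rewrite rmorph0 map_mx0 mulmx0 scale0r scaler0 addr0.
exists ('X *: T - map_mx polyC (horner_mx A p)).
have -> : horner_mx A (p * 'X + c%:P) = A *m horner_mx A p + c%:M.
  rewrite rmorphD rmorphM/= horner_mx_X horner_mx_C; congr (_ + _).
  by rewrite -[LHS]/(horner_mx A p *m A); apply: comm_horner_mx.
rewrite map_mxD map_mxM map_scalar_mx/= mulmxDr mulmxA adjA mulmxBl -scalemxAl TE.
rewrite mul_scalar_mx mul_mx_scalar scalerDr scalerBr !scalerA scalerDl.
rewrite -[_ * 'X]mulrC [char_poly A * 'X]mulrC.
by rewrite addrAC -!addrA; congr (_ + _); rewrite addrCA.
Qed.

Lemma size_resolvent_num k l n (C : 'M[R]_(l, n.+1)) A (B : 'M[R]_(n.+1, k)) i j :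
  (size (resolvent_num C A B i j) <= n.+1)%N.
Proof.
rewrite /resolvent_num mxE; apply: leq_trans (size_sum _ _ _) _.
apply/bigmax_leqP => b _; rewrite [map_mx _ _ b j]mxE mulrC mul_polyC.
apply: leq_trans (size_scale_leq _ _) _.
rewrite mxE; apply: leq_trans (size_sum _ _ _) _.
apply/bigmax_leqP => a _; rewrite [map_mx _ _ i a]mxE mul_polyC.
by apply: leq_trans (size_scale_leq _ _) _; exact: size_adj_char.
Qed.

(** By [adj_horner] the polynomial on the left is divisible by the characteristic
    polynomial, whose degree exceeds its own. *)
Lemma resolvent_num_horner k l n (C : 'M[R]_(l, n.+1)) A (B : 'M[R]_(n.+1, k)) p i j :
  char_poly A %| p * resolvent_num C A B i j ->
  resolvent_num C A (horner_mx A p *m B) i j = 0.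
Proof.
move=> div; apply/eqP; apply: contraT => nz.
have : char_poly A %| resolvent_num C A (horner_mx A p *m B) i j.
  have [T TE] := adj_horner A p.
  have -> : resolvent_num C A (horner_mx A p *m B) =
     p *: resolvent_num C A B + char_poly A *: (map_mx polyC C *m T *m map_mx polyC B).
    rewrite /resolvent_num map_mxM mulmxA -[_ *m _ *m map_mx _ (horner_mx _ _)]mulmxA TE.
    by rewrite mulmxDr mulmxDl -!scalemxAr -!scalemxAl.
  by rewrite mxE dvdp_add// mxE// dvdp_mulr.
move=> /(dvdp_leq nz); rewrite size_char_poly leqNgt ltnS.
by rewrite size_resolvent_num.
Qed.

(** [C adj(sI - A) (sI - A) B] is [C B] times the characteristic polynomial. *)
Lemma resolvent_num_shift k l n (C : 'M[R]_(l, n.+1)) A (B : 'M[R]_(n.+1, k)) :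
  resolvent_num C A B = 0 -> resolvent_num C A (A *m B) = 0 -> C *m B = 0.
Proof.
move=> h1 h2.
have : map_mx polyC C *m (adj_char A *m char_poly_mx A) *m map_mx polyC B = 0.
  rewrite /char_poly_mx mulmxBr mul_mx_scalar mulmxBr mulmxBl -scalemxAr -scalemxAl.
  rewrite -/(resolvent_num C A B) h1 scaler0 sub0r.
  by move: h2; rewrite /resolvent_num map_mxM !mulmxA => ->; rewrite oppr0.
rewrite mul_adj_mx mul_mx_scalar -scalemxAl -map_mxM => CB.
apply/matrixP => i j; have /matrixP/(_ i j) := CB.
rewrite [X in X = _ -> _]mxE [X in _ * X = _]mxE ![(0 : 'M[_]_(_, _)) i j]mxE => /eqP.
rewrite mulf_eq0 (negbTE (monic_neq0 (char_poly_monic A)))/= polyC_eq0.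
by move=> /eqP.
Qed.

(** Divide [c] by its common factors with [q] until none is left. *)
Lemma coprime_cofactor (q c : {poly R}) : c != 0 ->
  exists m p, coprimep q p /\ c %| q ^+ m * p.
Proof.
have [N] := ubnP (size c); elim: N c => // N IH c szc c0.
have [cop|ncop] := boolP (coprimep q c).
  by exists 0%N, c; rewrite expr0 mul1r dvdpp.
set g := gcdp q c.
have g0 : g != 0 by rewrite gcdp_eq0 negb_and c0 orbT.
have cE : c = c %/ g * g by rewrite divpK// dvdp_gcdr.
have cg0 : c %/ g != 0 by apply: contra c0 => /eqP h; rewrite cE h mul0r.
have sg : (1 < size g)%N.
  by rewrite ltn_neqAle eq_sym ncop/= lt0n size_poly_eq0.
have [|m [p [cop dv]]] := IH (c %/ g) _ cg0.
  move: szc; rewrite {1}cE size_mul// ltnS => szc.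
  apply: leq_trans szc; move: sg; rewrite -(size_poly_gt0 g) in g0 *.
  by case: (size g) => [|[|sz]]// _; rewrite !addnS/= ltnS leq_addr.
exists m.+1, p; split=> //.
have -> : q ^+ m.+1 * p = q ^+ m * p * q by rewrite exprSr mulrAC.
by rewrite {1}cE dvdp_mul// dvdp_gcdl.
Qed.

End Realisation.

(** * Stable realisations *)

Section StableRealisation.
Variable R : realType.
Local Notation toC := (real_complex R).

Lemma transfer_den k l n A B C D (G := transfer (@Lti R k l n A B C D)) :
  let q := \prod_ij rden (G ij.1 ij.2) in
  q != 0 /\ forall i j, char_poly A %| q * resolvent_num C A B i j.
Proof.
move=> q; split.
  by apply/prodf_neq0 => -[i j] _ /=; have [] := rnum_rden (G i j).
move=> i j; rewrite /q (bigD1 (i, j))//= mulrAC dvdp_mulr//.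
have := transfer_resolvent A B C D i j; rewrite -/G => E.
have -> : rden (G i j) * resolvent_num C A B i j =
    (rnum (G i j) - rden (G i j) * (D i j)%:P) * char_poly A.
  by rewrite mulrBl E mulrDr mulrA addrK.
exact: dvdp_mulIr.
Qed.

(** Modes outside the roots of a common denominator of the transfer matrix are not seen
    from input to output: with [p] such a denominator, [C p(A) B = 0]. *)
Lemma output_horner0 k l n (C : 'M[R]_(l, n.+1)) A (B : 'M[R]_(n.+1, k)) p :
  (forall i j, char_poly A %| p * resolvent_num C A B i j) ->
  C *m horner_mx A p *m B = 0.
Proof.
move=> div; rewrite -mulmxA; apply: (@resolvent_num_shift _ _ _ _ _ A).
  by apply/matrixP => i j; rewrite resolvent_num_horner// mxE.
have -> : A *m (horner_mx A p *m B) = horner_mx A ('X * p) *m B.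
  by rewrite rmorphM/= horner_mx_X mulmxA.
apply/matrixP => i j; rewrite [RHS]mxE; apply: resolvent_num_horner.
by rewrite -mulrA dvdp_mull.
Qed.

Lemma scale_polymx_inj m n p : p != 0 -> injective (fun M : 'M[{poly R}]_(m, n) => p *: M).
Proof.
move=> p0 M N /matrixP MN; apply/matrixP => i j; apply: (mulfI p0).
by have := MN i j; rewrite !mxE.
Qed.

Lemma adj_char_comm n (A E : 'M[R]_n.+1) : E *m A = A *m E ->
  adj_char A *m map_mx polyC E = map_mx polyC E *m adj_char A.
Proof.
move=> com; have chi0 := monic_neq0 (char_poly_monic A).
have comS : map_mx polyC E *m char_poly_mx A = char_poly_mx A *m map_mx polyC E.
  rewrite /char_poly_mx mulmxBr mulmxBl -!map_mxM com mul_scalar_mx mul_mx_scalar//.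
apply: (scale_polymx_inj chi0) => /=.
have cA : adj_char A *m char_poly_mx A = (char_poly A)%:M by exact: mul_adj_mx.
have cA' : char_poly_mx A *m adj_char A = (char_poly A)%:M by exact: mul_mx_adj.
rewrite -[LHS]mul_mx_scalar -{1}cA' -[RHS]mul_scalar_mx -cA.
by rewrite !mulmxA; congr (_ *m _); rewrite -!mulmxA comS.
Qed.

(** Changing the dynamics from [A] to [A'] on the range of [E], which contributes
    nothing to the output, leaves the transfer function unchanged; the equality of
    fractions is stated after cross-multiplication. *)
Lemma resolvent_num_cross k l n (C : 'M[R]_(l, n.+1)) A A' (B : 'M[R]_(n.+1, k)) (E F : 'M[R]_n.+1) :
  E + F = 1%:M -> F *m A = A *m F -> F *m A' = A' *m F -> A' *m F = A *m F ->
  resolvent_num C A (E *m B) = 0 ->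
  char_poly A' *: resolvent_num C A B = char_poly A *: resolvent_num C A' (F *m B).
Proof.
move=> EF FA FA' AF NE.
have SF : char_poly_mx A *m map_mx polyC F = map_mx polyC F *m char_poly_mx A'.
  by rewrite /char_poly_mx mulmxBl mulmxBr -!map_mxM FA' AF mul_scalar_mx mul_mx_scalar.
have -> : resolvent_num C A B = resolvent_num C A (F *m B).
  rewrite -{1}[B]mul1mx -EF mulmxDl /resolvent_num map_mxD mulmxDr.
  by rewrite -/(resolvent_num C A (E *m B)) NE add0r.
have key : char_poly A' *: (adj_char A *m map_mx polyC F) =
    char_poly A *: (adj_char A' *m map_mx polyC F).
  have cA : adj_char A *m char_poly_mx A = (char_poly A)%:M by exact: mul_adj_mx.
  have cA' : char_poly_mx A' *m adj_char A' = (char_poly A')%:M by exact: mul_mx_adj.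
  rewrite [in RHS]adj_char_comm// -[LHS]mul_mx_scalar -cA' -[RHS]mul_scalar_mx -cA.
  by rewrite !mulmxA; congr (_ *m _); rewrite -!mulmxA SF.
have assoc (c : {poly R}) l' k' (C' : 'M[{poly R}]_(l', n.+1)) (B' : 'M[{poly R}]_(n.+1, k')) (X Fp : 'M[{poly R}]_n.+1) :
    c *: (C' *m X *m (Fp *m B')) = C' *m (c *: (X *m Fp)) *m B'.
  by rewrite -scalemxAr -scalemxAl !mulmxA.
rewrite /resolvent_num map_mxM; move: (map_mx polyC C) (map_mx polyC B) => C' B'.
by rewrite !assoc key.
Qed.

Lemma horner_mx_eigen (K : fieldType) n (A : 'M[K]_n.+1) (v : 'rV_n.+1) s p :
  v *m A = s *: v -> v *m horner_mx A p = p.[s] *: v.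
Proof.
move=> vA; elim/poly_ind: p => [|p c IH].
  by rewrite rmorph0 mulmx0 horner0 scale0r.
rewrite rmorphD rmorphM/= horner_mx_X horner_mx_C mulmxDr.
rewrite -[horner_mx A p * A]/(horner_mx A p *m A) mulmxA IH -scalemxAl vA scalerA.
by rewrite mul_mx_scalar -scalerDl !hornerE.
Qed.

Lemma horner_dvd0 n (A : 'M[R]_n.+1) p : char_poly A %| p -> horner_mx A p = 0.
Proof.
by move=> /dvdpP[r ->]; rewrite rmorphM/= Cayley_Hamilton mulr0.
Qed.

Lemma coef_top (p q : {poly R}) a b : (size p <= a.+1)%N -> (size q <= b.+1)%N ->
  (p * q)`_(a + b) = p`_a * q`_b.
Proof.
move=> sp sq; have ab : (a < (a + b).+1)%N by rewrite ltnS leq_addr.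
rewrite coefM (bigD1 (Ordinal ab))//= addKn big1 ?addr0// => -[i ilt] /=.
rewrite -val_eqE/= => ia.
have [ai|ai] := ltnP a i.
  by rewrite (nth_default 0 (leq_trans sp ai)) mul0r.
rewrite [q`_ _](nth_default 0) ?mulr0//; apply: leq_trans sq _.
have : (i < a)%N by rewrite ltn_neqAle ia.
lia.
Qed.

Lemma size_resolvent_numW k l n (C : 'M[R]_(l, n)) A (B : 'M[R]_(n, k)) i j :
  (size (resolvent_num C A B i j) <= n)%N.
Proof.
case: n => [|n] in C A B *; last exact: size_resolvent_num.
by rewrite /resolvent_num mxE big_ord0 size_poly0.
Qed.

(** On the imaginary axis both [rden] and the characteristic polynomial are nonzero, so
    that the polynomial identity can be evaluated and divided.  At infinity the
    coefficients of highest degree are compared. *)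
Lemma realisation_values k l n (A : 'M[R]_n) (B : 'M[R]_(n, k)) (C : 'M[R]_(l, n))
   (D : 'M[R]_(l, k)) (G : 'M[{fraction {poly R}}]_(l, k)) : hurwitz A -> RHinfty G ->
  (forall i j, rnum (G i j) * char_poly A =
     rden (G i j) * (resolvent_num C A B i j + (D i j)%:P * char_poly A)) ->
  (forall om f g, cmx A *m f + cmx B *m g = (0 +i* om)%C *: f ->
     cmx C *m f + cmx D *m g = map_mx (ratval ^~ (0 +i* om)%C) G *m (g : 'cV[R[i]]_k)) /\
  map_mx ratval_infty G = cmx D.
Proof.
move=> hA hG E; split; last first.
  apply/matrixP => i j; rewrite !mxE /ratval_infty.
  have [r0 _ _] := rnum_rden (G i j); have [_ /negP] := hG i j.
  rewrite /is_pole_infty -leqNgt => pr; congr (_%:C)%C.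
  have sr : (0 < size (rden (G i j)))%N by rewrite size_poly_gt0.
  set d := (size (rden (G i j))).-1; have dE : size (rden (G i j)) = d.+1 by rewrite /d prednK.
  have sc : (size (char_poly A) <= n.+1)%N by rewrite size_char_poly.
  have lc : (char_poly A)`_n = 1.
    by have := char_poly_monic A; rewrite monicE lead_coefE size_char_poly => /eqP.
  have sD : (size ((D i j)%:P * char_poly A)%R <= n.+1)%N.
    by rewrite mul_polyC (leq_trans (size_scale_leq _ _)).
  have sN := leqW (size_resolvent_numW C A B i j).
  have := congr1 (fun p : {poly R} => p`_(d + n)) (E i j).
  rewrite coef_top// ?lc ?mulr1 -?dE// => ->.
  rewrite coef_top// ?dE// ?(leq_trans (size_polyD _ _)) ?geq_max ?sN//.
  rewrite coefD (nth_default 0 (size_resolvent_numW _ _ _ _ _)) add0r coefCM lc mulr1.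
  rewrite lead_coefE -/d mulrAC divff ?mul1r//.
  by rewrite /d -lead_coefE lead_coef_eq0.
move=> om f g eq; set s := (0 +i* om)%C in eq *.
pose ev : {rmorphism {poly R} -> R[i]} := horner_eval s \o map_poly toC.
have evE p : ev p = (map_poly toC p).[s] by [].
have evC c : ev c%:P = toC c by rewrite evE map_polyC hornerC.
have evX : ev 'X = s by rewrite evE map_polyX hornerX.
clearbody ev.
have evmx a b (X : 'M[R]_(a, b)) : map_mx ev (map_mx polyC X) = cmx X.
  by apply/matrixP => i j; rewrite !mxE evC.
have evS : map_mx ev (char_poly_mx A) = s%:M - cmx A.
  by rewrite /char_poly_mx map_mxB evmx map_scalar_mx/= evX.
have chi0 : ev (char_poly A) != 0.
  rewrite evE map_char_poly -/(cmx A) -rootE -eigenvalue_root_char.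
  by apply/negP => /hA; rewrite ltxx.
have den0 i j : ev (rden (G i j)) != 0.
  have [/(_ s) + _] := hG i j; rewrite /is_pole lexx => /(_ isT)/negP.
  by rewrite rootE evE.
have Sf : map_mx ev (char_poly_mx A) *m f = cmx B *m g.
  by rewrite evS mulmxBl mul_scalar_mx -eq addrC addKr.
have chif : ev (char_poly A) *: f = map_mx ev (adj_char A) *m cmx B *m g.
  rewrite -mulmxA -Sf mulmxA /adj_char -map_mxM mul_adj_mx map_scalar_mx.
  by rewrite mul_scalar_mx.
have chiCf : ev (char_poly A) *: (cmx C *m f) = map_mx ev (resolvent_num C A B) *m g.
  by rewrite scalemxAr chif /resolvent_num !map_mxM !evmx !mulmxA.
have Gs : ev (char_poly A) *: map_mx (ratval ^~ s) G =
    map_mx ev (resolvent_num C A B) + ev (char_poly A) *: cmx D.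
  apply/matrixP => i j; rewrite [LHS]mxE [map_mx _ G i j]mxE /ratval -!evE.
  rewrite [RHS]mxE [X in _ = X + _]mxE [X in _ = _ + X]mxE [X in _ = _ + _ * X]mxE.
  apply: (mulfI (den0 i j)); have := congr1 ev (E i j).
  rewrite !rmorphM rmorphD rmorphM/= evC [_ * toC _]mulrC => <-.
  by rewrite mulrCA [ev (rden _) * _]mulrC divfK// mulrC.
apply: (scalerI chi0); by rewrite scalerDr chiCf !scalemxAl Gs mulmxDl.
Qed.

(** [F] is the projector on the generalised eigenspaces for the roots of [q], and [E] the
    complementary one.  If the characteristic polynomial divides [q^m p] with [p] coprime
    to [q], a Bezout identity [u q^(m+1) + v p = 1] evaluated at [A] gives both; the
    exponent [m + 1] leaves a factor [q] in [E] even when [m = 0]. *)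
Lemma spectral_splitting n (A : 'M[R]_n.+1) (q : {poly R}) : q != 0 -> exists (E F : 'M[R]_n.+1) r N,
  [/\ E + F = 1%:M, E *m F = 0, E = horner_mx A (r * q) & F *m horner_mx A (q ^+ N) = 0].
Proof.
move=> q0; have chi0 := monic_neq0 (char_poly_monic A).
have [m [p [cop dv]]] := coprime_cofactor q chi0.
have /Bezout_eq1_coprimepP[[u v]/= uv] : coprimep (q ^+ m.+1) p by rewrite coprimep_pexpl.
have eE : u * q ^+ m.+1 = u * q ^+ m * q by rewrite exprSr mulrA.
exists (horner_mx A (u * q ^+ m.+1)), (horner_mx A (v * p)), (u * q ^+ m), m; split.
- by rewrite -rmorphD/= uv rmorph1.
- rewrite -[LHS]/(_ * _) -rmorphM/=; apply: horner_dvd0.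
  have -> : u * q ^+ m.+1 * (v * p) = u * q * v * (q ^+ m * p).
    by rewrite exprSr; ring.
  exact: dvdp_mull.
- by rewrite eE.
- rewrite -[LHS]/(_ * _) -rmorphM/=; apply: horner_dvd0.
  have -> : v * p * q ^+ m = v * (q ^+ m * p) by ring.
  exact: dvdp_mull.
Qed.

(** With [q] a common denominator of the transfer matrix, whose roots are stable, split
    the state space as in [spectral_splitting].  The modes in the range of [E] do not
    show in the transfer matrix; they are decoupled from the input, [B' = F B], and
    given the eigenvalue -1, [A' = A F - E]. *)
Theorem stable_realisation k l (Delta : lti R k l) : RHinfty (transfer Delta) ->
  exists (A' : 'M[R]_(lti_dim Delta)) B', [/\ hurwitz A',
    forall j, lti_C Delta *m (lti_A Delta) ^+ j *m lti_B Delta = 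
       lti_C Delta *m A' ^+ j *m B',
    forall om f g, cmx A' *m f + cmx B' *m g = (0 +i* om)%C *: f ->
     cmx (lti_C Delta) *m f + cmx (lti_D Delta) *m g =
       map_mx (ratval ^~ (0 +i* om)%C) (transfer Delta) *m (g : 'cV[R[i]]_k)
  & map_mx ratval_infty (transfer Delta) = cmx (lti_D Delta)].
Proof.
move=> hG; case: Delta hG => n A B C D /= hG.
set G := transfer _ in hG *.
have E0 i j := transfer_resolvent A B C D i j.
case: n => [|n] in A B C @G hG E0 *.
  have hA : hurwitz A.
    by move=> s /eigenvalueP[v _]; rewrite thinmx0 eqxx.
  by have [] := realisation_values hA hG E0; exists A, B; split.
have [q0 qdiv] := transfer_den A B C D; set q := \prod_ij _ in q0 qdiv.
have chi0 := monic_neq0 (char_poly_monic A).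
(* idempotence and F E = 0 follow from E + F = 1 and E F = 0 *)
have [E [F [r [N [EF EF0 Er Fq]]]]] := spectral_splitting A q0.
have comE : E *m A = A *m E by rewrite Er; exact: comm_horner_mx.
have FE : F = 1%:M - E by rewrite -EF addrC addKr.
have comF : F *m A = A *m F by rewrite FE mulmxBl mulmxBr comE mul1mx mulmx1.
have FE0 : F *m E = 0 by rewrite -EF0 FE mulmxBl mulmxBr mul1mx mulmx1.
have FF : F *m F = F by rewrite {1}FE mulmxBl EF0 subr0 mul1mx.
have EE : E *m E = E by rewrite -[RHS]mulmx1 -EF mulmxDr EF0 addr0.
pose A' := A *m F - E; pose B' := F *m B.
have A'F : A' *m F = A *m F by rewrite /A' mulmxBl EF0 subr0 -mulmxA FF.
have A'E : A' *m E = - E by rewrite /A' mulmxBl EE -mulmxA FE0 mulmx0 sub0r.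
have FA' : F *m A' = A' *m F.
  by rewrite A'F /A' mulmxBr FE0 subr0 mulmxA comF -mulmxA FF.
have EA' : E *m A' = A' *m E.
  by rewrite A'E /A' mulmxBr EE mulmxA comE -mulmxA EF0 mulmx0 sub0r.
have rqdiv r' i j : char_poly A %| r' * q * resolvent_num C A B i j.
  by rewrite -mulrA dvdp_mull.
have NE : resolvent_num C A (E *m B) = 0.
  apply/matrixP => i j; rewrite [RHS]mxE Er; apply: resolvent_num_horner.
  exact: rqdiv.
have CE j : C *m A ^+ j *m E *m B = 0.
  rewrite Er (_ : C *m A ^+ j *m _ = C *m horner_mx A ('X^j * r * q)).
    by apply: output_horner0 => i j'; exact: rqdiv.
  by rewrite -[in RHS]mulrA [in RHS]rmorphM/= rmorphXn/= horner_mx_X -mulmxA.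
have A'j j : A' ^+ j *m F = A ^+ j *m F.
  elim: j => [|j IH]; first by rewrite !expr0.
  rewrite !exprSr -[A' ^+ j * A']/(A' ^+ j *m A') -[A ^+ j * A]/(A ^+ j *m A).
  by rewrite -mulmxA -FA' mulmxA IH -!mulmxA FA' A'F.
have hA' : hurwitz A'.
  move=> s /eigenvalueP[w wA w0].
  have [wE|wE] := eqVneq (w *m cmx E) 0; last first.
    have : w *m cmx E *m cmx A' = s *: (w *m cmx E).
      by rewrite -mulmxA -cmxM EA' cmxM mulmxA wA scalemxAl.
    rewrite -mulmxA -cmxM EA' A'E.
    have -> : w *m cmx (- E) = - 1 *: (w *m cmx E).
      by rewrite /cmx map_mxN mulmxN scaleN1r.
    move=> /eqP; rewrite -subr_eq0 -scalerBl scaler_eq0 (negbTE wE) orbF subr_eq0.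
    by move=> /eqP <-; rewrite /= oppr_lt0 ltr01.
  have wF : w *m cmx F = w.
    rewrite -[RHS]mulmx1 -[1%:M](_ : cmx 1%:M = _); last by rewrite /cmx map_mx1.
    by rewrite -EF cmxD mulmxDr wE add0r.
  have wAs : w *m cmx A = s *: w.
    by rewrite -wA -[in RHS]wF -[in LHS]wF -!mulmxA -!cmxM comF FA' A'F.
  have := horner_mx_eigen (map_poly toC (q ^+ N)) wAs.
  rewrite -map_horner_mx -{1}wF -mulmxA -[map_mx _ _]/(cmx _) -cmxM Fq cmx0 mulmx0.
  move=> /esym/eqP; rewrite scaler_eq0 (negbTE w0) orbF rmorphXn horner_exp.
  rewrite expf_eq0/= => /andP[_].
  rewrite /q rmorph_prod horner_prod => /prodf_eq0[[i j] _ /= rs].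
  rewrite ltNge; apply/negP => /(proj1 (hG i j)); apply.
  by rewrite /is_pole rootE.
have cross := resolvent_num_cross EF comF FA' A'F NE.
have E1 i j : rnum (G i j) * char_poly A' =
     rden (G i j) * (resolvent_num C A' B' i j + (D i j)%:P * char_poly A').
  apply: (mulIf chi0).
  have /matrixP/(_ i j) := cross; rewrite [LHS]mxE [RHS]mxE => cr.
  rewrite mulrAC E0 -/G -!mulrA; congr (_ * _).
  by rewrite !mulrDl [_ * char_poly A']mulrC cr -/B'; ring.
have [v1 v2] := realisation_values hA' hG E1.
exists A', B'; split=> // j.
rewrite /B' mulmxA -[C *m A' ^+ j *m F]mulmxA A'j mulmxA.
by rewrite -[B in LHS]mul1mx -EF mulmxDl mulmxDr mulmxA CE add0r mulmxA.
Qed.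
End StableRealisation.

(** * Coercive forms and Kronecker products *)

Section Coercivity.
Variable R : realType.

Lemma qf_scale n (A : 'M[R]_n) c (v : 'cV[R]_n) : qf A (c *: v) = c ^+ 2 * qf A v.
Proof.
have cT : (c *: v)^T = c *: v^T by rewrite linearZ.
by rewrite /qf cT -2!scalemxAl -scalemxAr scalerA mxE expr2.
Qed.

Lemma nsq_scale n c (v : 'cV[R]_n) : nsq (c *: v) = c ^+ 2 * nsq v.
Proof. by rewrite -!qf1 qf_scale. Qed.

Lemma continuous_qf n (A : 'M[R]_n) : continuous (fun x : 'rV[R]_n => qf A x^T).
Proof.
have -> : (fun x : 'rV[R]_n => qf A x^T) =
    (fun x : 'rV[R]_n => \sum_i \sum_j x^T i 0 * A i j * x^T j 0).
  by apply/funext => x; rewrite qfE.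
move=> x.
apply: (@cvg_sumr R _ (nbhs x) (nbhs_filter x)) => i.
apply: (@cvg_sumr R _ (nbhs x) (nbhs_filter x)) => j.
have ci k : ((y : 'rV[R]_n)^T k 0) @[y --> x] --> x^T k 0.
  by rewrite mxE; under eq_fun do rewrite mxE; exact: coord_continuous.
by apply: cvgM => //; apply: cvgM => //; exact: cvg_cst.
Qed.

Lemma compact_sphere n : compact [set x : 'rV[R]_n | nsq x^T = 1].
Proof.
apply: bounded_closed_compact; last first.
  apply: (@preimage_closed _ _ (fun x : 'rV[R]_n => nsq x^T) [set y | y = 1]).
    move=> x _; have -> : (fun x : 'rV[R]_n => nsq x^T) = (fun x => qf 1%:M x^T).
      by apply/funext => y; rewrite qf1.
    exact: continuous_qf.
  exact: closed_eq.
exists 1; split; first exact: num_real.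
move=> y y1 v /= v1; apply: le_trans (ltW y1).
rewrite [leLHS]/Num.Def.normr/= mx_normrE (bigmax_le _ ler01)//=.
move=> [i0 i] _ /=; rewrite (ord1 i0).
rewrite -(@ler_pXn2r _ 2)// ?nnegrE// expr1n real_normK ?num_real// -v1.
by have := le_nsq v^T i; rewrite mxE.
Qed.

(** The minimum over the unit sphere is positive. *)
Lemma qf_coercive n (A : 'M[R]_n) : (forall v, v != 0 -> 0 < qf A v) ->
  exists2 e, 0 < e & forall v, e * nsq v <= qf A v.
Proof.
move=> A0.
have red e : (forall x : 'rV[R]_n, nsq x^T = 1 -> e <= qf A x^T) ->
    forall v, e * nsq v <= qf A v.
  move=> H v; have [->|v0] := eqVneq v 0.
    by rewrite /nsq /qf trmx0 !mul0mx mxE mulr0.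
  have nv : 0 < nsq v.
    by rewrite lt_def nsq_ge0 andbT; apply: contra v0 => /eqP/nsq_eq0 ->.
  pose s := (Num.sqrt (nsq v))^-1.
  have s2 : s ^+ 2 = (nsq v)^-1 by rewrite exprVn sqr_sqrtr// ltW.
  have := H (s *: v)^T; rewrite trmxK nsq_scale qf_scale s2 mulVf ?gt_eqF// => /(_ erefl).
  by rewrite mulrC ler_pdivlMr.
have [[x0 x01]|S0] := pselect (exists x : 'rV[R]_n, nsq x^T = 1); last first.
  by exists 1 => //; apply: red => x x1; case: S0; exists x.
have [c cS cmin] := @compact_EVT_min _ _ (fun x : 'rV[R]_n => qf A x^T)
  [set x : 'rV[R]_n | nsq x^T = 1] (ex_intro _ x0 x01) (@compact_sphere n)
  (continuous_subspaceT (@continuous_qf n A)).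
rewrite inE/= in cS.
exists (qf A c^T); last by apply: red => x x1; apply: cmin; rewrite inE.
apply: A0; apply/eqP => c0; move: cS; rewrite c0 /nsq mulmx0 mxE => /esym/eqP.
by rewrite oner_eq0.
Qed.

End Coercivity.

Section Kronecker.
Variable R : realType.

(** Row-major vectorisation, the order of indices of the Kronecker product.  It turns a
    state of the filter bank [I (x) (A_psi, B_psi)] into a matrix with one row per
    channel, on which the filter acts by multiplication from the right. *)
Definition rowvec m p (X : 'M[R]_(m, p)) : 'cV[R]_(m * p) :=
  \col_r X (mxtens.mxtens_unindex r).1 (mxtens.mxtens_unindex r).2.

Lemma sum_mxtens m p (f : 'I_(m * p) -> R) :
  \sum_r f r = \sum_i \sum_a f (mxtens.mxtens_index (i, a)).
Proof.
rewrite (reindex (@mxtens.mxtens_index m p))/=; last first.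
  exists (@mxtens.mxtens_unindex m p) => r _;
  [exact: mxtens.mxtens_indexK|exact: mxtens.mxtens_unindexK].
rewrite (eq_bigr (fun ia => (fun i a => f (mxtens.mxtens_index (i, a))) ia.1 ia.2)).
  by rewrite -(pair_bigA _ (fun i a => f (mxtens.mxtens_index (i, a)))).
by case.
Qed.

Lemma tens_rowvec m m' p p' (P : 'M[R]_(m', m)) (M : 'M[R]_(p', p)) (X : 'M[R]_(m, p)) :
  (P *t M) *m rowvec X = rowvec (P *m X *m M^T).
Proof.
apply/colP => r; rewrite -[r]mxtens.mxtens_unindexK.
case: (mxtens.mxtens_unindex r) => i a; rewrite !mxE mxtens.mxtens_indexK/= sum_mxtens.
rewrite exchange_big/=; apply: eq_bigr => b _.
rewrite mxE mulr_suml mxE; apply: eq_bigr => j _.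
by rewrite !mxE !mxtens.mxtens_indexK/= mulrAC.
Qed.

Lemma rowvec_dot m p (X Y : 'M[R]_(m, p)) :
  ((rowvec X)^T *m rowvec Y) 0 0 = \tr (X *m Y^T).
Proof.
rewrite mxE sum_mxtens /mxtrace; apply: eq_bigr => i _.
by rewrite mxE; apply: eq_bigr => a _; rewrite !mxE !mxtens.mxtens_indexK/=.
Qed.

Lemma nsq_rowvec m p (X : 'M[R]_(m, p)) : nsq (rowvec X) = \tr (X *m X^T).
Proof. exact: rowvec_dot. Qed.

Lemma qf_tens_rowvec m p (P : 'M[R]_m) (M : 'M[R]_p) (X : 'M[R]_(m, p)) : P^T = P ->
  qf (P *t M) (rowvec X) = \tr (P *m (X *m M *m X^T)).
Proof.
move=> sP; rewrite /qf -mulmxA tens_rowvec rowvec_dot !trmx_mul trmxK sP.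
by rewrite !mulmxA mxtrace_mulC !mulmxA.
Qed.

Lemma rowvecD m p (X Y : 'M[R]_(m, p)) : rowvec (X + Y) = rowvec X + rowvec Y.
Proof. by apply/colP => r; rewrite !mxE. Qed.

Lemma rowvec0 m p : rowvec (0 : 'M[R]_(m, p)) = 0.
Proof. by apply/colP => r; rewrite !mxE. Qed.

Lemma mxprimitive_rowvec m p (X X' : R -> 'M[R]_(m, p)) : mxprimitive X X' ->
  mxprimitive (fun t => rowvec (X t)) (fun t => rowvec (X' t)).
Proof.
move=> pX r j; under eq_fun do rewrite mxE.
by under [X in primitive _ X]eq_fun do rewrite mxE.
Qed.

(** The two identity blocks make up the identity of size [k + l]. *)
Lemma Psimx_tens k l p q (J : 'M[R]_(p, q)) : Psimx k l J = (1%:M : 'M[R]_(k + l)) *t J.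
Proof.
apply/matrixP => r s; rewrite /Psimx castmxE.
rewrite -[r]mxtens.mxtens_unindexK -[s]mxtens.mxtens_unindexK.
case: (mxtens.mxtens_unindex r) (mxtens.mxtens_unindex s) => i a [j b].
rewrite mxtens.tensmxE.
have split_idx k' l' p' (i' : 'I_(k' + l')) (a' : 'I_p') :
    cast_ord (esym (esym (mulnDl k' l' p'))) (mxtens.mxtens_index (i', a')) =
    unsplit (match fintype.split i' with
       | inl u => inl (mxtens.mxtens_index (u, a'))
       | inr u => inr (mxtens.mxtens_index (u, a')) end).
  by apply/val_inj; case: splitP => u /= ->; rewrite ?mulnDl ?addnA.
rewrite /= !split_idx [RHS](_ : _ = (i == j)%:R * J a b); last by rewrite mxE.
case: splitP => u iu; case: splitP => v jv /=;
  rewrite ?block_mxEul ?block_mxEur ?block_mxEdl ?block_mxEdr ?mxtens.tensmxE ?mxE.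
- by rewrite -!val_eqE/= iu jv.
- by rewrite -val_eqE/= iu jv (ltn_eqF (leq_trans (ltn_ord u) (leq_addr _ _))) mul0r.
- by rewrite -val_eqE/= iu jv eq_sym (ltn_eqF (leq_trans (ltn_ord v) (leq_addr _ _))) mul0r.
- by rewrite -!val_eqE/= iu jv eqn_add2l.
Qed.

Lemma Psimx_rowvec k l p q (J : 'M[R]_(p, q)) (X : 'M[R]_(k + l, q)) :
  Psimx k l J *m rowvec X = rowvec (X *m J^T).
Proof. by rewrite Psimx_tens tens_rowvec mul1mx. Qed.

Lemma Psimx1_mul k l p (J : 'cV[R]_p) (X : 'cV[R]_(k + l)) :
  Psimx1 k l J *m X = rowvec (X *m J^T).
Proof.
rewrite -Psimx_rowvec; apply/colP => r; rewrite /Psimx1 !mxE.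
rewrite sum_mxtens; apply: eq_bigr => i _; rewrite big_ord1 castmxE cast_ord_id mxE.
rewrite mxtens.mxtens_indexK/=; congr (Psimx k l J r _ * _).
by apply/val_inj; rewrite /= muln1 addn0.
Qed.

End Kronecker.

(** * Decay along a Lyapunov function *)

Section Decay.
Variable R : realType.
Local Notation mu := (@lebesgue_measure R).

Lemma ac_within_continuous (f : R -> R) : (forall T, 0 <= T -> ac 0 T f) ->
  {within `[0, +oo[, continuous f}.
Proof.
move=> acf; apply/subspace_continuousP => x /=; rewrite in_itv/= andbT => x0.
apply/cvgrPdist_lt => e e0.
have x1 : 0 <= x + 1 by lra.
have [d d0 H] := acf _ x1 _ e0.
have step s t : 0 <= s -> s <= t -> t <= x + 1 -> t - s < d -> `|f t - f s| < e.
  move=> s0 st tx ts; have := H 1%N (fun=> s) (fun=> t); rewrite !big_ord1; apply=> //.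
  by move=> i j; rewrite !ord1 eqxx.
have r0 : 0 < Num.min d 1 by rewrite lt_min d0 ltr01.
apply/nbhs_ballP; exists (Num.min d 1) => //= y; rewrite /ball/= => xy /=.
rewrite in_itv/= andbT => y0.
move: xy; rewrite lt_min => /andP[xd x1'].
have [xy|/ltW yx] := leP x y.
  rewrite distrC; apply: step => //.
    by move: x1'; rewrite distrC ger0_norm ?subr_ge0//; lra.
  by move: xd; rewrite distrC ger0_norm ?subr_ge0.
by apply: step => //; [lra|move: xd; rewrite ger0_norm ?subr_ge0].
Qed.

(** Needed to use the solution of one differential equation as input of another. *)
Lemma ac_locint (f : R -> R) : (forall T, 0 <= T -> ac 0 T f) -> locint f.
Proof.
move=> acf; have mf : measurable_fun (`[0, +oo[ : set R) f.
  by apply: subspace_continuous_measurable_fun => //; exact: ac_within_continuous.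
split=> // T; have [T0|T0] := ltP T 0.
  by rewrite set_itv_ge ?bnd_simp -?ltNge//; exact: integrable_set0.
apply: measurable_bounded_integrable => //.
- exact: (compact_finite_measure (@segment_compact _ 0 T)).
- apply: measurable_funS mf => //.
  by move=> x /=; rewrite !in_itv/= => /andP[->].
- have [K K0 HK] := ac_bounded T0 (acf T T0).
  exists K; split; first exact: num_real.
  move=> M KM x /=; rewrite in_itv/= => /andP[x0 xT].
  exact: le_trans (HK x x0 xT) (ltW KM).
Qed.

Lemma mxprimitive_locint m n (F F' : R -> 'M[R]_(m, n)) : mxprimitive F F' -> mxlocint F.
Proof. by move=> pF i j; apply: ac_locint; have [] := pF i j. Qed.

(** [V] is nonincreasing and bounded below, so that its variation after a late time [T] is
    small.  The bound on [u'] makes [c V + u] and [c V - u] monotone for [c = K / a], so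
    that [u] varies little after [T] too.  If [u] were at least [e] at such a time it would
    remain above [e / 2], and [V] would decrease at a constant rate for ever. *)
Lemma lyapunov_decay (V V' u u' g : R -> R) (a K : R) : 0 < a -> 0 <= K ->
  primitive V V' -> primitive u u' ->
  (forall t : R, 0 <= t -> [/\ 0 <= V t, 0 <= u t & 0 <= g t]) ->
  {ae mu, forall t : R, 0 <= t -> V' t <= - a * (u t + g t)} ->
  {ae mu, forall t : R, 0 <= t -> `|u' t| <= K * (u t + g t)} ->
  (forall t : R, 0 <= t -> V t <= V 0) /\
  forall e : R, 0 < e -> exists2 T : R, 0 <= T & forall t, T <= t -> u t <= e.
Proof.
move=> a0 K0 pV pu pos dV du.
have dec : forall s t, 0 <= s -> s <= t -> V t <= V s.
  apply: (primitive_nonincreasing pV).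
  apply: (ae_mono dV) => t H t0; have [_ u0 g0] := pos t t0; have := H t0; nra.
split=> [t t0|e e0]; first exact: dec.
pose c := K / a; have c0 : 0 <= c by rewrite divr_ge0// ltW.
have ca : c * a = K by rewrite /c mulfVK// gt_eqF.
have var s t : 0 <= s -> s <= t -> u s - u t <= c * (V s - V t).
  move=> s0 st.
  have pw := primitiveD (primitiveZ c pV) (primitiveZ (-1) pu).
  suff : c * V t + -1 * u t <= c * V s + -1 * u s by lra.
  apply: (primitive_nonincreasing pw) => //.
  apply: ae_mono2 dV du _ => r Hv Hu r0; have [_ u0 g0] := pos r r0.
  have hv := Hv r0; have := Hu r0; rewrite ler_norml => /andP[h1 h2].
  have : c * V' r <= - K * (u r + g r).
    have -> : - K * (u r + g r) = c * (- a * (u r + g r)) by rewrite -ca; ring.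
    by rewrite ler_wpM2l.
  lra.
pose S : set R := [set V t | t in `[0, +oo[].
have S0 : S !=set0 by exists (V 0), 0 => //=; rewrite in_itv/= lexx.
have lbS : lbound S 0.
  by move=> _ [t /= + <-]; rewrite in_itv/= andbT => t0; have [] := pos t t0.
have hS : has_inf S by split=> //; exists 0.
pose d := e / (2 * (c + 1)).
have c1 : 0 < 2 * (c + 1) by lra.
have d0 : 0 < d by rewrite divr_gt0.
have cd : c * d <= e / 2.
  rewrite /d mulrA ler_pdivrMr//; nra.
have [_ [T /= T0 <-] VT] := inf_adherent d0 hS.
rewrite in_itv/= andbT in T0; exists T => // s Ts.
have s0 := le_trans T0 Ts.
rewrite leNgt; apply/negP => us.
have half t : s <= t -> e / 2 <= u t.
  move=> st; have t0 := le_trans s0 st.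
  have h1 := var s t s0 st.
  have h2 : V s <= V T by exact: dec.
  have h3 : inf S <= V t by apply: ge_inf; [exists 0|exists t => //=; rewrite in_itv/= andbT].
  have : c * (V s - V t) <= c * d by rewrite ler_wpM2l//; lra.
  lra.
have pid : primitive (fun t : R => t) (fun=> 1).
  by apply: primitive_derive; exact: cst_continuous.
(* V t + a (e / 2) t would be nonincreasing from s on *)
have pL := primitiveD pV (primitiveZ (a * (e / 2)) pid).
have lin : forall t, s <= t -> V t + a * (e / 2) * t <= V s + a * (e / 2) * s.
  move=> t; apply: (primitive_nonincreasing_after s0 pL) => //.
  apply: (ae_mono dV) => r Hr sr; have r0 := le_trans s0 sr.
  have [_ _ g0] := pos r r0; have h1 := half r sr.
  have : a * (e / 2) <= a * (u r + g r) by apply: ler_wpM2l; [exact: ltW|lra].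
  by have := Hr r0; lra.
pose t := s + V s / (a * (e / 2)) + 1.
have ae0 : 0 < a * (e / 2) by rewrite mulr_gt0// divr_gt0.
have [Vs _ _] := pos s s0.
have q0 : 0 <= V s / (a * (e / 2)) by rewrite divr_ge0// ltW.
have st : s <= t by rewrite /t; lra.
have [Vt _ _] := pos t (le_trans s0 st).
have qE : V s / (a * (e / 2)) * (a * (e / 2)) = V s by rewrite mulfVK// gt_eqF.
have tE : a * (e / 2) * t = a * (e / 2) * s + V s + a * (e / 2).
  by rewrite -[in RHS]qE /t; ring.
by have := lin t st; lra.
Qed.
End Decay.

(** * Storage functions of the uncertainty *)

Section Dissipation.
Variable R : realType.
Local Open Scope sesquilinear_scope.
Local Notation mu := (@lebesgue_measure R).

Lemma symmetricmx_tr n (A : 'M[R]_n) : A \is symmetricmx -> A^T = A.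
Proof.
move=> sA; have /eqP {2}-> // : A == A^T.
by move: sA; rewrite is_hermitianmxE expr0 scale1r map_mx_id.
Qed.

Lemma mxtrace_congr n m p (K1 : 'M[R]_(p, n)) (M : 'M[R]_p) (K2 : 'M[R]_(p, n))
    (V : 'M[R]_(n, m)) (L : 'M[R]_m) :
  \tr (K1^T *m M *m K2 *m (V *m L *m V^T)) =
  \tr (M *m ((K2 *m V) *m L *m (K1 *m V)^T)).
Proof. by rewrite trmx_mul -!mulmxA mxtrace_mulC !mulmxA. Qed.

(** [V L V^T] is positive semidefinite, and so is [M]. *)
Lemma trace_form_ge0 n m (M : 'M[R]_n) (V : 'M[R]_(n, m)) (L : 'M[R]_m) :
  M^T = M -> rpsd M -> L^T = L -> rpsd L -> 0 <= \tr (M *m (V *m L *m V^T)).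
Proof.
move=> sM pM sL pL; apply: rtrace_psd_ge0 => //.
  by rewrite !trmx_mul trmxK sL mulmxA.
move=> v; have := pL (V^T *m v).
by rewrite trmx_mul trmxK !mulmxA.
Qed.

Lemma trace_form_rows n m (V : 'M[R]_(n, m)) (L : 'M[R]_m) :
  \tr (V *m L *m V^T) = \sum_i qf L (row i V)^T.
Proof.
apply: eq_bigr => i _; rewrite /qf trmxK -row_mul [LHS]mxE [RHS]mxE.
by apply: eq_bigr => j _; rewrite !mxE.
Qed.

Lemma trace_form_bound m (L : 'M[R]_m) : exists2 K, 0 <= K &
  forall n (V : 'M[R]_(n, m)), \tr (V *m L *m V^T) <= K * \tr (V *m V^T).
Proof.
have [K K0 HK] := qf_bound L; exists K => // n V.
have -> : \tr (V *m V^T) = \sum_i qf 1%:M (row i V)^T.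
  by rewrite -trace_form_rows mulmx1.
rewrite trace_form_rows mulr_sumr.
by apply: ler_sum => i _; rewrite qf1; apply: le_trans (ler_norm _) (HK _).
Qed.

Lemma primitive_trace_form n m (P : 'M[R]_n) (L : 'M[R]_m) (F F' : R -> 'M[R]_(n, m)) :
  mxprimitive F F' ->
  primitive (fun t => \tr (P *m (F t *m L *m (F t)^T)))
    (fun t => \tr (P *m (F' t *m L *m (F t)^T + F t *m L *m (F' t)^T))).
Proof.
move=> pF; apply: primitive_trace; apply: mxprimitive_mull.
exact: mxprimitiveM (mxprimitive_mulr L pF) (mxprimitive_tr pF).
Qed.

Lemma dot_bound n p (K1 K2 : 'M[R]_(p, n)) : exists2 K, 0 <= K &
  forall v, `|((K1 *m v)^T *m (K2 *m v)) 0 0| <= K * nsq v.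
Proof.
have [K K0 HK] := qf_bound (K1^T *m K2); exists K => // v.
by apply: le_trans (HK v); rewrite /qf trmx_mul !mulmxA.
Qed.

(** The hypothesis says that a certain matrix is positive semidefinite.  Its trace
    against [V L V^T], with [V = (X; U)], expresses the inequality for all the columns of
    [X] and [U] at once, combined with the weight [L]. *)
Lemma kyp_trace n k l q (A : 'M[R]_n) (B : 'M[R]_(n, k)) (C : 'M[R]_(l, n)) (D : 'M[R]_(l, k))
    (P0 : 'M[R]_(k + l)) (P : 'M[R]_n) (e : R) (L : 'M[R]_q) :
  P0^T = P0 -> P^T = P -> L^T = L -> rpsd L ->
  (forall x u, - e * nsq u <=
     2 * (x^T *m P *m (A *m x + B *m u)) 0 0 + qf P0 (col_mx u (C *m x + D *m u))) ->
  forall (X X' : 'M[R]_(n, q)) (U : 'M[R]_(k, q)) Phi,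
  X' = A *m X + B *m U -> Phi = col_mx U (C *m X + D *m U) ->
  0 <= \tr (P *m (X' *m L *m X^T + X *m L *m X'^T)) + \tr (P0 *m (Phi *m L *m Phi^T))
     + e * \tr (U *m L *m U^T).
Proof.
move=> sP0 sP sL pL H X X' U Phi X'E PhiE.
pose K0 : 'M[R]_(n, n + k) := row_mx 1%:M 0.
pose K1 : 'M[R]_(n, n + k) := row_mx A B.
pose K2 : 'M[R]_(k, n + k) := row_mx 0 1%:M.
pose Gm : 'M[R]_(k + l, n + k) := col_mx K2 (row_mx C D).
pose M := K0^T *m P *m K1 + K1^T *m P *m K0 + Gm^T *m P0 *m Gm + e *: (K2^T *m 1%:M *m K2).
pose V := col_mx X U.
have K0V : K0 *m V = X by rewrite mul_row_col mul1mx mul0mx addr0.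
have K1V : K1 *m V = X' by rewrite mul_row_col X'E.
have K2V : K2 *m V = U by rewrite mul_row_col mul1mx mul0mx add0r.
have GmV : Gm *m V = Phi by rewrite PhiE mul_col_mx K2V mul_row_col.
have sM : M^T = M.
  rewrite /M [LHS]linearD/= [X in X + _]linearD/= [X in X + _ + _]linearD/= linearZ/=.
  by rewrite !trmx_mul !trmxK sP sP0 trmx1 !mulmxA [X in X + _ + _]addrC.
have pM : rpsd M.
  move=> v; rewrite -/(qf M v) /M !qfD qfZ !qf_congr qf1.
  rewrite -[v]vsubmxK; set x := usubmx v; set u := dsubmx v.
  have K0v : K0 *m col_mx x u = x by rewrite mul_row_col mul1mx mul0mx addr0.
  have K1v : K1 *m col_mx x u = A *m x + B *m u by rewrite mul_row_col.
  have K2v : K2 *m col_mx x u = u by rewrite mul_row_col mul1mx mul0mx add0r.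
  have -> : Gm *m col_mx x u = col_mx u (C *m x + D *m u) by rewrite mul_col_mx K2v mul_row_col.
  have -> : qf (K0^T *m P *m K1) (col_mx x u) = (x^T *m P *m (A *m x + B *m u)) 0 0.
    by rewrite /qf !mulmxA -trmx_mul K0v -mulmxA K1v.
  have -> : qf (K1^T *m P *m K0) (col_mx x u) = (x^T *m P *m (A *m x + B *m u)) 0 0.
    by rewrite -bilin_sym// /qf !mulmxA -trmx_mul K1v -mulmxA K0v.
  by have := H x u; rewrite K2v; lra.
have := trace_form_ge0 V sM pM sL pL.
rewrite /M !mulmxDl !linearD/= -scalemxAl linearZ/= !mxtrace_congr.
by rewrite K0V K1V K2V GmV mul1mx.
Qed.

(** The frequency condition of the Kalman-Yakubovich-Popov lemma is the membership of
    [Delta (i om)] in the value set: at a solution of [A f + B g = i om f], the output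
    [C f + D g] is [Delta (i om) g].  Taking [u = 0] in the resulting inequality and using
    that the lower right block of [P0] is nonpositive, the form of [P] is nondecreasing
    along the stable system [x' = A x], so [P] is negative semidefinite. *)
Lemma uncertainty_storage k l (P0 : 'M[R]_(k + l)) (Delta : lti R k l) :
  P0^T = P0 -> (forall y, qf (drsubmx P0) y <= 0) -> uncertainty (value_set P0) Delta ->
  exists (A : 'M[R]_(lti_dim Delta)) B,
    (forall j, lti_C Delta *m lti_A Delta ^+ j *m lti_B Delta =
               lti_C Delta *m A ^+ j *m B) /\
    forall e, 0 < e -> exists P : 'M[R]_(lti_dim Delta), [/\ P^T = P,
      forall v, qf P v <= 0 &
      forall x u, - e * nsq u <= 2 * (x^T *m P *m (A *m x + B *m u)) 0 0
        + qf P0 (col_mx u (lti_C Delta *m x + lti_D Delta *m u))].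
Proof.
move=> sP0 nR [hG Vom Vinf].
have [A [B [hA markov Gom Ginf]]] := stable_realisation hG.
exists A, B; split=> // e e0.
set C := lti_C Delta in Gom *; set D := lti_D Delta in Gom Ginf *.
pose Gm : 'M[R]_(k + l, lti_dim Delta + k) := block_mx 0 1%:M C D.
have GmE x u : Gm *m col_mx x u = col_mx u (C *m x + D *m u).
  by rewrite mul_block_col mul0mx mul1mx add0r.
have sM : (Gm^T *m P0 *m Gm)^T = Gm^T *m P0 *m Gm.
  by rewrite !trmx_mul trmxK sP0 mulmxA.
have form (f : 'cV[R[i]]_(lti_dim Delta)) (g : 'cV[R[i]]_k) V0 : value_set P0 V0 ->
    cmx C *m f + cmx D *m g = V0 *m g ->
    0 <= ((col_mx f g) ^t* *m cmx (Gm^T *m P0 *m Gm) *m col_mx f g) 0 0.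
  move=> [_ pV0] eq; have := pV0 g.
  have GmC : cmx Gm *m col_mx f g = col_mx 1%:M V0 *m g.
    rewrite /cmx map_block_mx -/(cmx _) -/(cmx _) -/(cmx _) -/(cmx _).
    rewrite mul_block_col mul_col_mx mul1mx -eq cmx0 mul0mx add0r.
    by rewrite /cmx map_mx1 mul1mx.
  rewrite !mulmxA -adjM -mulmxA -GmC adjM adj_cmx.
  by rewrite !cmxM !mulmxA.
have H1 (f : 'cV[R[i]]_(lti_dim Delta)) (g : 'cV[R[i]]_k) (lam : R[i]) :
    Num.conj lam = - lam -> cmx A *m f + cmx B *m g = lam *: f ->
    0 <= ((col_mx f g) ^t* *m cmx (Gm^T *m P0 *m Gm) *m col_mx f g) 0 0.
  move=> lamE eq; apply: form (Vom (complex.Im lam)) _.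
  apply: Gom; rewrite eq; congr (_ *: _).
  case: lam lamE {eq} => a b /= /(congr1 (@complex.Re R)) /=.
  by move=> /eqP; rewrite eq_sym eqNr => /eqP ->.
have H2 (g : 'cV[R[i]]_k) :
    0 <= ((col_mx (0 : 'cV[R[i]]_(lti_dim Delta)) g) ^t* *m cmx (Gm^T *m P0 *m Gm)
          *m col_mx 0 g) 0 0.
  by apply: form Vinf _; rewrite mulmx0 add0r Ginf.
have [P sP HP] := kyp sM hA H1 H2 e0.
have HP' x u : - e * nsq u <= 2 * (x^T *m P *m (A *m x + B *m u)) 0 0
        + qf P0 (col_mx u (C *m x + D *m u)).
  by have := HP x u; rewrite qf_congr GmE.
exists P; split=> //.
apply: (lyapunov_sign hA sP) => v.
have := HP' v 0; rewrite !mulmx0 !addr0.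
have -> : nsq (0 : 'cV[R]_k) = 0 by rewrite /nsq mulmx0 mxE.
have -> : qf P0 (col_mx 0 (C *m v)) = qf (drsubmx P0) (C *m v).
  rewrite /qf -[P0 in LHS]submxK tr_col_mx trmx0 mul_row_block mul_row_col.
  by rewrite !mul0mx mulmx0 !add0r.
by rewrite mulr0; have := nR (C *m v); lra.
Qed.

End Dissipation.

(** * The matrix inequalities as quadratic identities *)

Section Inequalities.
Variable R : realType.

Lemma qf_storage_block n m (X : 'M[R]_n) (K : 'M[R]_m) (h h' : 'cV[R]_n) v : X^T = X ->
  qf (block_mx (block_mx 0 X X 0) 0 0 K) (col_mx (col_mx h h') v) =
  2 * (h^T *m X *m h') 0 0 + qf K v.
Proof.
move=> sX; rewrite /qf !tr_col_mx !mul_row_block !mulmx0 !addr0 !add0r.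
rewrite !mul_row_col [LHS]mxE; congr (_ + _).
by rewrite [LHS]mxE bilin_sym// -mulr2n mulr_natl.
Qed.

Variables (n k l p m : nat).
Variables (A : 'M[R]_n) (B : 'M[R]_(n, l)) (C : 'M[R]_(k, n)) (D : 'M[R]_(k, l)).
Variables (P0 : 'M[R]_(k + l)) (Ap : 'M[R]_p) (Bp : 'cV[R]_p) (Cp : 'M[R]_(m, p)) (Dp : 'cV[R]_m).
Variables (X : 'M[R]_((k + l) * p + n)) (Y : 'M[R]_p) (M : 'M[R]_m).
Hypothesis sP0 : P0^T = P0.

Definition lmi_filter : 'M[R]_(p + 1) :=
  let F := block_mx 1%:M 0 Ap Bp in let G := row_mx Cp Dp in
  F^T *m block_mx 0 Y Y 0 *m F + G^T *m M *m G.

Definition lmi_outer : 'M[R]_((k + l) * p + n + ((k + l) * p + n) + (k + l) * m,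
                              (k + l) * p + n + l) :=
  let APsi := Psimx k l Ap in let BPsi := Psimx1 k l Bp in
  let CPsi := Psimx k l Cp in let DPsi := Psimx1 k l Dp in
  let C0 := col_mx C 0 : 'M[R]_(k + l, n) in
  let DI := col_mx D 1%:M : 'M[R]_(k + l, l) in
  col_mx (col_mx
            (col_mx (row_mx (row_mx 1%:M 0) 0)
                    (row_mx (row_mx 0 1%:M) 0))
            (col_mx (row_mx (row_mx APsi (BPsi *m C0)) (BPsi *m DI))
                    (row_mx (row_mx 0 A) B)))
            (row_mx (row_mx CPsi (DPsi *m C0)) (DPsi *m DI)).

Definition lmi_main : 'M[R]_((k + l) * p + n + l) :=
  lmi_outer^T *m block_mx (block_mx 0 X X 0) 0 0 (P0 *t M) *m lmi_outer.

(** Multiplication of [Phi] by the two block rows of [F] from the right reads off the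
    filter state [Xi] and its derivative [Xi'], and multiplication by [G] the filter
    output. *)
Lemma lmi_filter_trace (Xi : 'M[R]_(k + l, p)) (zeta : 'cV[R]_(k + l)) :
  let Xi' := Xi *m Ap^T + zeta *m Bp^T in let Phi := row_mx Xi zeta in
  \tr (P0 *m (Phi *m lmi_filter *m Phi^T)) =
  \tr (P0 *m (Xi' *m Y *m Xi^T + Xi *m Y *m Xi'^T)) +
  qf (P0 *t M) (rowvec (Xi *m Cp^T + zeta *m Dp^T)).
Proof.
move=> Xi' Phi; rewrite qf_tens_rowvec// -linearD/= -mulmxDr; congr (\tr (_ *m _)).
rewrite /lmi_filter/=; set F := block_mx 1%:M 0 Ap Bp; set G := row_mx Cp Dp.
have FP : Phi *m F^T = row_mx Xi Xi'.
  rewrite /F tr_block_mx mul_row_block trmx1 trmx0 mulmx1 mulmx0 addr0.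
  by [].
have GP : Phi *m G^T = Xi *m Cp^T + zeta *m Dp^T by rewrite tr_row_mx mul_row_col.
rewrite mulmxDr mulmxDl; congr (_ + _).
  have FPt : F *m Phi^T = (row_mx Xi Xi')^T by rewrite -FP trmx_mul trmxK.
  rewrite !mulmxA FP -[_ *m F *m _]mulmxA FPt.
  by rewrite mul_row_block tr_row_mx mul_row_col !mulmx0 add0r addr0.
rewrite !mulmxA GP -[_ *m G *m _]mulmxA.
by have -> : G *m Phi^T = (Xi *m Cp^T + zeta *m Dp^T)^T by rewrite -GP trmx_mul trmxK.
Qed.

Lemma lmi_outer_mul (Xi : 'M[R]_(k + l, p)) (x : 'cV[R]_n) (w : 'cV[R]_l) :
  let zeta := col_mx (C *m x + D *m w) w in
  lmi_outer *m col_mx (col_mx (rowvec Xi) x) w =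
  col_mx (col_mx (col_mx (rowvec Xi) x)
     (col_mx (rowvec (Xi *m Ap^T + zeta *m Bp^T)) (A *m x + B *m w)))
     (rowvec (Xi *m Cp^T + zeta *m Dp^T)).
Proof.
move=> zeta; have zE : col_mx C 0 *m x + col_mx D 1%:M *m w = zeta.
  by rewrite !mul_col_mx mul0mx mul1mx add_col_mx add0r.
have psi q (J : 'M[R]_(q, p)) (J1 : 'cV[R]_q) :
    Psimx k l J *m rowvec Xi + Psimx1 k l J1 *m col_mx C 0 *m x
      + Psimx1 k l J1 *m col_mx D 1%:M *m w = rowvec (Xi *m J^T + zeta *m J1^T).
  by rewrite -!mulmxA -addrA -mulmxDr zE Psimx_rowvec Psimx1_mul rowvecD.
clearbody zeta; rewrite /lmi_outer/= ![col_mx _ _ *m col_mx _ _]mul_col_mx !mul_row_col !mul0mx !mul1mx !addr0 !add0r.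
by rewrite !psi.
Qed.

Hypothesis sX : X^T = X.

(** Eliminating [P0 (x) M] between the two inequalities is the point: what remains is
    the derivative of [h^T X h - tr (P0 Xi Y Xi^T)] and a term in the positive definite
    matrix [lmi_filter], the one that [kyp_trace] estimates. *)
Lemma lmi_main_form (Xi : 'M[R]_(k + l, p)) (x : 'cV[R]_n) (w : 'cV[R]_l) :
  let zeta := col_mx (C *m x + D *m w) w in
  let Xi' := Xi *m Ap^T + zeta *m Bp^T in let Phi := row_mx Xi zeta in
  let h := col_mx (rowvec Xi) x in
  let h' := col_mx (rowvec Xi') (A *m x + B *m w) in
  qf lmi_main (col_mx h w) = 2 * (h^T *m X *m h') 0 0
    - \tr (P0 *m (Xi' *m Y *m Xi^T + Xi *m Y *m Xi'^T))
    + \tr (P0 *m (Phi *m lmi_filter *m Phi^T)).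
Proof.
move=> zeta Xi' Phi h h'.
rewrite lmi_filter_trace -/Xi' addrA subrK.
rewrite /lmi_main qf_congr lmi_outer_mul -/zeta -/Xi' -/h -/h'.
by rewrite qf_storage_block.
Qed.

End Inequalities.

(** * Robust stability *)

Section FilteredSignals.
Variable R : realType.
Local Notation mu := (@lebesgue_measure R).

(** Filter the input of the uncertainty, giving [Z], and drive the state equation by [Z]
    instead of [z], giving [S].  The filter acts from the right and the dynamics from
    the left, so they commute: [S] is also the filtered state [eta], and
    [C S + D Z] is the filtered output [w].  In this way the uncertainty, seen on all
    filter states at once, satisfies its state equation with state matrix
    [(S, eta)]. *)
Lemma filtered_states q k l p (A : 'M[R]_q) (B : 'M[R]_(q, k)) (C : 'M[R]_(l, q))
    (D : 'M[R]_(l, k)) (Ap : 'M[R]_p) (Bp : 'cV[R]_p) (eta : R -> 'cV[R]_q)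
    (z : R -> 'cV[R]_k) (w : R -> 'cV[R]_l) :
  mxlocint z -> mxprimitive eta (fun t => A *m eta t + B *m z t) -> eta 0 = 0 ->
  {ae mu, forall t : R, 0 <= t -> w t = C *m eta t + D *m z t} ->
  exists (Z : R -> 'M[R]_(k, p)) (S : R -> 'M[R]_(q, p)),
    let Xi t := col_mx (Z t) (C *m S t + D *m Z t) in
    [/\ Z 0 = 0, S 0 = 0,
        mxprimitive Xi (fun t => Xi t *m Ap^T + col_mx (z t) (w t) *m Bp^T) &
        mxprimitive (fun t => row_mx (S t) (eta t))
          (fun t => A *m row_mx (S t) (eta t) + B *m row_mx (Z t) (z t))].
Proof.
move=> lz peta eta0 wE.
have lBz : mxlocint (fun t => Bp *m (z t)^T).
  apply: mxlocint_mul => [i j|i j]; first exact: cst_continuous.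
  by under eq_fun do rewrite mxE; exact: lz.
have [Zt [pZt Zt0]] : exists Zt : R -> 'M[R]_(p, k),
    mxprimitive Zt (fun t => Ap *m Zt t + Bp *m (z t)^T) /\ Zt 0 = 0.
  by eexists; exact: linear_ode lBz.
pose Z t := (Zt t)^T.
have pZ : mxprimitive Z (fun t => Z t *m Ap^T + z t *m Bp^T).
  apply: eq_mxprimitive (mxprimitive_tr pZt) => // t.
  by rewrite linearD/= !trmx_mul trmxK.
have lBZ : mxlocint (fun t => B *m Z t).
  apply: mxlocint_mul => [i j|]; first exact: cst_continuous.
  exact: mxprimitive_locint pZ.
have [S [pS S0]] : exists S : R -> 'M[R]_(q, p),
    mxprimitive S (fun t => A *m S t + B *m Z t) /\ S 0 = 0.
  by eexists; exact: linear_ode lBZ.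
have Z0 : Z 0 = 0 by rewrite /Z Zt0 trmx0.
(* the defect of commutation solves a homogeneous linear equation *)
pose E t := S t *m Ap^T + eta t *m Bp^T - (A *m S t + B *m Z t).
have pE : mxprimitive E (fun t => A *m E t).
  have := mxprimitiveB
    (mxprimitiveD (mxprimitive_mulr Ap^T pS) (mxprimitive_mulr Bp^T peta))
    (mxprimitiveD (mxprimitive_mull A pS) (mxprimitive_mull B pZ)).
  apply: eq_mxprimitive => // t; rewrite /E.
  rewrite !mulmxBr !mulmxDr !mulmxDl !mulmxA opprD.
  rewrite (addrACA (A *m S t *m Ap^T)).
  by rewrite (addrACA (A *m S t *m Ap^T + _)) subrr addr0.
have E0 : E 0 = 0 by rewrite /E S0 eta0 Z0 !(mul0mx, mulmx0, addr0, subr0).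
have EE t : 0 <= t -> A *m S t + B *m Z t = S t *m Ap^T + eta t *m Bp^T.
  by move=> t0; apply/esym/eqP; rewrite -subr_eq0; apply/eqP; exact: linear_ode_uniq pE E0 t t0.
have pS' : mxprimitive S (fun t => S t *m Ap^T + eta t *m Bp^T).
  by apply: mxprimitive_ae pS _; apply: aeW => t t0; exact: EE.
exists Z, S; split=> //.
  have := mxprimitive_col pZ (mxprimitiveD (mxprimitive_mull C pS') (mxprimitive_mull D pZ)).
  move=> /mxprimitive_ae; apply.
  apply: (ae_mono wE) => t H t0.
  rewrite !mul_col_mx add_col_mx; congr col_mx.
  by rewrite H// !mulmxDr !mulmxDl !mulmxA addrACA.
have := mxprimitive_row pS peta.
apply: eq_mxprimitive => // t.
by rewrite !mul_mx_row add_row_mx.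
Qed.

End FilteredSignals.

Section Robustness.
Local Open Scope sesquilinear_scope.
Variable R : realType.
Local Notation mu := (@lebesgue_measure R).
Variables (n k l p m : nat).
Variables (A : 'M[R]_n) (B : 'M[R]_(n, l)) (C : 'M[R]_(k, n)) (D : 'M[R]_(k, l)).
Variables (P0 : 'M[R]_(k + l)) (Ap : 'M[R]_p) (Bp : 'cV[R]_p) (Cp : 'M[R]_(m, p)) (Dp : 'cV[R]_m).
Variables (X : 'M[R]_((k + l) * p + n)) (Y : 'M[R]_p) (M : 'M[R]_m).
Hypotheses (sP0 : P0^T = P0) (sX : X^T = X).
Let L := lmi_filter Ap Bp Cp Dp Y M.
Let N := lmi_main A B C D P0 Ap Bp Cp Dp X M.
Hypothesis sL : L^T = L.
Hypothesis pL : forall v : 'cV[R]_(p + 1), v != 0 -> 0 < qf L v.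
Hypothesis nN : forall v : 'cV[R]_((k + l) * p + n + l), v != 0 -> qf N v < 0.

Let DI : 'M[R]_(k + l, l) := col_mx D 1%:M.

(** Evaluate the identity [lmi_main_form] at [Xi = 0] and [x = 0].  Only the last
    diagonal entry of [lmi_filter] is left, multiplied by the form in question, and this
    entry is positive. *)
Lemma channel_neg (w : 'cV[R]_l) : w != 0 -> qf P0 (DI *m w) < 0.
Proof.
move=> w0; pose zeta := col_mx (C *m 0 + D *m w) w.
have DIw : DI *m w = zeta by rewrite /zeta mulmx0 add0r mul_col_mx mul1mx.
have v0 : col_mx (col_mx (rowvec (0 : 'M[R]_(k + l, p))) (0 : 'cV[R]_n)) w != 0.
  by rewrite col_mx_eq0 negb_and w0 orbT.
have := nN v0; rewrite /N (lmi_main_form A B C D Ap Bp Cp Dp Y M sP0 sX 0 0 w) -/zeta -/L.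
rewrite rowvec0 col_mx0 !(trmx0, mul0mx, mulmx0) addr0 mulmx0 mxtrace0 subr0.
rewrite [X in 2 * X]mxE mulr0 add0r.
(* the last basis vector: row_mx 0 zeta has rank one *)
pose q := col_mx 0 1%:M : 'cV[R]_(p + 1).
have q0 : q != 0.
  rewrite col_mx_eq0 negb_and.
  by apply/orP; right; apply/eqP => /matrixP/(_ 0 0)/eqP; rewrite !mxE oner_eq0.
have -> : row_mx (0 : 'M[R]_(k + l, p)) zeta = zeta *m q^T.
  by rewrite /q tr_col_mx mul_mx_row trmx0 mulmx0 trmx1 mulmx1.
have -> : zeta *m q^T *m L *m (zeta *m q^T)^T = qf L q *: (zeta *m zeta^T).
  rewrite trmx_mul trmxK !mulmxA -2!(mulmxA zeta) [q^T *m _ *m _]mx11_scalar -/(qf L q).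
  by rewrite mul_mx_scalar -scalemxAl.
rewrite -scalemxAr linearZ/= -qf_trace DIw.
by rewrite pmulr_rlt0// pL.
Qed.

(** A kernel vector [z] of [1 - D V0] gives [(z; w) = (D; 1) w] with [w = V0 z <> 0].  The
    form of [P0] is nonnegative there because [V0] is in the value set, and negative by
    [channel_neg]. *)
Lemma well_posed V0 : value_set P0 V0 -> \det (1%:M - cmx D *m V0) != 0.
Proof.
move=> [_ pV0]; rewrite -det_tr; apply/det0P => -[u u0 uD].
pose z := u^T; have z0 : z != 0 by rewrite trmx_eq0.
have zE : z = cmx D *m (V0 *m z).
  have : (u *m (1%:M - cmx D *m V0)^T)^T = 0 by rewrite uD trmx0.
  by rewrite trmx_mul trmxK mulmxBl mul1mx -mulmxA => /eqP; rewrite subr_eq0 => /eqP.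
pose w := V0 *m z.
have zetaE : col_mx 1%:M V0 *m z = cmx DI *m w.
  by rewrite mul_col_mx mul1mx {1}zE /DI /cmx map_col_mx map_mx1 mul_col_mx mul1mx.
have formE : z ^t* *m ((col_mx 1%:M V0) ^t* *m cmx P0 *m col_mx 1%:M V0) *m z =
    w ^t* *m cmx (DI^T *m P0 *m DI) *m w.
  by rewrite !mulmxA -adjM -mulmxA zetaE adjM adj_cmx !cmxM !mulmxA.
have := pV0 z; rewrite formE [w]complex_split form_complex; last first.
  by rewrite !trmx_mul trmxK sP0 mulmxA.
rewrite ler0c -/(qf _ _) -/(qf _ (map_mx (@complex.Im R) w)) !qf_congr.
set a := map_mx _ w; set b := map_mx _ w => ab.
have np c : qf P0 (DI *m c) <= 0.
  have [->|c0] := eqVneq c 0; last exact: ltW (channel_neg c0).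
  by rewrite /qf !mulmx0 mxE.
have a0 : a = 0.
  by apply: contraTeq ab => /channel_neg h; rewrite -ltNge; have := np b; lra.
have b0 : b = 0.
  by apply: contraTeq ab => /channel_neg h; rewrite -ltNge; have := np a; lra.
have w0 : w = 0 by rewrite [w]complex_split -/a -/b a0 b0 cmx0 scaler0 addr0.
by move: z0; rewrite zE -/w w0 mulmx0 eqxx.
Qed.

Hypothesis pS : forall v : 'cV[R]_((k + l) * p + n), v != 0 ->
  0 < qf (X - block_mx (P0 *t Y) 0 0 0) v.
Hypothesis nR : forall y : 'cV[R]_l, qf (drsubmx P0) y <= 0.

Lemma qf_storage (Xi : 'M[R]_(k + l, p)) (x : 'cV[R]_n) :
  qf (X - block_mx (P0 *t Y) 0 0 0) (col_mx (rowvec Xi) x) =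
  qf X (col_mx (rowvec Xi) x) - \tr (P0 *m (Xi *m Y *m Xi^T)).
Proof.
rewrite qfB -qf_tens_rowvec//; congr (_ - _).
rewrite /qf tr_col_mx mul_row_block mul_row_col.
by rewrite !mulmx0 !addr0 mul0mx addr0.
Qed.

(** The left-hand side is the derivative of the Lyapunov function of [robust_bound].  The
    terms in [P0] and [lmi_filter] of [lmi_main_form] and of [kyp_trace] cancel, leaving
    [- e] times the square norm of [(Xi, x, w)] and the slack of the storage inequality.
    The latter is a quadratic form in [Z] and [z = C x + D w], hence bounded by the former
    for small [gamma].  What matters is that [a] and [gamma] are chosen before the
    uncertainty. *)
Lemma dissipation_rate : exists a gamma : R, [/\ 0 < a, 0 < gamma &
  forall q (A' : 'M[R]_q) (B' : 'M[R]_(q, k)) (C' : 'M[R]_(l, q)) (D' : 'M[R]_(l, k))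
    (P : 'M[R]_q) (Z : 'M[R]_(k, p)) (S : 'M[R]_(q, p)) (x : 'cV[R]_n)
    (eta : 'cV[R]_q) (z : 'cV[R]_k) (w : 'cV[R]_l),
    P^T = P ->
    (forall y u, - gamma * nsq u <=
     2 * (y^T *m P *m (A' *m y + B' *m u)) 0 0 + qf P0 (col_mx u (C' *m y + D' *m u))) ->
    z = C *m x + D *m w -> w = C' *m eta + D' *m z ->
    let Xi := col_mx Z (C' *m S + D' *m Z) in
    let Xi' := Xi *m Ap^T + col_mx z w *m Bp^T in
    let h := col_mx (rowvec Xi) x in
    let h' := col_mx (rowvec Xi') (A *m x + B *m w) in
    let T := row_mx S eta in let T' := A' *m T + B' *m row_mx Z z in
    is_true (2 * (h^T *m X *m h') 0 0 - \tr (P0 *m (Xi' *m Y *m Xi^T + Xi *m Y *m Xi'^T))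
      - \tr (P *m (T' *m L *m T^T + T *m L *m T'^T)) <= - a * (nsq x + nsq w))].
Proof.
have [e e0 He] : exists2 e, 0 < e & forall v, e * nsq v <= qf (- N) v.
  apply: qf_coercive => v v0; have := nN v0.
  by rewrite qfN oppr_gt0.
have [K K0 HK] := trace_form_bound L.
have [K1 K10 HK1] := dot_bound (row_mx C D) (row_mx C D).
(* the slack is at most gamma K (1 + K1) (|Xi|^2 + |x|^2 + |w|^2) *)
pose c := 2 * (K * (1 + K1)) + 1.
have c0 : 0 < c by rewrite /c; nra.
exists (e / 2), (e / c); split; [by rewrite divr_gt0|by rewrite divr_gt0|].
move=> q A' B' C' D' P Z S x eta z w sP HP zE wE Xi Xi' h h' T T'.
have pL' : rpsd L.
  move=> v; have [->|v0] := eqVneq v 0; first by rewrite mulmx0 mxE.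
  exact: ltW (pL v0).
pose Phi := row_mx Xi (col_mx z w).
have PhiE : Phi = col_mx (row_mx Z z) (C' *m T + D' *m row_mx Z z).
  by rewrite /Phi /Xi /T !mul_mx_row add_row_mx -wE -[RHS]block_mxEv block_mxEh.
have kt := kyp_trace sP0 sP sL pL' HP (X' := T') erefl PhiE.
have := lmi_main_form A B C D Ap Bp Cp Dp Y M sP0 sX Xi x w.
rewrite /= -zE -/Xi' -/Phi -/h -/h' -/L -/N => mf.
have := He (col_mx h w).
rewrite qfN mf !nsq_col nsq_rowvec => HN.
have trX : 0 <= \tr (Z *m Z^T) /\ \tr (Z *m Z^T) <= \tr (Xi *m Xi^T).
  rewrite -!nsq_rowvec nsq_ge0; split=> //.
  rewrite !nsq_rowvec /Xi tr_col_mx mul_col_row mxtrace_block lerDl.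
  by rewrite -nsq_rowvec nsq_ge0.
have zb : nsq z <= K1 * (nsq x + nsq w).
  have := HK1 (col_mx x w); rewrite mul_row_col -zE nsq_col.
  exact: le_trans (ler_norm _).
have := HK k (row_mx Z z).
rewrite [X in _ <= _ * X -> _](_ : _ = \tr (Z *m Z^T) + nsq z); last first.
  rewrite tr_row_mx mul_row_col linearD/=; congr (_ + _).
  by rewrite -[nsq z]qf1 qf_trace mul1mx.
have x0 := nsq_ge0 x; have w0 := nsq_ge0 w; have z0 := nsq_ge0 z.
have [Z0 ZX] := trX.
set s := \tr (row_mx Z z *m L *m _) => Hs.
have s1 : s <= K * (1 + K1) * (\tr (Xi *m Xi^T) + nsq x + nsq w).
  apply: le_trans Hs _; rewrite -mulrA ler_wpM2l//; nra.
have cs : e / c * s <= e / 2 * (\tr (Xi *m Xi^T) + nsq x + nsq w).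
  rewrite mulrAC ler_pdivrMr//.
  have : e * s <= e * (K * (1 + K1) * (\tr (Xi *m Xi^T) + nsq x + nsq w)).
    by rewrite ler_wpM2l// ltW.
  rewrite /c; nra.
have eT : 0 <= e * \tr (Xi *m Xi^T) by rewrite mulr_ge0// ?(ltW e0)// (le_trans Z0).
lra.
Qed.

(** The Lyapunov function is
    [V = h^T X h - tr (P0 Xi Y Xi^T) - tr (P T L T^T)], with [h = (Xi, x)] and
    [T = (S, eta)].  It dominates [|x|^2] by the third matrix inequality and
    [P <= 0], and at time 0 it only involves [x 0], as all filter and uncertainty states
    start at 0. *)
Lemma robust_bound : exists2 M0 : R, 0 < M0 &
  forall Delta, uncertainty (value_set P0) Delta ->
  forall x, state_trajectory A B C D Delta x ->
    x t @[t --> +oo] --> (0 : 'cV[R]_n) /\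
    forall t, 0 <= t -> enorm (x t) <= M0 * enorm (x 0).
Proof.
have [a [gamma [a0 gamma0 Hrate]]] := dissipation_rate.
have [c c0 Hc] := qf_coercive pS.
have [KX KX0 HX] := qf_bound X.
have [K1 K10 HK1] := dot_bound (row_mx 1%:M 0) (row_mx A B).
have pL' : rpsd L.
  move=> v; have [->|v0] := eqVneq v 0; first by rewrite mulmx0 mxE.
  exact: ltW (pL v0).
have r0 : 0 <= KX / c by rewrite divr_ge0// ltW.
have M0 : 0 < Num.sqrt (KX / c) + 1 by rewrite ltr_wpDl// sqrtr_ge0.
exists (Num.sqrt (KX / c) + 1) => // Delta Dunc x [acx [w [z [Lw Lz eqs]]]].
have [A' [B' [markov storage]]] := uncertainty_storage sP0 nR Dunc.
have [P [sP nP HP]] := storage _ gamma0.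
set C' := lti_C Delta in markov HP *; set D' := lti_D Delta in HP *.
have lz := L2e_mxlocint Lz.
have [eta [peta eta0 ioE]] := iomap_state markov lz.
have wE : {ae mu, forall t : R, 0 <= t -> w t = C' *m eta t + D' *m z t}.
  by apply: (ae_mono eqs) => t H t0; have [_ _ ->] := H t0; rewrite ioE.
have [Z [S [Z0 S0 pXi pT]]] := filtered_states Ap Bp lz peta eta0 wE.
set Xi := (fun t => col_mx (Z t) _) in pXi.
set T := (fun t => row_mx (S t) (eta t)) in pT.
have px : mxprimitive x (fun t => A *m x t + B *m w t).
  apply: mxprimitive_trajectory => //.
  by apply: (ae_mono eqs) => t H t0; have [] := H t0.
pose h t := col_mx (rowvec (Xi t)) (x t).
have ph := mxprimitive_col (mxprimitive_rowvec pXi) px.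
pose V t := qf X (h t) - \tr (P0 *m (Xi t *m Y *m (Xi t)^T)) - \tr (P *m (T t *m L *m (T t)^T)).
have pV := primitiveD (primitiveD (primitive_qf sX ph)
    (primitiveZ (-1) (primitive_trace_form P0 Y pXi)))
    (primitiveZ (-1) (primitive_trace_form P L pT)).
have VE : V = (fun t => qf X (h t) + -1 * \tr (P0 *m (Xi t *m Y *m (Xi t)^T)) +
    -1 * \tr (P *m (T t *m L *m (T t)^T))).
  by apply/funext => t; rewrite /V !mulN1r.
rewrite -VE in pV.
have pu := primitive_qf (trmx1 _ _) px.
have Vlow t : c * nsq (x t) <= V t.
  have h1 := Hc (h t); rewrite /h qf_storage nsq_col in h1.
  have h2 : 0 <= \tr (- P *m (T t *m L *m (T t)^T)).
    apply: trace_form_ge0 => //; first by rewrite linearN/= sP.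
    by move=> v; rewrite mulmxN mulNmx mxE oppr_ge0; exact: nP.
  rewrite mulNmx linearN/= in h2.
  have h3 : 0 <= c * nsq (rowvec (Xi t)) by rewrite mulr_ge0 ?nsq_ge0 ?(ltW c0).
  rewrite /V /h; lra.
have V00 : V 0 <= KX * nsq (x 0).
  have Xi0 : Xi 0 = 0 by rewrite /Xi Z0 S0 !mulmx0 addr0 col_mx0.
  have T0 : T 0 = 0 by rewrite /T S0 eta0 row_mx0.
  rewrite /V Xi0 T0 !(mul0mx, mulmx0) !mxtrace0 !subr0.
  apply: le_trans (ler_norm _) _; apply: le_trans (HX _) _.
  rewrite /h Xi0 rowvec0 nsq_col.
  have -> : nsq (0 : 'cV[R]_((k + l) * p)) = 0 by rewrite /nsq mulmx0 mxE.
  by rewrite add0r.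
have [] := lyapunov_decay (g := fun t => nsq (w t)) (K := 2 * K1) a0 _ pV pu.
- by rewrite mulr_ge0.
- move=> t t0; rewrite qf1 !nsq_ge0; split=> //.
  by apply: le_trans (Vlow t); rewrite mulr_ge0 ?nsq_ge0 ?(ltW c0).
- apply: (ae_mono eqs) => t H t0; have [_ zE] := H t0; rewrite ioE => wE'.
  have := Hrate _ A' B' C' D' P (Z t) (S t) (x t) (eta t) (z t) (w t) sP HP zE wE'.
  by rewrite /= qf1 !mulN1r.
- apply: aeW => t t0; rewrite mulmx1 qf1 normrM ger0_norm// -mulrA ler_pM2l//.
  have := HK1 (col_mx (x t) (w t)).
  by rewrite !mul_row_col mul1mx mul0mx addr0 nsq_col.
move=> Vdec Vlim; split.
  apply/cvgrPdist_le => /= e e0.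
  have [t1 t10 Ht] := Vlim (e ^+ 2) (exprn_gt0 2 e0).
  exists t1; split; first exact: num_real.
  move=> t /ltW tt; rewrite sub0r normrN.
  rewrite [leLHS]/Num.Def.normr/= mx_normrE (bigmax_le _ (ltW e0))//= => -[i j] _ /=.
  rewrite -(@ler_pXn2r _ 2)// ?nnegrE ?(ltW e0)// real_normK ?num_real//.
  by rewrite (ord1 j); apply: le_trans (le_nsq _ _) _; have := Ht t tt; rewrite qf1.
move=> t t0.
have enormE (v : 'cV[R]_n) : enorm v = Num.sqrt (nsq v) by rewrite /enorm nsqE.
have xb : nsq (x t) <= KX / c * nsq (x 0).
  rewrite mulrAC ler_pdivlMr// mulrC.
  exact: le_trans (Vlow t) (le_trans (Vdec t t0) V00).
apply: (@le_trans _ _ (Num.sqrt (KX / c) * enorm (x 0))).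
  by rewrite !enormE -sqrtrM// ler_wsqrtr.
by rewrite ler_wpM2r ?enorm_ge0// lerDl.
Qed.

End Robustness.

Theorem theorem7 (Rl : realType) (n k l npsi mpsi : nat)
    (A : 'M[Rl]_n) (B : 'M[Rl]_(n, l)) (C : 'M[Rl]_(k, n)) (D : 'M[Rl]_(k, l))
    (Q : 'M[Rl]_k) (S : 'M[Rl]_(k, l)) (R : 'M[Rl]_l)
    (P0 := block_mx Q S S^T R : 'M[Rl]_(k + l))
    (HP0 : P0 \is symmetricmx)
    (HR : negsemidefmx R)
    (Apsi : 'M[Rl]_npsi) (Bpsi : 'cV[Rl]_npsi)
    (Cpsi : 'M[Rl]_(mpsi, npsi)) (Dpsi : 'cV[Rl]_mpsi)
    (HApsi : hurwitz Apsi)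
    (APsi := Psimx k l Apsi : 'M[Rl]_((k + l) * npsi))
    (BPsi := Psimx1 k l Bpsi : 'M[Rl]_((k + l) * npsi, k + l))
    (CPsi := Psimx k l Cpsi : 'M[Rl]_((k + l) * mpsi, (k + l) * npsi))
    (DPsi := Psimx1 k l Dpsi : 'M[Rl]_((k + l) * mpsi, k + l))
    (C0 := col_mx C 0 : 'M[Rl]_(k + l, n))
    (DI := col_mx D 1%:M : 'M[Rl]_(k + l, l))
    (F := block_mx 1%:M 0 Apsi Bpsi : 'M[Rl]_(npsi + npsi, npsi + 1))
    (G := row_mx Cpsi Dpsi : 'M[Rl]_(mpsi, npsi + 1))
    (H := col_mx (col_mx
            (col_mx (row_mx (row_mx 1%:M 0) 0)
                    (row_mx (row_mx 0 1%:M) 0))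
            (col_mx (row_mx (row_mx APsi (BPsi *m C0)) (BPsi *m DI))
                    (row_mx (row_mx 0 A) B)))
            (row_mx (row_mx CPsi (DPsi *m C0)) (DPsi *m DI))
       : 'M[Rl]_(((k + l) * npsi + n) + ((k + l) * npsi + n) + (k + l) * mpsi,
                 (k + l) * npsi + n + l))
    (HLMI : exists (X : 'M[Rl]_((k + l) * npsi + n))
                   (Y : 'M[Rl]_npsi) (M : 'M[Rl]_mpsi),
       [/\ X \is symmetricmx, Y \is symmetricmx & M \is symmetricmx] /\
       [/\ posdefmx (F^T *m block_mx 0 Y Y 0 *m F + G^T *m M *m G),
           negdefmx (H^T *m block_mx (block_mx 0 X X 0) 0 0 (P0 *t M) *m H)
         & posdefmx (X - block_mx (P0 *t Y) 0 0 0)]) :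
  robustly_stable A B C D (value_set P0).
Proof.
have [X [Y [M [[sX _ _] [[sL pL] [_ nN] [_ pS]]]]]] := HLMI.
have sP0 := symmetricmx_tr HP0.
split.
  move=> V0; exact: (well_posed sP0 (symmetricmx_tr sX) pL nN).
apply: (robust_bound sP0 (symmetricmx_tr sX) (symmetricmx_tr sL) pL nN pS) => y.
by rewrite /P0 block_mxKdr; have [_] := HR; exact.
Qed.
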